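(* Let $X$ be a one-dimensional Lévy process with characteristics $(b,c,F)$ and assume $c>0$; put $\sigma=\sqrt c$. Let $\Delta_n>0$ with $\Delta_n\to0$, $V^n(f)_t=\sum_{i=1}^{[t/\Delta_n]}f(\Delta^n_iX)$ and $V'^n(f)_t=\sum_{i=1}^{[t/\Delta_n]}f(\Delta^n_iX/\sqrt{\Delta_n})$. (i) If $f\in\mathcal E_r$ for some $r\in(0,2)$, then $\Delta_n^{1-r/2}V^n(f)_t$ converges u.c.p. to $c^{r/2}\mu_rt$. The same holds for $r\in[2,\infty)$ if there is no jump (i.e. $F=0$). (ii) If $f$ is a bounded Borel function, then $\Delta_nV'^n(f)_t$ converges u.c.p. to $t\,\mathbb E(f(\sigma U))$.
   Context: $X$ is a Lévy process with $X_0=0$; its characteristics are $b\in\mathbb R$, $c\ge0$ and a measure $F$ on $\mathbb R$ with $F(\{0\})=0$, $\int(x^2\wedge1)F(dx)<\infty$, such that $\mathbb E(e^{iuX_t})=\exp t\big(iub-\tfrac{cu^2}2+\int F(dx)(e^{iux}-1-iux1_{\{|x|\le1\}})\big)$. $\Delta^n_iX=X_{i\Delta_n}-X_{(i-1)\Delta_n}$. $U$ is a generic $\mathcal N(0,1)$ variable and $\mu_r=\mathbb E(|U|^r)$. For $r>0$, $\mathcal E_r$ is the set of Borel functions $f:\mathbb R\to\mathbb R$ of polynomial growth with $f(x)\sim|x|^r$ as $x\to0$ (and $f(0)=0$). Processes $Y^n$ converge u.c.p. to $Y$ if $\sup_{s\le t}|Y^n_s-Y_s|\to0$ in probability for all $t>0$.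 *)

(* Defs.v *)
From HB Require Import structures.
From mathcomp Require Import all_boot all_order all_algebra complex.
From mathcomp Require Import all_classical all_reals all_analysis.

Set Implicit Arguments.
Unset Strict Implicit.
Unset Printing Implicit Defensive.

Import Order.TTheory GRing.Theory Num.Theory.
Import numFieldNormedType.Exports.

Local Open Scope classical_set_scope.
Local Open Scope ring_scope.
Local Open Scope complex_scope.

(* Complex exponential: exp (x + iy) = e^x (cos y + i sin y). *)
Definition cexp (R : realType) (z : R[i]) : R[i] :=
  (expR (complex.Re z))%:C * (cos (complex.Im z) +i* sin (complex.Im z)).

Definition cintegral (d : measure_display) (T : measurableType d)
    (R : realType) (mu : {measure set T -> \bar R}) (f : T -> R[i]) : R[i] :=
  Rintegral mu setT (fun x => complex.Re (f x))
    +i* Rintegral mu setT (fun x => complex.Im (f x)).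

Section Processes.
Variables (R : realType) (d : measure_display) (T : measurableType d).
Variable P : probability T R.

Definition mutually_independent (I : finType) (Y : I -> T -> R) : Prop :=
  forall (J : {set I}) (B : I -> set R), (forall i, measurable (B i)) ->
    P (\bigcap_(i in [set` J]) (Y i @^-1` B i)) =
    (\prod_(i in J) P (Y i @^-1` B i))%E.

Definition cadlag (x : R -> R) : Prop :=
  (forall t, 0 <= t -> x s @[s --> t^'+] --> x t) /\
  (forall t, 0 < t -> cvg (x s @[s --> t^'-])).

(* A process is indexed by R, but only its values at times t >= 0 matter. *)
Record levy_process (X : R -> {RV P >-> R}) : Prop := LevyProcess {
  levy_start : {ae P, forall w, X 0 w = 0} ;
  levy_cadlag : {ae P, forall w, cadlag (fun t => X t w)} ;
  levy_stationary : forall (s h : R) (B : set R), 0 <= s -> 0 <= h ->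
    measurable B ->
    P ((fun w => X (s + h) w - X s w) @^-1` B) =
    P ((fun w => X h w - X 0 w) @^-1` B) ;
  levy_independent : forall (n : nat) (t : nat -> R), 0 <= t 0%N ->
    {homo t : i j / (i <= j)%N >-> i <= j} ->
    mutually_independent (fun (i : 'I_n) w => X (t i.+1) w - X (t i) w) }.

Definition levy_measure (F : {measure set R -> \bar R}) : Prop :=
  F [set 0] = 0%E /\ (\int[F]_x (Num.min (x ^+ 2) 1)%:E < +oo)%E.

Definition levy_exponent (b c : R) (F : {measure set R -> \bar R}) (u : R)
    : R[i] :=
  'i * (u * b)%:C - (c * u ^+ 2 / 2)%:C +
  cintegral F (fun x =>
    cexp ('i * (u * x)%:C) - 1 - 'i * (u * x * \1_[set y : R | `|y| <= 1] x)%:C).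

Definition has_characteristics (X : R -> {RV P >-> R}) (b c : R)
    (F : {measure set R -> \bar R}) : Prop :=
  [/\ 0 <= c, levy_measure F &
    forall t u : R, 0 <= t ->
      cintegral P (fun w => cexp ('i * (u * X t w)%:C)) =
      cexp (t%:C * levy_exponent b c F u)].

Definition increment (X : R -> T -> R) (h : R) (i : nat) (w : T) : R :=
  X (i%:R * h) w - X (i.-1%:R * h) w.

Definition power_variation (X : R -> T -> R) (h : R) (f : R -> R)
    (t : R) (w : T) : R :=
  \sum_(1 <= i < (Num.truncn (t / h)).+1) f (increment X h i w).

Definition normalized_power_variation (X : R -> T -> R) (h : R) (f : R -> R)
    (t : R) (w : T) : R :=
  \sum_(1 <= i < (Num.truncn (t / h)).+1) f (increment X h i w / Num.sqrt h).

Definition sup_distance (y z : R -> R) (t : R) : \bar R :=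
  ereal_sup [set `|y s - z s|%:E | s in `[0, t]].

Definition ucp_cvg (Y : nat -> R -> T -> R) (Z : R -> T -> R) : Prop :=
  forall t : R, 0 < t -> forall e : R, 0 < e ->
    P [set w | (e%:E < sup_distance (Y n ^~ w) (Z ^~ w) t)%E]
      @[n --> \oo] --> 0%E.

End Processes.

Definition gaussian_expectation (R : realType) (g : R -> R) : R :=
  fine 'E_(normal_prob (0 : R) 1)[g].

Definition gaussian_moment (R : realType) (r : R) : R :=
  gaussian_expectation (fun u : R => `|u| `^ r).

Definition polynomial_growth (R : realType) (f : R -> R) : Prop :=
  exists (K : R) (p : nat), forall x, `|f x| <= K * (1 + `|x| ^+ p).

(* [f ~_(0^') g] ranges over the punctured neighborhoods of 0 and means
   f / g --> 1 here, since |x| `^ r vanishes only at 0. *)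
Definition class_E (R : realType) (r : R) (f : R -> R) : Prop :=
  [/\ measurable_fun setT f, polynomial_growth f, f 0 = 0 &
    f ~_(0^') (fun x : R => `|x| `^ r)].

(* Main.v *)
Require Import Defs.
From HB Require Import structures.
From mathcomp Require Import all_boot all_order all_algebra complex.
From mathcomp Require Import all_classical all_reals all_analysis.
From mathcomp Require Import measurable_realfun ring lra.

Set Implicit Arguments.
Unset Strict Implicit.
Unset Printing Implicit Defensive.

Import Order.TTheory GRing.Theory Num.Theory.
Import numFieldNormedType.Exports.

Local Open Scope classical_set_scope.
Local Open Scope ring_scope.

(** The characteristic function of X_h / sqrt h has modulus at most
    exp (- c u^2 / 2) and converges to that of N(0, c).  The Gaussian domination
    gives all these laws densities by Fourier inversion, and the densities
    converge pointwise, so Scheffe's lemma yields E g (X_h / sqrt h) -->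
    E g (sigma U) for every bounded Borel g, with no continuity assumption.
    For bounded f the increments are i.i.d. and bounded, and a second-moment
    bound on a grid of fixed mesh gives the uniform convergence.

    For f in E_r, truncate at increments of size k sqrt h: the truncated
    functional is the bounded case, with a limit tending to c^(r/2) mu_r t as
    k grows.  With W_s(x) = 1 - exp (- (s x)^2 / 2) = E (1 - cos (s x U)),
    Fubini expresses E W_s(X_h) through the characteristic function and bounds
    it by h (kappa(s) + O(h)), where kappa(s) --> 0 as s --> 0.
    If r < 2, the remaining part is dominated by W_1 outside an event of
    probability controlled by W_s.  Without jumps X_h is Gaussian and an
    exponential moment suffices for every r. *)

(** * Integrals of bounded functions, product measures and densities *)

(** The test functions are only Borel, so weak convergence of X_h / sqrt h is too little and
    convergence in total variation is needed. It holds because jumps contribute a nonpositive real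
    part to the exponent: the factor exp (- c u^2 / 2) survives the scaling with the same c for
    every h, and this one integrable bound serves all inversion integrals. For unbounded f the
    obstacle is that F only integrates min (x^2, 1), so increments may have no moments. If r < 2 and
    |x| > k sqrt h, then h^(1 - r/2) |x|^r <= k^(r - 2) x^2, which is small in k uniformly in h;
    near 0 the bounded weight W_1 stands in for x^2, and E W_1(X_h) = O(h). Increments of size
    between a fixed eta and 1/s carry the vanishing factor h^(1 - r/2). Those beyond 1/s, where f
    may be large, are excluded: their expected number before t is of order t (kappa(s) + O(h)).
    Hence the parameters are chosen in the order s, k, n. Since f may change sign, V^n is not
    monotone in t; only the tail, summed in absolute value, is, so its supremum in time is its final
    value. *)

Section integral_tools.
Context d (T : measurableType d) (R : realType).
Implicit Types (mu : {measure set T -> \bar R}) (f g : T -> R).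

Lemma bounded_integrable mu f (M : R) : (mu setT < +oo)%E ->
  measurable_fun setT f -> (forall x, `|f x| <= M) ->
  mu.-integrable setT (EFin \o f).
Proof.
move=> muT mf fM; apply: measurable_bounded_integrable => //.
by exists M; split; rewrite ?num_real// => y My x _; exact: le_trans (fM x) (ltW My).
Qed.

Lemma probability_lty (P : probability T R) : (P setT < +oo)%E.
Proof. by rewrite probability_setT ltry. Qed.

Lemma integrable_dominated mu f g : measurable_fun setT f ->
  mu.-integrable setT (EFin \o g) -> (forall x, `|f x| <= g x) ->
  mu.-integrable setT (EFin \o f).
Proof.
move=> mf ig fg; apply: le_integrable ig => //; first exact/measurable_EFinP.
by move=> x _ /=; rewrite lee_fin (le_trans (fg x))// ler_norm.
Qed.

Lemma integrable_EFinP mu f : mu.-integrable setT (EFin \o f) ->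
  (\int[mu]_x f x)%:E = (\int[mu]_x (f x)%:E)%E.
Proof. by move=> fi; rewrite /Rintegral fineK// integrable_fin_num. Qed.

Lemma Rintegral_dominated_cvg mu (f_ : nat -> T -> R) f g :
  (forall n, measurable_fun setT (f_ n)) -> measurable_fun setT f ->
  {ae mu, forall x, f_ n x @[n --> \oo] --> f x} ->
  mu.-integrable setT (EFin \o g) -> (forall n x, `|f_ n x| <= g x) ->
  \int[mu]_x f_ n x @[n --> \oo] --> \int[mu]_x f x.
Proof.
move=> mf_ mf cf ig fg.
have [||||i0 _ H] := @dominated_convergence _ _ _ mu setT measurableT
    (fun n x => (f_ n x)%:E) (EFin \o f) (EFin \o g) _ _ _ ig.
- by move=> n; exact/measurable_EFinP.
- exact/measurable_EFinP.
- by apply: filterS cf => x cx _; apply: cvg_EFin => //; exact: nearW.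
- by apply: aeW => x n _ /=; rewrite lee_fin.
apply: (fine_cvg (F := \oo)); rewrite fineK ?integrable_fin_num//.
Qed.

Lemma Rintegral_probability_cst (P : probability T R) (r : R) : \int[P]_x r = r.
Proof. by rewrite Rintegral_cst// [X in fine X]probability_setT mulr1. Qed.

Lemma Rintegral_bounded_le (P : probability T R) f (M : R) :
  measurable_fun setT f -> (forall x, `|f x| <= M) -> `|\int[P]_x f x| <= M.
Proof.
move=> mf fM; have fi := bounded_integrable (probability_lty P) mf fM.
apply: le_trans (le_normr_Rintegral _ fi) _ => //.
rewrite -[leRHS](Rintegral_probability_cst P).
apply: le_Rintegral => //.
- by apply: (bounded_integrable (M := M)) => //; [exact: probability_lty|exact: measurableT_comp|move=> x; rewrite normr_id].
- by apply: (bounded_integrable (M := `|M|)) => //; exact: probability_lty.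
Qed.

End integral_tools.

Section product_tools.
Context d1 d2 (T1 : measurableType d1) (T2 : measurableType d2) (R : realType).
Variables (P1 : probability T1 R) (P2 : probability T2 R).
Variables (f : T1 * T2 -> R) (M : R).
Hypotheses (mf : measurable_fun setT f) (fM : forall z, `|f z| <= M).

Lemma bounded_product_integrable :
  (P1 \x P2)%E.-integrable setT (EFin \o f).
Proof.
apply: (bounded_integrable (M := M)) => //.
exact: probability_lty.
Qed.

Let i1 x : P2.-integrable setT (EFin \o (fun y => f (x, y))).
Proof.
apply: (bounded_integrable (M := M)) => //; first exact: probability_lty.
exact: measurableT_comp mf (pair1_measurable x).
Qed.

Let i2 y : P1.-integrable setT (EFin \o (fun x => f (x, y))).
Proof.
apply: (bounded_integrable (M := M)) => //; first exact: probability_lty.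
exact: measurableT_comp mf (pair2_measurable y).
Qed.

Lemma measurable_Rintegral_l : measurable_fun setT (fun x => \int[P2]_y f (x, y)).
Proof.
apply/measurable_EFinP; have := measurable_fubini_F bounded_product_integrable.
by apply: eq_measurable_fun => x _; rewrite /fubini_F /= integrable_EFinP.
Qed.

Lemma measurable_Rintegral_r : measurable_fun setT (fun y => \int[P1]_x f (x, y)).
Proof.
apply/measurable_EFinP; have := measurable_fubini_G bounded_product_integrable.
by apply: eq_measurable_fun => y _; rewrite /fubini_G /= integrable_EFinP.
Qed.

Lemma Rintegral_Fubini :
  \int[P1]_x \int[P2]_y f (x, y) = \int[P2]_y \int[P1]_x f (x, y).
Proof.
have := Fubini bounded_product_integrable.
rewrite [X in _ = X -> _](_ : _ = \int[P2]_y (\int[P1]_x f (x, y))%:E)%E; last first.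
  by apply: eq_integral => y _; rewrite integrable_EFinP.
rewrite [X in X = _ -> _](_ : _ = \int[P1]_x (\int[P2]_y f (x, y))%:E)%E; last first.
  by apply: eq_integral => y _; rewrite integrable_EFinP.
by rewrite /Rintegral => ->.
Qed.

Lemma Rintegral_product :
  \int[(P1 \x P2)%E]_z f z = \int[P1]_x \int[P2]_y f (x, y).
Proof.
rewrite {1}/Rintegral -(integral12_prod_meas1 bounded_product_integrable).
by congr fine; apply: eq_integral => y _; rewrite integrable_EFinP.
Qed.

End product_tools.

(** * Integration against a density *)

Section density.
Context d (T : measurableType d) (R : realType).
Variables (mu nu : {measure set T -> \bar R}) (p : T -> R).
Hypotheses (mp : measurable_fun setT p) (p0 : forall x, 0 <= p x).
Hypothesis nuE : forall A, measurable A -> nu A = (\int[mu]_(x in A) (p x)%:E)%E.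

Import HBNNSimple.

(** On a simple function the identity is [nuE] on each level set; both sides pass to the limit by
    monotone convergence because [p] is nonnegative. *)
Lemma ge0_integral_density (f : T -> R) : measurable_fun setT f ->
  (forall x, 0 <= f x) ->
  (\int[nu]_x (f x)%:E = \int[mu]_x (f x * p x)%:E)%E.
Proof.
move=> mf f0; have mEf : measurable_fun setT (EFin \o f) by exact/measurable_EFinP.
pose f_ := nnsfun_approx measurableT mEf.
have cf x : (f_ n x)%:E @[n --> \oo] --> (f x)%:E.
  by apply: (@cvg_nnsfun_approx _ _ _ _ measurableT _ mEf) => // y _; rewrite lee_fin.
transitivity (limn (fun n => \int[nu]_x (f_ n x)%:E))%E.
  rewrite -monotone_convergence//.
  - by apply: eq_integral => x _; apply/esym/cvg_lim.
  - by move=> n; exact/measurable_EFinP.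
  - by move=> n x _; rewrite lee_fin.
  - by move=> x _ a b ab; rewrite lee_fin; exact/lefP/nd_nnsfun_approx.
transitivity (limn (fun n => \int[mu]_x (f_ n x * p x)%:E))%E; last first.
  rewrite -monotone_convergence//.
  - apply: eq_integral => x _; apply/cvg_lim => //.
    rewrite EFinM; under eq_fun do rewrite EFinM.
    apply: cvgeZr => //.
  - by move=> n; apply/measurable_EFinP; exact: measurable_funM.
  - by move=> n x _; rewrite lee_fin mulr_ge0.
  - move=> x _ a b ab; rewrite lee_fin ler_wpM2r//.
    exact/lefP/nd_nnsfun_approx.
congr (limn _); apply/funext => n.
rewrite (eq_integral (fun x => \sum_(k \in range (f_ n)) (k * \1_(f_ n @^-1` [set k]) x)%:E)%E); last first.
  by move=> x _; rewrite [in LHS](fimfunE (f_ n)) -fsumEFin.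
rewrite [RHS](eq_integral (fun x => \sum_(k \in range (f_ n)) (k * \1_(f_ n @^-1` [set k]) x * p x)%:E)%E); last first.
  move=> x _; rewrite [in LHS](fimfunE (f_ n)) EFinM -fsumEFin// ge0_mule_fsuml.
    by apply: eq_fsbigr => k _; rewrite EFinM.
  by move=> k; rewrite nnfun_muleindic_ge0.
rewrite !ge0_integral_fsum//; last 4 first.
- move=> k; apply/measurable_EFinP/measurable_funM => //.
  exact: measurable_funM.
- by move=> k x _; rewrite lee_fin mulr_ge0// -lee_fin EFinM nnfun_muleindic_ge0.
- by move=> k; apply/measurable_EFinP/measurable_funM.
- by move=> k x _; rewrite EFinM nnfun_muleindic_ge0.
apply: eq_fsbigr => k kr; rewrite (integralZl_indic _ (fun k => f_ n @^-1` [set k]))//; last first.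
  by move=> k0; rewrite preimage_nnfun0.
have k0 : 0 <= k by move: kr; rewrite inE => -[x _ <-].
rewrite integral_indic// setIT nuE//.
under [RHS]eq_integral do rewrite -mulrA EFinM.
rewrite [RHS]ge0_integralZl//.
- congr *%E; rewrite integral_mkcond; apply: eq_integral => x _.
  by rewrite patchE indicE; case: ifPn => xk; rewrite ?(negbTE xk) ?xk ?mul1r ?mul0r.
- by apply/measurable_EFinP; exact: measurable_funM.
- by move=> x _; rewrite lee_fin mulr_ge0.
Qed.

Lemma Rintegral_density (f : T -> R) (M : R) : (nu setT < +oo)%E ->
  measurable_fun setT f -> (forall x, `|f x| <= M) ->
  \int[nu]_x f x = \int[mu]_x (f x * p x).
Proof.
move=> nuT mf fM.
have p1 : mu.-integrable setT (EFin \o p).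
  apply/integrableP; split; first exact/measurable_EFinP.
  by under eq_integral do rewrite /= ger0_norm//; rewrite -nuE.
(* Adding [M] reduces the signed case to the nonnegative one; the constant is subtracted again at
   the end, which uses that [nu] is finite. *)
have M0 x : 0 <= f x + M by have := fM x; rewrite ler_norml; lra.
have ifp (g : T -> R) (K : R) : measurable_fun setT g -> (forall x, `|g x| <= K) ->
    mu.-integrable setT (EFin \o (fun x => g x * p x)).
  move=> mg gK; apply: (@integrable_dominated _ _ _ _ _ (fun x => K * p x)).
  - exact: measurable_funM.
  - exact: (integrableZl measurableT K p1).
  - by move=> x; rewrite normrM (ger0_norm (p0 x)) ler_wpM2r.
have E : \int[nu]_x (f x + M) = \int[mu]_x ((f x + M) * p x).
  rewrite /Rintegral ge0_integral_density//; exact: measurable_funD.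
have E1 : \int[nu]_x M = \int[mu]_x (M * p x).
  rewrite Rintegral_cst// RintegralZl//; congr (_ * _).
  by rewrite /Rintegral nuE.
have : \int[nu]_x (f x + M) - \int[nu]_x M = \int[mu]_x ((f x + M) * p x) - \int[mu]_x (M * p x).
  by rewrite E E1.
rewrite -RintegralB//.
- rewrite -RintegralB//.
  + under eq_Rintegral do rewrite addrK.
    by move=> ->; apply: eq_Rintegral => x _; rewrite -mulrBl addrK.
  + apply: (ifp _ (M + `|M|)); first exact: measurable_funD.
    by move=> x; rewrite (le_trans (ler_normD _ _))// lerD2r.
  + by apply: (ifp (cst M) `|M|) => //.
- apply: (bounded_integrable (M := M + `|M|)) => //; first exact: measurable_funD.
  by move=> x; rewrite (le_trans (ler_normD _ _))// lerD2r.
- by apply: (bounded_integrable (M := `|M|)).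
Qed.

End density.

(** * The cosine transform of Gaussian laws *)

Section gaussian_transform.
Context (R : realType).
Local Notation mu := (@lebesgue_measure R).
Local Notation pdf := (@normal_pdf R 0).

Lemma normal_pdf_expRE (m s x : R) : s != 0 ->
  normal_pdf m s x = normal_peak s * expR (- (x - m) ^+ 2 / (2 * s ^+ 2)).
Proof. by move=> s0; rewrite normal_pdfE// /normal_fun (mulr_natl (s ^+ 2) 2). Qed.

Lemma is_derive_normal_pdf (s x : R) : s != 0 ->
  is_derive x 1 (pdf s) (- (x / s ^+ 2) * pdf s x).
Proof.
move=> s0.
rewrite (_ : pdf s = (fun x => normal_peak s * expR (- (x - 0) ^+ 2 / (2 * s ^+ 2)))); last first.
  by apply/funext => y; rewrite normal_pdf_expRE.
have s20 : s ^+ 2 != 0 by rewrite expf_neq0.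
apply: is_derive_eq.
rewrite /GRing.scale /= subr0; field.
by [].
Qed.

Lemma normal_peak_double (s : R) : normal_peak (2 * s) = normal_peak s / 2.
Proof.
rewrite /normal_peak -invfM; congr (_^-1).
rewrite (_ : (2 * s) ^+ 2 * pi *+ 2 = (s ^+ 2 * pi *+ 2) * 2 ^+ 2); last by ring.
by rewrite sqrtrM ?sqrtr_sqr ?ger0_norm// mulrn_wge0// mulr_ge0 ?sqr_ge0 ?pi_ge0.
Qed.

(** Doubling the deviation frees 3/8 (x / s)^2 in the exponent, and completing the square absorbs a
    |x| into it. The factor 2 is the ratio of the two peaks. *)
Lemma expR_normal_pdf_le (a s x : R) : 0 < s ->
  expR (a * `|x|) * pdf s x <= 2 * expR (a ^+ 2 * s ^+ 2) * pdf (2 * s) x.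
Proof.
move=> s0; have sn0 : s != 0 by rewrite gt_eqF.
rewrite !normal_pdf_expRE ?mulf_neq0// normal_peak_double.
rewrite (mulrCA (expR _)) -expRD.
rewrite [leRHS](_ : _ = normal_peak s * expR (a ^+ 2 * s ^+ 2 +
   - (x - 0) ^+ 2 / (2 * (2 * s) ^+ 2))); last by rewrite expRD; field.
rewrite ler_pM2l ?normal_peak_gt0// ler_expR subr0.
rewrite -[x ^+ 2]real_normK ?num_real//.
set y := `|x|.
rewrite -subr_ge0 (_ : _ - _ = 3 / 8 * (y / s - 4 / 3 * (a * s)) ^+ 2 + (a * s) ^+ 2 / 3); last first.
  by field.
by apply: addr_ge0; apply: mulr_ge0; rewrite ?sqr_ge0//; lra.
Qed.

Lemma integrable_expR_normal_pdf (a s : R) : 0 < s ->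
  mu.-integrable setT (EFin \o (fun x => expR (a * `|x|) * pdf s x)).
Proof.
move=> s0.
apply: (@integrable_dominated _ _ R mu _ (fun x => 2 * expR (a ^+ 2 * s ^+ 2) * pdf (2 * s) x)).
- apply: measurable_funM; last exact: measurable_normal_pdf.
  by apply: measurableT_comp => //; apply: measurable_funM => //; exact: measurableT_comp.
- exact: (integrableZl measurableT _ (integrable_normal_pdf 0 (2 * s))).
- move=> x; rewrite ger0_norm ?mulr_ge0 ?expR_ge0 ?normal_pdf_ge0//.
  exact: expR_normal_pdf_le.
Qed.

Lemma normr_le_expR (x : R) : `|x| <= expR `|x|.
Proof. by apply: le_trans (expR_ge1Dx _); rewrite lerDr. Qed.

Lemma integrable_normr_normal_pdf (s : R) : 0 < s ->
  mu.-integrable setT (EFin \o (fun x => `|x| * pdf s x)).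
Proof.
move=> s0; apply: integrable_dominated (integrable_expR_normal_pdf 1 s0) _.
- apply: measurable_funM; last exact: measurable_normal_pdf.
  exact: normr_measurable.
- move=> x; rewrite normrM normr_id (ger0_norm (normal_pdf_ge0 _ _ _)).
  by rewrite ler_wpM2r ?normal_pdf_ge0// mul1r normr_le_expR.
Qed.

Lemma normal_pdf_cvg0 (s : R) (e : R) : 0 < s -> `|e| = 1 ->
  pdf s (e * n%:R) @[n --> \oo] --> 0.
Proof.
move=> s0 e1.
have le n : pdf s (e * n%:R) <= 2 * expR (s ^+ 2) * normal_peak (2 * s) * expR (- n%:R).
  have := @expR_normal_pdf_le 1 s (e * n%:R) s0.
  rewrite mul1r normrM e1 mul1r ger0_norm// expr1n mul1r => h.
  rewrite expRN ler_pdivlMr ?expR_gt0// mulrC (le_trans h)//.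
  by rewrite ler_wpM2l ?mulr_ge0 ?expR_ge0// normal_pdf_ub// mulf_neq0// gt_eqF.
apply: (@squeeze_cvgr _ _ _ _ (cst 0) (fun n => 2 * expR (s ^+ 2) * normal_peak (2 * s) * expR (- n%:R))).
- by apply: nearW => n; rewrite normal_pdf_ge0 le.
- exact: cvg_cst.
- rewrite -[X in _ --> X](mulr0 (2 * expR (s ^+ 2) * normal_peak (2 * s))).
  by apply: cvgMr; exact: cvgn_expR.
Qed.

(** Integration by parts on the whole line with vanishing boundary terms: the fundamental theorem on
    symmetric intervals, then domination by |f|. *)
Lemma Rintegral_derive_eq0 (F f : R -> R) :
  (forall x : R, is_derive x 1 F (f x)) -> continuous f ->
  mu.-integrable setT (EFin \o f) ->
  F n%:R @[n --> \oo] --> 0 -> F (- n%:R) @[n --> \oo] --> 0 ->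
  \int[mu]_x f x = 0.
Proof.
move=> dF cf fi Fp Fn.
(* [n.+1] keeps the interval nondegenerate, as the fundamental theorem requires. *)
pose g (n : nat) x := f x * \1_(`[- n.+1%:R, n.+1%:R]%classic : set R) x.
have mf : measurable_fun setT f by apply/measurable_EFinP; exact: measurable_int fi.
have gE n : \int[mu]_x g n x = F n.+1%:R - F (- n.+1%:R).
  have ab : - n.+1%:R < n.+1%:R :> R by rewrite gtrN.
  have cF : continuous F by move=> x; apply/differentiable_continuous/derivable1_diffP.
  have := @continuous_FTC2 R f F (- n.+1%:R) n.+1%:R ab _ _ _.
  rewrite /Rintegral.
  move=> H.
  rewrite (_ : (\int[mu]_x (g n x)%:E)%E = (\int[mu]_(x in `[(- n.+1%:R)%R, n.+1%:R]) (f x)%:E)%E).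
    rewrite H//=.
    - exact: continuous_subspaceT.
    - split.
      + by move=> x _.
      + by apply: cvg_at_right_filter; exact: cF.
      + by apply: cvg_at_left_filter; exact: cF.
    - by move=> x _; rewrite derive1E derive_val.
  rewrite [RHS]integral_mkcond; apply: eq_integral => x _.
  by rewrite /g patchE indicE; case: ifPn => xk; rewrite ?(negbTE xk) ?xk ?mulr1 ?mulr0.
have : \int[mu]_x g n x @[n --> \oo] --> \int[mu]_x f x.
  apply: (@Rintegral_dominated_cvg _ _ R mu _ _ (fun x => `|f x|)) => //.
  - by move=> n; apply: measurable_funM => //; exact: measurable_indic.
  - apply: aeW => x; apply: (@cvg_near_cst _ _ _ _ \oo).
    near=> n; rewrite /g indicE mem_set ?mulr1//= in_itv/= -ler_norml.
    rewrite (@le_trans _ _ n%:R) ?ler_nat//.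
    by near: n; exact: nbhs_infty_ger.
  - exact: integrable_norm.
  - move=> n x; rewrite /g normrM ler_piMr// indicE.
    by case: (_ \in _); rewrite ?normr1 ?normr0.
under eq_fun do rewrite gE.
move=> c1.
have c2 : F n.+1%:R - F (- n.+1%:R) @[n --> \oo] --> (0 - 0 : R).
  apply: cvgB.
  - by rewrite (cvg_shiftS (fun n => F n%:R)).
  - by rewrite (cvg_shiftS (fun n => F (- n%:R))).
by rewrite subr0 in c2; exact: (cvg_unique _ c1 c2).
Unshelve. all: by end_near. Qed.


(** As a function of v the transform [k] solves k' = - s^2 v k with k(0) = cos th; this differential
    equation takes the place of contour integration. *)
Lemma normal_cos_transform (s u th : R) : 0 < s ->
  \int[mu]_x (cos (u * x + th) * pdf s x) = cos th * expR (- (s ^+ 2 * u ^+ 2 / 2)).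
Proof.
move=> s0; have sn0 : s != 0 by rewrite gt_eqF.
pose f (v x : R) : R := cos (v * x + th) * pdf s x.
pose h (v x : R) : R := - (x * sin (v * x + th)) * pdf s x.
pose k (v : R) : R := \int[mu]_x f v x.
have mlin v : measurable_fun setT (fun x : R => v * x + th).
  by apply: measurable_funD => //; exact: measurable_funM.
have mcos v : measurable_fun setT (fun x : R => cos (v * x + th)).
  by apply: measurableT_comp => //; apply: continuous_measurable_fun; exact: continuous_cos.
have msin v : measurable_fun setT (fun x : R => sin (v * x + th)).
  by apply: measurableT_comp => //; apply: continuous_measurable_fun; exact: continuous_sin.
have if_ v : mu.-integrable setT (EFin \o f v).
  apply: (@integrable_dominated _ _ R mu _ (pdf s)).
  - apply: measurable_funM; last exact: measurable_normal_pdf.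
    exact: mcos.
  - exact: integrable_normal_pdf.
  - move=> x; rewrite normrM (ger0_norm (normal_pdf_ge0 _ _ _)).
    by rewrite ler_piMl ?normal_pdf_ge0 ?cos_max.
have hle v x : `|h v x| <= `|x| * pdf s x.
  rewrite normrM (ger0_norm (normal_pdf_ge0 _ _ _)) normrN normrM.
  by rewrite ler_wpM2r ?normal_pdf_ge0// ler_piMr ?sin_max.
have ih v : mu.-integrable setT (EFin \o h v).
  apply: (@integrable_dominated _ _ R mu _ (fun x => `|x| * pdf s x)).
  - apply: measurable_funM; last exact: measurable_normal_pdf.
    by apply: measurable_funN; apply: measurable_funM => //; exact: msin.
  - exact: integrable_normr_normal_pdf.
  - exact: hle.
have df (v x : R) : is_derive v 1 (f ^~ x) (h v x).
  have -> : h v x = - sin (v * x + th) * x * pdf s x by rewrite /h; ring.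
  rewrite /f; apply: is_derive_eq; rewrite /GRing.scale/=; ring.
have dfE (v x : R) : partial1of2 f v x = h v x by rewrite partial1of2E derive_val.
have dk (v : R) : is_derive v 1 k (\int[mu]_x h v x).
  (* The dominating function |x| [pdf] does not depend on v, so the radius 1 is arbitrary. *)
  have Iv : `]v - 1, v + 1[%classic v by rewrite /= in_itv/= gtrBl ltrDl ltr01.
  have E : derive1 k v = \int[mu]_x h v x.
    rewrite (@differentiation_under_integral R _ _ mu f setT measurableT v (v - 1) (v + 1) Iv _ _ (fun x => `|x| * pdf s x)) => //.
    - by apply: eq_Rintegral => x _; rewrite dfE.
    - by move=> x; rewrite mulr_ge0 ?normal_pdf_ge0.
    - exact: integrable_normr_normal_pdf.
    - by move=> x y _ _; rewrite dfE.
  apply: DeriveDef; last by rewrite -derive1E.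
  apply: (@derivable_under_integral R _ _ mu f setT measurableT v (v - 1) (v + 1) Iv _ _ (fun x => `|x| * pdf s x)) => //.
  - by move=> x; rewrite mulr_ge0 ?normal_pdf_ge0.
  - exact: integrable_normr_normal_pdf.
  - by move=> x y _ _; rewrite dfE.
(* Stein's identity for N(0, s^2) applied to sin (v x + th): the derivative of [F] integrates to 0
   and equals v f + s^-2 h. *)
have hk v : \int[mu]_x h v x = - (s ^+ 2 * v) * k v.
  pose F (x : R) : R := sin (v * x + th) * pdf s x.
  pose F' (x : R) : R := v * f v x + (s ^+ 2)^-1 * h v x.
  have dF (x : R) : is_derive x 1 F (F' x).
    have dp := is_derive_normal_pdf x sn0.
    rewrite /F; apply: is_derive_eq; rewrite /F' /f /h /GRing.scale/=.
    by field.
  have cF' : continuous F'.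
    have cl : continuous (fun x : R => v * x + th).
      by move=> x; apply: cvgD; [apply: cvgM; [exact: cvg_cst|exact: cvg_id]|exact: cvg_cst].
    have cp := @continuous_normal_pdf R 0 s sn0.
    move=> x; apply: cvgD; apply: cvgM; try exact: cvg_cst.
      apply: cvgM; last exact: cp.
      apply: (cvg_comp (fun x : R => v * x + th) cos); [exact: cl|exact: continuous_cos].
    apply: cvgM; last exact: cp.
    apply: cvgN; apply: cvgM; first exact: cvg_id.
    apply: (cvg_comp (fun x : R => v * x + th) sin); [exact: cl|exact: continuous_sin].
  have i1 : mu.-integrable setT (EFin \o (fun x => v * f v x)).
    exact: (integrableZl measurableT v (if_ v)).
  have i2 : mu.-integrable setT (EFin \o (fun x => (s ^+ 2)^-1 * h v x)).
    exact: (integrableZl measurableT (s ^+ 2)^-1 (ih v)).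
  have iF' : mu.-integrable setT (EFin \o F').
    exact: (integrableD measurableT i1 i2).
  have cv0 (e : R) : `|e| = 1 -> F (e * n%:R) @[n --> \oo] --> 0.
    move=> e1; apply: norm_cvg0.
    apply: (@squeeze_cvgr _ _ _ _ (cst 0) (fun n => pdf s (e * n%:R))).
    - apply: nearW => n; rewrite normr_ge0/= normrM (ger0_norm (normal_pdf_ge0 _ _ _)).
      by rewrite ler_piMl ?normal_pdf_ge0 ?sin_max.
    - exact: cvg_cst.
    - exact: normal_pdf_cvg0.
  have : \int[mu]_x F' x = 0.
    apply: (Rintegral_derive_eq0 dF cF' iF').
    - by have := cv0 1 (normr1 _); under eq_fun do rewrite mul1r.
    - have := cv0 (-1); rewrite normrN1 => /(_ erefl).
      by under eq_fun do rewrite mulN1r.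
  rewrite RintegralD// !RintegralZl// -/(k v) => /eqP.
  rewrite addrC addr_eq0 => /eqP H.
  have s20 : s ^+ 2 != 0 by rewrite expf_neq0.
  rewrite -[LHS](mulVKf s20) H; ring.
(* Integrating factor: up to the constant cos th, [g] is the quotient of [k] by the claimed
   solution, and its derivative vanishes. *)
pose g (v : R) : R := k v * expR (s ^+ 2 * v ^+ 2 / 2).
have dg (v : R) : is_derive v 1 g 0.
  have dkv := dk v; rewrite hk in dkv.
  rewrite /g; apply: is_derive_eq; rewrite /GRing.scale/=; by field.
have := is_derive_0_is_cst u 0 dg.
rewrite /g expr0n/= mulr0 mul0r expR0 mulr1.
have -> : k 0 = cos th.
  rewrite /k /f.
  under eq_Rintegral do rewrite mul0r add0r.
  rewrite RintegralZl//; last exact: integrable_normal_pdf.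
  by rewrite /Rintegral integral_normal_pdf /= mulr1.
by move=> <-; rewrite -mulrA -expRD subrr expR0 mulr1.
Qed.

End gaussian_transform.

(** * Fourier inversion and convergence in total variation *)

Section density_of_transform.
Context (R : realType).
Local Notation mu := (@lebesgue_measure R).
Implicit Types (rho : probability (measurableTypeR R) R) (s u th a c : R).

(* The phase [th] lets one real integral carry both parts of the characteristic function. *)
Definition cos_transform rho u th : R := \int[rho]_y cos (u * y + th).

Lemma measurable_cos_affine u th :
  measurable_fun (setT : set (measurableTypeR R)) (fun y : R => cos (u * y + th)).
Proof.
apply: (measurableT_comp (f := cos)).
  by apply: continuous_measurable_fun; exact: continuous_cos.
by apply: measurable_funD => //; exact: measurable_funM.
Qed.

Lemma cos_transform_le1 rho u th : `|cos_transform rho u th| <= 1.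
Proof.
apply: Rintegral_bounded_le; first exact: measurable_cos_affine.
by move=> y; exact: cos_max.
Qed.

Lemma Rintegral_normal_prob m s (f : R -> R) (M : R) : measurable_fun setT f ->
  (forall x, `|f x| <= M) ->
  \int[normal_prob m s]_x f x = \int[mu]_x (f x * normal_pdf m s x).
Proof.
move=> mf fM; apply: (@Rintegral_density _ _ _ mu (normal_prob m s) (normal_pdf m s) _ _ _ f M) => //.
- exact: measurable_normal_pdf.
- by move=> x; exact: normal_pdf_ge0.
- exact: probability_lty.
Qed.

(** Self-duality of the Gaussian: its density is a cosine average under the law of deviation 1 / s.
    In this form Fubini is applied to two probability measures and a bounded integrand. *)
Lemma normal_pdf_Fourier y s a : 0 < s -> normal_pdf y s a =
  normal_peak s * \int[normal_prob 0 s^-1]_u cos (u * (y - a)).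
Proof.
move=> s0; have sn0 : s != 0 by rewrite gt_eqF.
rewrite (@Rintegral_normal_prob _ _ _ 1); last 2 first.
- have := measurable_cos_affine (y - a) 0; congr (measurable_fun _ _).
  by apply/funext => x; rewrite addr0 mulrC.
- by move=> x; exact: cos_max.
have := @normal_cos_transform R s^-1 (y - a) 0; rewrite invr_gt0 => /(_ s0).
have -> : \int[mu]_x (cos (x * (y - a)) * normal_pdf 0 s^-1 x) =
    \int[mu]_x (cos ((y - a) * x + 0) * normal_pdf 0 s^-1 x).
  by apply: eq_Rintegral => x _; rewrite addr0 [x * _]mulrC.
move=> ->; rewrite cos0 mul1r normal_pdf_expRE//; congr (_ * expR _).
by field.
Qed.

Lemma normal_peakM s : 0 < s -> normal_peak s * normal_peak s^-1 = (2 * pi)^-1 :> R.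
Proof.
move=> s0; have sn0 : s != 0 by rewrite gt_eqF.
have p0 := pi_gt0 R.
rewrite /normal_peak -invfM -sqrtrM; last by rewrite mulrn_wge0// mulr_ge0 ?sqr_ge0 ?ltW.
rewrite [X in (Num.sqrt X)^-1](_ : _ = (2 * pi) ^+ 2); first by rewrite sqrtr_sqr ger0_norm// mulr_ge0 ?ltW.
by field.
Qed.

(** On [A] the density is compared with the one of deviation 2 s: their ratio is 2 exp (- 3/8 (x /
    s)^2) with |x| >= e, and exp z >= 1 + z turns this into a rational bound. Only its convergence
    to 0 with [s] matters. *)
Lemma normal_tail_le y s e (A : set R) : 0 < s -> 0 < e -> measurable A ->
  (forall a, A a -> e <= `|a - y|) ->
  fine (normal_prob y s A) <= 6 * s ^+ 2 / e ^+ 2.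
Proof.
move=> s0 e0 mA Ay; have sn0 : s != 0 by rewrite gt_eqF.
have en0 : e != 0 by rewrite gt_eqF.
set K := _ / _.
have K0 : 0 <= K.
  by apply: divr_ge0; [apply: mulr_ge0; rewrite ?sqr_ge0|exact: sqr_ge0].
have le1 a : A a -> normal_pdf y s a <= K * normal_pdf y (2 * s) a.
  move=> /Ay ea.
  rewrite !normal_pdf_expRE ?mulf_neq0// normal_peak_double.
  set x := a - y in ea *.
  rewrite [X in _ <= X](_ : _ = normal_peak s * (K / 2 * expR (- x ^+ 2 / (2 * (2 * s) ^+ 2)))); last by field.
  rewrite ler_pM2l ?normal_peak_gt0//.
  rewrite -ler_pdivrMr ?expR_gt0// -expRN -expRD.
  rewrite (_ : _ + _ = - (3 / 8 * (x / s) ^+ 2)); last by field.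
  have ex : e ^+ 2 <= x ^+ 2 by rewrite -(real_normK (num_real x)) lerXn2r// nnegrE ltW.
  have exs : (e / s) ^+ 2 <= (x / s) ^+ 2.
    by rewrite !expr_div_n ler_pM2r// invr_gt0 exprn_gt0.
  have es0 : 0 < (e / s) ^+ 2 by rewrite exprn_gt0// divr_gt0.
  rewrite expRN -[leRHS]invrK lef_pV2 ?posrE ?expR_gt0//; last first.
    by rewrite invr_gt0 divr_gt0// /K divr_gt0 ?mulr_gt0 ?exprn_gt0.
  apply: le_trans (expR_ge1Dx _).
  rewrite (_ : (K / 2)^-1 = 1 / 3 * (e / s) ^+ 2); last by rewrite /K; field; rewrite sn0 en0.
  by nra.
have iK : mu.-integrable setT (EFin \o (fun a => K * normal_pdf y (2 * s) a)).
  exact: (integrableZl measurableT K (integrable_normal_pdf y (2 * s))).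
have : (normal_prob y s A <= (\int[mu]_a (K * normal_pdf y (2 * s) a)%:E))%E.
  apply: (@le_trans _ _ (\int[mu]_(a in A) (K * normal_pdf y (2 * s) a)%:E)%E).
    apply: ge0_le_integral => //.
    - by move=> a _; rewrite lee_fin normal_pdf_ge0.
    - by apply/measurable_EFinP; apply: measurable_funTS; exact: measurable_normal_pdf.
    - apply/measurable_EFinP; apply: measurable_funTS; apply: measurable_funM => //.
      exact: measurable_normal_pdf.
  apply: ge0_subset_integral => //.
  - by case/integrableP : iK.
  - by move=> a _; rewrite lee_fin mulr_ge0 ?normal_pdf_ge0.
rewrite -integrable_EFinP// RintegralZl//; last exact: integrable_normal_pdf.
rewrite [X in K * X]/Rintegral integral_normal_pdf mulr1 => H.
by rewrite -lee_fin fineK// fin_num_measure.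
Qed.

(** * Inversion for a law whose transform has Gaussian decay *)

Section fourier_inversion.
Variables (rho : probability (measurableTypeR R) R) (c : R).
Hypothesis c0 : 0 < c.
Hypothesis rho_le : forall u th, `|cos_transform rho u th| <= expR (- (c * u ^+ 2 / 2)).

(* Density of the convolution of [rho] with N(0, s^2). *)
Definition smooth_density s a : R := \int[rho]_y normal_pdf y s a.

(** The inversion formula in real form: with this phase [cos_transform] is the real part of e^(-iua)
    times the characteristic function at u; the imaginary part is odd in u and integrates to 0. *)
Definition fourier_density a : R :=
  (2 * pi)^-1 * \int[mu]_u cos_transform rho u (- (u * a)).

Let gam u : R := expR (- (c * u ^+ 2 / 2)).

Lemma integrable_gaussian : mu.-integrable setT (EFin \o gam).
Proof.
have sc : 0 < (Num.sqrt c)^-1 by rewrite invr_gt0 sqrtr_gt0.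
have := integrableZl measurableT (normal_peak (Num.sqrt c)^-1)^-1 (integrable_normal_pdf 0 (Num.sqrt c)^-1).
apply: eq_integrable => // x _ /=.
rewrite -EFinM normal_pdf_expRE ?gt_eqF// mulKf ?gt_eqF ?normal_peak_gt0 ?gt_eqF// /gam.
congr (expR _)%:E; rewrite exprVn sqr_sqrtr ?ltW// subr0; field.
by rewrite gt_eqF.
Qed.

Lemma measurable_normal_pdf2 s : s != 0 ->
  measurable_fun setT (fun z : measurableTypeR R * measurableTypeR R => normal_pdf z.1 s z.2).
Proof.
move=> s0; under eq_fun do rewrite normal_pdf_expRE//.
apply: measurable_funM => //; apply: measurableT_comp => //.
apply: measurable_funM => //; apply: measurable_funN; apply: measurable_funX.
by apply: measurable_funB.
Qed.

Lemma measurable_smooth_density s : s != 0 -> measurable_fun setT (smooth_density s).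
Proof.
move=> s0; apply: (@measurable_Rintegral_r _ _ _ _ R rho rho (fun z => normal_pdf z.1 s z.2) (normal_peak s)).
- exact: measurable_normal_pdf2.
- by move=> z; rewrite ger0_norm ?normal_pdf_ge0// normal_pdf_ub.
Qed.

Lemma measurable_cos_transform a :
  measurable_fun setT (fun u => cos_transform rho u (- (u * a))).
Proof.
apply: (@measurable_Rintegral_r _ _ _ _ R rho rho (fun z => cos (z.2 * z.1 + - (z.2 * a))) 1).
- apply: (measurableT_comp (f := cos)).
    by apply: continuous_measurable_fun; exact: continuous_cos.
  by apply: measurable_funD; [exact: measurable_funM|apply: measurable_funN; exact: measurable_funM].
- by move=> z; exact: cos_max.
Qed.

(** Convolution with N(0, s^2) multiplies the transform by exp (- s^2 u^2 / 2), so inversion becomes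
    an exchange of two probability integrals; [normal_peakM] produces the constant 1 / (2 pi). *)
Lemma smooth_density_Fourier s a : 0 < s -> smooth_density s a =
  (2 * pi)^-1 * \int[mu]_u (cos_transform rho u (- (u * a)) * expR (- (s ^+ 2 * u ^+ 2 / 2))).
Proof.
move=> s0; have sn0 : s != 0 by rewrite gt_eqF.
have sV0 : s^-1 != 0 by rewrite invr_eq0.
have mcu : measurable_fun setT (fun z : measurableTypeR R * measurableTypeR R => cos (z.2 * z.1 + - (z.2 * a))).
  apply: (measurableT_comp (f := cos)).
    by apply: continuous_measurable_fun; exact: continuous_cos.
  by apply: measurable_funD; [exact: measurable_funM|apply: measurable_funN; exact: measurable_funM].
have cu1 (z : measurableTypeR R * measurableTypeR R) : `|cos (z.2 * z.1 + - (z.2 * a))| <= 1.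
  exact: cos_max.
have E y : normal_pdf y s a = normal_peak s * \int[normal_prob 0 s^-1]_u cos (u * y + - (u * a)).
  by rewrite normal_pdf_Fourier//; under eq_Rintegral do rewrite mulrBr.
rewrite /smooth_density; under eq_Rintegral do rewrite E.
rewrite RintegralZl//; last first.
  apply: (bounded_integrable (M := 1)); first exact: probability_lty.
    exact: (@measurable_Rintegral_l _ _ _ _ R rho (normal_prob 0 s^-1) (fun z => cos (z.2 * z.1 + - (z.2 * a))) 1).
  move=> y; apply: Rintegral_bounded_le => [|u]; last exact: cos_max.
  exact: measurableT_comp mcu (pair1_measurable y).
rewrite (@Rintegral_Fubini _ _ _ _ R rho (normal_prob 0 s^-1) (fun z => cos (z.2 * z.1 + - (z.2 * a))) 1)//=.
rewrite -[X in _ * X = _]/(\int[normal_prob 0 s^-1]_u cos_transform rho u (- (u * a))).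
rewrite (@Rintegral_normal_prob _ _ _ 1); last 2 first.
- exact: measurable_cos_transform.
- by move=> u; exact: cos_transform_le1.
rewrite -(normal_peakM s0) -mulrA; congr (_ * _).
rewrite -RintegralZl//; last first.
  apply: (@integrable_dominated _ _ R mu _ gam).
  - apply: measurable_funM; first exact: measurable_cos_transform.
    apply: measurableT_comp => //; apply: measurable_funN.
    by apply: measurable_funM => //; apply: measurable_funM => //; exact: measurable_funX.
  - exact: integrable_gaussian.
  - move=> u; rewrite normrM (ger0_norm (expR_ge0 _)) (le_trans _ (rho_le u (- (u * a))))//.
    rewrite ler_piMr// expR_le1 oppr_le0.
    by rewrite divr_ge0// mulr_ge0 ?sqr_ge0.
apply: eq_Rintegral => u _; rewrite normal_pdf_expRE// mulrCA; congr (_ * (_ * expR _)).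
by rewrite subr0; field.
Qed.

Definition density_bound : R := (2 * pi)^-1 * \int[mu]_u gam u.

Let inv_2pi_ge0 : 0 <= (2 * pi)^-1 :> R.
Proof. by rewrite invr_ge0 mulr_ge0 ?pi_ge0. Qed.

Let integrable_cos_transform a (g : R -> R) : measurable_fun setT g -> (forall u, `|g u| <= 1) ->
  mu.-integrable setT (EFin \o (fun u => cos_transform rho u (- (u * a)) * g u)).
Proof.
move=> mg g1; apply: (@integrable_dominated _ _ R mu _ gam).
- by apply: measurable_funM => //; exact: measurable_cos_transform.
- exact: integrable_gaussian.
- move=> u; rewrite normrM (le_trans _ (rho_le u (- (u * a))))//.
  by rewrite ler_piMr.
Qed.

Let gauss_factor_le1 s u : `|expR (- (s ^+ 2 * u ^+ 2 / 2))| <= 1.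
Proof.
rewrite ger0_norm ?expR_ge0// expR_le1 oppr_le0.
by rewrite divr_ge0// mulr_ge0 ?sqr_ge0.
Qed.

Let measurable_gauss_factor s : measurable_fun setT (fun u : measurableTypeR R => expR (- (s ^+ 2 * u ^+ 2 / 2))).
Proof.
apply: measurableT_comp => //; apply: measurable_funN.
by apply: measurable_funM => //; apply: measurable_funM => //; exact: measurable_funX.
Qed.

Lemma smooth_density_ge0 s a : 0 <= smooth_density s a.
Proof. by apply: Rintegral_ge0 => y _; exact: normal_pdf_ge0. Qed.

(** The bound is free of [s], so it survives s --> 0: it dominates the smoothed densities and rules
    out atoms. *)
Lemma smooth_density_le s a : 0 < s -> smooth_density s a <= density_bound.
Proof.
move=> s0; rewrite smooth_density_Fourier// /density_bound ler_wpM2l//.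
apply: le_Rintegral => //.
- exact: (integrable_cos_transform a (measurable_gauss_factor s) (gauss_factor_le1 s)).
- exact: integrable_gaussian.
- move=> u _; rewrite (le_trans (ler_norm _))// normrM.
  by rewrite (le_trans _ (rho_le u (- (u * a))))// ler_piMr.
Qed.

Let sn (n : nat) : R := n.+1%:R^-1.
Let sn0 n : 0 < sn n. Proof. by rewrite invr_gt0. Qed.
Let cvg_sn : sn n @[n --> \oo] --> 0.
Proof. exact: cvg_harmonic. Qed.

Lemma smooth_density_cvg a : smooth_density (sn n) a @[n --> \oo] --> fourier_density a.
Proof.
under eq_fun do rewrite smooth_density_Fourier//.
apply: cvgMr.
apply: (@Rintegral_dominated_cvg _ _ R mu _ _ gam).
- by move=> n; apply: measurable_funM => //; exact: measurable_cos_transform.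
- exact: measurable_cos_transform.
- apply: aeW => u.
  rewrite -[X in _ --> X]mulr1; apply: cvgMr.
  rewrite -[X in _ --> X]expR0; apply: continuous_cvg; first exact: continuous_expR.
  rewrite -[X in _ --> X]oppr0; apply: cvgN.
  rewrite -[X in _ --> X](mul0r (2^-1)); apply: cvgMl.
  rewrite -[X in _ --> X](mul0r (u ^+ 2)); apply: cvgMl.
  by rewrite -[X in _ --> X](mulr0 0) ; under eq_fun do rewrite expr2; apply: cvgM.
- exact: integrable_gaussian.
- by move=> n u; rewrite normrM (le_trans _ (rho_le u (- (u * a))))// ler_piMr.
Qed.

Lemma fourier_density_ge0 a : 0 <= fourier_density a.
Proof.
by apply: (cvgr_to_ge (@smooth_density_cvg a)); apply: nearW => n; exact: smooth_density_ge0.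
Qed.

Lemma fourier_density_le a : fourier_density a <= density_bound.
Proof.
by apply: (cvgr_to_le (@smooth_density_cvg a)); apply: nearW => n; exact: smooth_density_le.
Qed.

Lemma measurable_fourier_density : measurable_fun setT fourier_density.
Proof.
apply: (@measurable_fun_cvg _ _ _ setT (fun n => smooth_density (sn n))) => //.
- by move=> n; apply: measurable_smooth_density; rewrite gt_eqF.
- by move=> a _; exact: smooth_density_cvg.
Qed.

(* An atom would make the smoothed densities blow up as s --> 0. *)
Lemma density_atomless b : rho [set b] = 0%E.
Proof.
have mb : measurable [set b] by exact: measurable_set1.
have fb : rho [set b] \is a fin_num by rewrite fin_num_measure.
have le s : 0 < s -> normal_peak s * fine (rho [set b]) <= density_bound.
  move=> s0; apply: le_trans (smooth_density_le b s0).
  have -> : normal_peak s * fine (rho [set b]) = \int[rho]_y (normal_peak s * \1_[set b] y).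
    rewrite RintegralZl//; last exact: integrable_indic.
    by congr (_ * _); rewrite /Rintegral integral_indic// setIT.
  apply: le_Rintegral => //.
  - apply: (bounded_integrable (M := normal_peak s)); first exact: probability_lty.
      by apply: measurable_funM => //; exact: measurable_indic.
    move=> y; rewrite ger0_norm ?mulr_ge0 ?normal_peak_ge0//.
    by rewrite ler_piMr ?normal_peak_ge0// indicE; case: (_ \in _).
  - apply: (bounded_integrable (M := normal_peak s)); first exact: probability_lty.
      exact: measurableT_comp (measurable_normal_pdf2 (lt0r_neq0 s0)) (pair2_measurable b).
    by move=> y; rewrite ger0_norm ?normal_pdf_ge0// normal_pdf_ub// gt_eqF.
  - move=> y _; rewrite indicE; case: (boolP (y \in [set b])) => [/set_mem -> |_]; last first.
      by rewrite mulr0 normal_pdf_ge0.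
    by rewrite mulr1 normal_pdf_expRE ?gt_eqF// subrr expr0n/= oppr0 mul0r expR0 mulr1.
apply/eqP; rewrite -(fineK fb) eqe eq_le fine_ge0 ?andbT//.
have cB : density_bound * (normal_peak (sn n))^-1 @[n --> \oo] --> 0.
  rewrite -[X in _ --> X](mulr0 density_bound); apply: cvgMr.
  have -> : (fun n => (normal_peak (sn n))^-1) = (fun n => sn n * Num.sqrt (pi *+ 2)).
    apply/funext => n; rewrite /normal_peak invrK -mulrnAr sqrtrM ?sqr_ge0// sqrtr_sqr.
    by rewrite ger0_norm// ltW.
  by rewrite -[X in _ --> X](mul0r (Num.sqrt (pi *+ 2))); apply: cvgMl.
apply: (cvgr_to_ge cB); apply: nearW => n.
rewrite ler_pdivlMr ?normal_peak_gt0 ?gt_eqF// mulrC.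
exact: le.
Qed.

(** Off the endpoints, y lies at distance e > 0 from both, and the mass of N(y, s^2) on the wrong
    side is at most 6 s^2 / e^2. At an endpoint of a nondegenerate interval the limit would be
    1/2. *)
Lemma normal_prob_cvg_indic y a b : y != a -> y != b ->
  fine (normal_prob y (sn n) `]a, b]) @[n --> \oo] --> (\1_(`]a, b]%classic : set R) y : R).
Proof.
move=> ya yb.
pose e := Num.min `|a - y| `|b - y|.
have e0 : 0 < e by rewrite lt_min !normr_gt0 !subr_eq0 ![_ == y]eq_sym ya yb.
have c6 : 6 * sn n ^+ 2 / e ^+ 2 @[n --> \oo] --> 0.
  rewrite -[X in _ --> X](mul0r (e ^- 2)); apply: cvgMl.
  rewrite -[X in _ --> X](mulr0 6); apply: cvgMr.
  by rewrite -[X in _ --> X](mulr0 0); under eq_fun do rewrite expr2; apply: cvgM.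
have mab : measurable `]a, b]%classic by exact: measurable_itv.
rewrite indicE; have [/set_mem/=|] := boolP (y \in _).
  rewrite in_itv/= => /andP[ay yb'].
  have cl n : 1 - 6 * sn n ^+ 2 / e ^+ 2 <= fine (normal_prob y (sn n) `]a, b]).
    have := @normal_tail_le y (sn n) e (~` `]a, b]) (sn0 n) e0 (measurableC mab).
    rewrite probability_setC// -(fineK (fin_num_measure (normal_prob y (sn n)) _ mab)) -EFinB/=.
    move=> H; rewrite lerBlDr -lerBlDl H// => z /= /negP.
    rewrite in_itv/= negb_and -leNgt -ltNge => /orP[za|bz].
      by rewrite ge_min; apply/orP; left; rewrite !ler0_norm; lra.
    by rewrite ge_min; apply/orP; right; rewrite !ger0_norm; lra.
  apply: (@squeeze_cvgr _ _ _ _ (fun n => 1 - 6 * sn n ^+ 2 / e ^+ 2) (cst 1)).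
  - apply: nearW => n; rewrite cl/= -lee_fin fineK ?fin_num_measure//.
    exact: probability_le1.
  - by rewrite -[X in _ --> X]subr0; apply: cvgB => //; exact: cvg_cst.
  - exact: cvg_cst.
move=> /negP yab.
apply: (@squeeze_cvgr _ _ _ _ (cst 0) (fun n => 6 * sn n ^+ 2 / e ^+ 2)) => //; last exact: cvg_cst.
apply: nearW => n; rewrite fine_ge0//=; apply: normal_tail_le => // z /=.
rewrite in_itv/= => /andP[az zb].
have {}yab : ~ (a < y <= b) by move=> h; apply: yab; apply/mem_set; rewrite /= in_itv.
have [ya'|ya'] := leP y a.
  by rewrite ge_min; apply/orP; left; rewrite !ger0_norm; lra.
have yb' : b < y by rewrite ltNge; apply/negP => h; apply: yab; rewrite ya' h.
by rewrite ge_min; apply/orP; right; rewrite !ler0_norm; lra.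
Qed.

Lemma measurable_normal_prob s (A : set R) : s != 0 -> measurable A ->
  measurable_fun setT (fun y => fine (normal_prob y s A)).
Proof.
move=> s0 mA.
have mf : measurable_fun setT (fun z : measurableTypeR R * measurableTypeR R =>
    (\1_A z.2 * normal_pdf z.1 s z.2)%:E).
  apply/measurable_EFinP/measurable_funM; last exact: measurable_normal_pdf2.
  exact: measurableT_comp (measurable_indic mA) measurable_snd.
have := @measurable_fun_fubini_tonelli_F _ _ _ _ R mu _ mf.
move=> /(_ _)/[dup] _ H.
apply: measurableT_comp => //; apply: eq_measurable_fun (H _) => [y _|z].
- rewrite /fubini_F /= /normal_prob [RHS]integral_mkcond; apply: eq_integral => x _.
  by rewrite patchE indicE; case: ifPn => xk; rewrite ?(negbTE xk) ?xk ?mul1r ?mul0r.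
- by rewrite lee_fin mulr_ge0 ?normal_pdf_ge0.
Qed.

(** Both sides are the mass of [A] under the convolution of [rho] with N(0, s^2), integrated in the
    two orders. *)
Lemma Rintegral_normal_prob_smooth s (A : set R) : 0 < s -> measurable A ->
  \int[rho]_y fine (normal_prob y s A) = \int[mu]_a (\1_A a * smooth_density s a).
Proof.
move=> s0 mA; have sn0' : s != 0 by rewrite gt_eqF.
have mf : measurable_fun setT (fun z : measurableTypeR R * measurableTypeR R =>
    (\1_A z.2 * normal_pdf z.1 s z.2)%:E).
  apply/measurable_EFinP/measurable_funM; last exact: measurable_normal_pdf2.
  exact: measurableT_comp (measurable_indic mA) measurable_snd.
have f0 (z : measurableTypeR R * measurableTypeR R) :
    (0 <= (\1_A z.2 * normal_pdf z.1 s z.2)%:E)%E.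
  by rewrite lee_fin mulr_ge0 ?normal_pdf_ge0.
have := @fubini_tonelli _ _ _ _ R rho mu _ mf f0.
rewrite /Rintegral => E; congr fine.
transitivity (\int[rho]_y \int[mu]_a (\1_A a * normal_pdf y s a)%:E)%E.
  apply: eq_integral => y _; rewrite fineK ?fin_num_measure// /normal_prob integral_mkcond.
  apply: eq_integral => x _.
  by rewrite patchE indicE; case: ifPn => xk; rewrite ?(negbTE xk) ?xk ?mul1r ?mul0r.
rewrite [LHS]E; apply: eq_integral => a _.
rewrite EFinM /smooth_density integrable_EFinP; last first.
  apply: (bounded_integrable (M := normal_peak s)); first exact: probability_lty.
    exact: measurableT_comp (measurable_normal_pdf2 sn0') (pair2_measurable a).
  by move=> y; rewrite ger0_norm ?normal_pdf_ge0// normal_pdf_ub.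
rewrite /=; under eq_integral do rewrite EFinM.
rewrite ge0_integralZl//.
- apply/measurable_EFinP.
  exact: measurableT_comp (measurable_normal_pdf2 sn0') (pair2_measurable a).
- by move=> y _; rewrite lee_fin normal_pdf_ge0.
Qed.

(** The smoothed mass of the interval has two limits, which must agree: the mass under [rho], by
    concentration of the kernel, and the integral of [fourier_density], by domination with
    [density_bound] on the interval. *)
Lemma density_on_itv a b :
  rho `]a, b]%classic = (\int[mu]_(x in `]a, b]) (fourier_density x)%:E)%E.
Proof.
have mab : measurable (`]a, b]%classic : set R) by exact: measurable_itv.
have lim1 : \int[rho]_y fine (normal_prob y (sn n) `]a, b]) @[n --> \oo] -->
    \int[rho]_y (\1_(`]a, b]%classic : set R) y : R).
  apply: (@Rintegral_dominated_cvg _ _ R rho _ _ (cst 1)).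
  - by move=> n; apply: measurable_normal_prob => //; rewrite gt_eqF.
  - exact: measurable_indic.
  (* The indicator limit may fail only at the two endpoints, which carry no mass. *)
  - exists ([set a] `|` [set b]); split.
    + by apply: measurableU; exact: measurable_set1.
    + rewrite null_set_setU//; try exact: measurable_set1; exact: density_atomless.
    + move=> y; apply: contra_notP => /not_orP[/= /eqP ya /eqP yb].
      exact: normal_prob_cvg_indic.
  - by apply: (bounded_integrable (M := 1)) => //; [exact: probability_lty|move=> x; rewrite normr1].
  - move=> n y; rewrite ger0_norm ?fine_ge0// -lee_fin fineK ?fin_num_measure//.
    exact: probability_le1.
have iM : mu.-integrable setT (EFin \o (fun x => density_bound * \1_(`]a, b]%classic : set R) x)).
  exact: (integrableZl measurableT density_bound (@integrable_indic_itv R a b false false)).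
have lim2 : \int[rho]_y fine (normal_prob y (sn n) `]a, b]) @[n --> \oo] -->
    \int[mu]_x ((\1_(`]a, b]%classic : set R) x : R) * fourier_density x).
  under eq_fun do rewrite Rintegral_normal_prob_smooth//.
  apply: (@Rintegral_dominated_cvg _ _ R mu _ _ (fun x => density_bound * \1_(`]a, b]%classic : set R) x)) => //.
  - move=> n; apply: measurable_funM; first exact: measurable_indic.
    by apply: measurable_smooth_density; rewrite gt_eqF.
  - by apply: measurable_funM; [exact: measurable_indic|exact: measurable_fourier_density].
  - by apply: aeW => x; apply: cvgMr; exact: smooth_density_cvg.
  - move=> n x; rewrite ger0_norm; last by rewrite mulr_ge0 ?smooth_density_ge0.
    by rewrite mulrC ler_wpM2r// smooth_density_le.
have E := cvg_unique (@Rhausdorff R) lim1 lim2.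
have E1 : \int[rho]_y (\1_(`]a, b]%classic : set R) y : R) = fine (rho `]a, b]%classic).
  by rewrite /Rintegral integral_indic// setIT.
have i2 : mu.-integrable setT (EFin \o (fun x => (\1_(`]a, b]%classic : set R) x : R) * fourier_density x)).
  apply: (@integrable_dominated _ _ R mu _ (fun x => density_bound * \1_(`]a, b]%classic : set R) x)) => //.
  - by apply: measurable_funM; [exact: measurable_indic|exact: measurable_fourier_density].
  - move=> x; rewrite ger0_norm; last by rewrite mulr_ge0 ?fourier_density_ge0.
    by rewrite mulrC ler_wpM2r// fourier_density_le.
rewrite -[LHS]fineK ?fin_num_measure// -E1 E integrable_EFinP//.
rewrite [RHS]integral_mkcond; apply: eq_integral => x _.
by rewrite patchE indicE; case: ifPn => xk; rewrite ?(negbTE xk) ?xk ?mul1r ?mul0r.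
Qed.

Theorem fourier_densityP (A : set R) : measurable A ->
  rho A = (\int[mu]_(x in A) (fourier_density x)%:E)%E.
Proof.
move=> mA.
(* The density defines a measure, which is then identified with [rho] by uniqueness on the
   intersection-stable family of half-open intervals. *)
pose nu0 (B : set (measurableTypeR R)) := (\int[mu]_(x in B) (fourier_density x)%:E)%E.
have f0 x : (0 <= (fourier_density x)%:E)%E by rewrite lee_fin fourier_density_ge0.
have nu00 : nu0 set0 = 0%E by rewrite /nu0 integral_set0.
have nu0_ge0 B : (0 <= nu0 B)%E by apply: integral_ge0.
have nu0_add : semi_sigma_additive nu0.
  move=> B mB tB mUB; rewrite /nu0/= ge0_integral_bigcup//; last first.
    by apply/measurable_EFinP; apply: measurable_funTS; exact: measurable_fourier_density.
  by apply: is_cvg_ereal_nneg_natsum_cond => n _ _; exact: nu0_ge0.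
pose nu : {measure set (measurableTypeR R) -> \bar R} :=
  HB.pack nu0 (isMeasure.Build _ _ _ nu0 nu00 nu0_ge0 nu0_add).
rewrite -[RHS]/(nu A).
apply: (@measure_unique _ R (measurableTypeR R) (@ocitv R) (fun k => `](- k%:R), k%:R]%classic) _ _ _ _ rho nu _ _ A mA) => //.
- exact: ocitvI.
- by move=> k; exact: is_ocitv.
- apply/seteqP; split => // x _; exists (Num.truncn `|x|).+1 => //=.
  by rewrite in_itv/=; have := truncnS_gt `|x|; rewrite ltr_norml => /andP[-> /ltW].
- by move=> _ [[a b] _ <-]; exact: density_on_itv.
- by move=> k; rewrite (le_lt_trans (probability_le1 _ _))// ltry.
Qed.

Lemma Rintegral_fourier_density (f : R -> R) (M : R) : measurable_fun setT f ->
  (forall x, `|f x| <= M) -> \int[rho]_x f x = \int[mu]_x (f x * fourier_density x).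
Proof.
move=> mf fM; apply: (@Rintegral_density _ _ _ mu rho fourier_density _ _ _ f M) => //.
- exact: measurable_fourier_density.
- exact: fourier_density_ge0.
- by move=> A mA; exact: fourier_densityP.
- exact: probability_lty.
Qed.

Lemma integrable_fourier_density : mu.-integrable setT (EFin \o fourier_density).
Proof.
apply/integrableP; split; first by apply/measurable_EFinP; exact: measurable_fourier_density.
have <- : rho setT = (\int[mu]_x `|(EFin \o fourier_density) x|)%E.
  rewrite fourier_densityP//; apply: eq_integral => x _.
  by rewrite /= ger0_norm// fourier_density_ge0.
by rewrite probability_setT ltry.
Qed.

Lemma Rintegral_fourier_density1 : \int[mu]_x fourier_density x = 1.
Proof. by rewrite /Rintegral -fourier_densityP// probability_setT. Qed.

End fourier_inversion.

(** A form of Levy's continuity theorem for Borel test functions. The common constant [c] gives all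
    the laws densities and one dominating function, so these densities converge pointwise and then
    in L^1. *)
Theorem cos_transform_continuity (rho_ : nat -> probability (measurableTypeR R) R)
    (rho : probability (measurableTypeR R) R) (c : R) (f : R -> R) (M : R) : 0 < c ->
  (forall n u th, `|cos_transform (rho_ n) u th| <= expR (- (c * u ^+ 2 / 2))) ->
  (forall u th, cos_transform (rho_ n) u th @[n --> \oo] --> cos_transform rho u th) ->
  measurable_fun setT f -> (forall x, `|f x| <= M) ->
  \int[rho_ n]_x f x @[n --> \oo] --> \int[rho]_x f x.
Proof.
move=> c0 rho_le rho_cvg mf fM.
(* The Gaussian bound passes to the limit, so the limit law has an inversion density too. *)
have rho_le' u th : `|cos_transform rho u th| <= expR (- (c * u ^+ 2 / 2)).
  have /cvg_norm H := rho_cvg u th.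
  by apply: (cvgr_to_le H); apply: nearW => n; exact: rho_le.
pose p n := fourier_density (rho_ n); pose q := fourier_density rho.
have mp n : measurable_fun setT (p n) by exact: measurable_fourier_density c0 (rho_le n).
have mq : measurable_fun setT q by exact: measurable_fourier_density c0 rho_le'.
have ip n : mu.-integrable setT (EFin \o p n) by exact: integrable_fourier_density c0 (rho_le n).
have iq : mu.-integrable setT (EFin \o q) by exact: integrable_fourier_density c0 rho_le'.
have p0 n x : 0 <= p n x by exact: fourier_density_ge0 c0 (rho_le n) _.
have q0 x : 0 <= q x by exact: fourier_density_ge0 c0 rho_le' _.
have pq a : p n a @[n --> \oo] --> q a.
  apply: cvgMr; apply: (@Rintegral_dominated_cvg _ _ R mu _ _ (fun u => expR (- (c * u ^+ 2 / 2)))).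
  - by move=> n; exact: measurable_cos_transform.
  - exact: measurable_cos_transform.
  - by apply: aeW => u; exact: rho_cvg.
  - exact: integrable_gaussian.
  - by move=> n u; exact: rho_le.
(* Scheffe: the positive part of [q - p n] is dominated by [q], and [p n] and [q] have the same integral. *)
pose g n x := Num.max (q x - p n x) 0.
have mg n : measurable_fun setT (g n).
  by apply: measurable_maxr => //; exact: measurable_funB.
have ig n : mu.-integrable setT (EFin \o g n).
  apply: (@integrable_dominated _ _ R mu _ q); [exact: mg|exact: iq|move=> x].
  by rewrite ger0_norm ?le_max ?lexx ?orbT// ge_max q0 andbT lerBlDr lerDl.
have cg : \int[mu]_x g n x @[n --> \oo] --> 0.
  rewrite -(_ : \int[mu]_x (cst 0 x : R) = 0); last by rewrite /Rintegral integral0.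
  apply: (@Rintegral_dominated_cvg _ _ R mu _ _ q) => //.
  - apply: aeW => x.
    apply: (@squeeze_cvgr _ _ _ _ (cst 0) (fun n => `|q x - p n x|)).
    + by apply: nearW => n; rewrite /g le_max lexx orbT ge_max ler_norm normr_ge0.
    + exact: cvg_cst.
    + have : `|q x - p n x| @[n --> \oo] --> `|q x - q x|.
        by apply: cvg_norm; apply: cvgB => //; exact: cvg_cst.
      by rewrite subrr normr0.
  - move=> n x; rewrite ger0_norm ?le_max ?lexx ?orbT//.
    by rewrite ge_max q0 andbT lerBlDr lerDl.
(* Here |p - q| = 2 (q - p)^+ + (p - q), and the last term integrates to 0. *)
have dE n : \int[mu]_x `|p n x - q x| = 2 * \int[mu]_x g n x.
  have -> : \int[mu]_x `|p n x - q x| = \int[mu]_x (2 * g n x + (p n x - q x)).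
    apply: eq_Rintegral => x _; rewrite /g.
    by have [h|h] := leP (q x - p n x) 0; [rewrite ger0_norm|rewrite ltr0_norm]; lra.
  rewrite RintegralD//; last 2 first.
  - exact: (integrableZl measurableT 2 (ig n)).
  - exact: (integrableB measurableT (ip n) iq).
  rewrite RintegralZl// RintegralB// (Rintegral_fourier_density1 c0 (rho_le n)).
  by rewrite (Rintegral_fourier_density1 c0 rho_le') subrr addr0.
have ifp h : mu.-integrable setT (EFin \o h) -> mu.-integrable setT (EFin \o (fun x => f x * h x)).
  move=> ih; have mh : measurable_fun setT h by apply/measurable_EFinP; exact: measurable_int ih.
  apply: (@integrable_dominated _ _ R mu _ (fun x => M * `|h x|)).
  - exact: measurable_funM.
  - exact: (integrableZl measurableT M (integrable_norm ih)).
  - by move=> x; rewrite normrM ler_wpM2r.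
apply/cvgrPdist_le => e e0.
have M0 : 0 <= M by exact: le_trans (normr_ge0 _) (fM 0).
(* The final error is at most M times the L^1 distance, that is 2 M times the integral of [g n];
   adding 1 covers M = 0. *)
have M1 : 0 < 2 * M + 1 by lra.
have /cvgrPdist_le/(_ (e / (2 * M + 1))) := cg.
rewrite divr_gt0// => /(_ isT); apply: filterS => n.
rewrite sub0r normrN ger0_norm; last first.
  by apply: Rintegral_ge0 => x _; rewrite le_max lexx orbT.
move=> gn.
rewrite (Rintegral_fourier_density c0 rho_le' mf fM) (Rintegral_fourier_density c0 (rho_le n) mf fM).
rewrite -/q -/(p n) -RintegralB//; [|exact: (ifp _ iq)|exact: (ifp _ (ip n))].
have ipq : mu.-integrable setT (EFin \o (fun x => q x - p n x)).
  exact: (integrableB measurableT iq (ip n)).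
under eq_Rintegral do rewrite -mulrBr.
apply: le_trans (le_normr_Rintegral _ (ifp _ ipq)) _ => //.
apply: (@le_trans _ _ (\int[mu]_x (M * `|p n x - q x|))).
  apply: le_Rintegral => //.
  - exact: integrable_norm (ifp _ ipq).
  - exact: (integrableZl measurableT M (integrable_norm (integrableB measurableT (ip n) iq))).
  - by move=> x _; rewrite normrM distrC ler_wpM2r.
rewrite RintegralZl//; last exact: (integrable_norm (integrableB measurableT (ip n) iq)).
rewrite dE; move: gn; rewrite ler_pdivlMr//.
have : 0 <= \int[mu]_x g n x by apply: Rintegral_ge0 => x _; rewrite le_max lexx orbT.
move: (\int[mu]_x g n x) => I I0; apply: le_trans.
by rewrite mulrDr mulr1 (_ : M * (2 * I) = I * (2 * M)) ?lerDl//; ring.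
Qed.

End density_of_transform.

(** * Trigonometric and Gaussian estimates *)

Section trigonometric_bounds.
Context (R : realType).
Implicit Types x y u s : R.

Lemma MVT_from0 (f f' : R -> R) y : (forall x, is_derive x 1 f (f' x)) ->
  exists2 z, `|z| <= `|y| & f y - f 0 = f' z * y.
Proof.
move=> df.
have cf a b : {within `[a, b], continuous f}.
  apply: continuous_subspaceT => x.
  by apply/differentiable_continuous/derivable1_diffP.
have [y0|y0] := leP 0 y.
  have [z] := @MVT_segment _ f f' 0 y y0 (fun x _ => df x) (cf _ _).
  rewrite in_itv/= subr0 => /andP[z0 zy] E; exists z => //.
  by rewrite !ger0_norm.
have [z] := @MVT_segment _ f f' y 0 (ltW y0) (fun x _ => df x) (cf _ _).
rewrite in_itv/= => /andP[yz z0] E; exists z.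
  by rewrite !ler0_norm ?lerN2// ltW.
by rewrite -opprB E sub0r mulrN opprK.
Qed.

Lemma normr_cosB1_le y : `|cos y - 1| <= `|y|.
Proof.
have [z _] := @MVT_from0 cos (fun x => - sin x) y (fun x => is_derive_cos x).
rewrite cos0 => ->; rewrite normrM normrN ler_piMl//; exact: sin_max.
Qed.

(** A quadratic bound, weaker than the cubic one, matches the integrability of min (x^2, 1). *)
Lemma normr_sinB_le y : `|sin y - y| <= y ^+ 2.
Proof.
pose f y : R := sin y - y.
have df x : is_derive x 1 f (cos x - 1) by rewrite /f; apply: is_derive_eq.
have [z zy] := @MVT_from0 f (fun x => cos x - 1) y df.
rewrite /f sin0 !subr0 => ->; rewrite normrM -(real_normK (num_real y)) expr2.
by rewrite ler_wpM2r// (le_trans (normr_cosB1_le z)).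
Qed.

Lemma normr_sin_le y : `|sin y| <= `|y|.
Proof.
have [z _] := @MVT_from0 sin cos y (fun x => is_derive_sin x).
rewrite sin0 subr0 => ->; rewrite normrM ler_piMl//; exact: cos_max.
Qed.

Lemma onem_cos_le y : 1 - cos y <= y ^+ 2 / 2.
Proof.
have -> : 1 - cos y = 2 * sin (y / 2) ^+ 2.
  have e2 : (y / 2) *+ 2 = y by rewrite -mulr_natr; field.
  have := cos_mulr2n (y / 2); rewrite e2 => ->.
  by rewrite cos2sin2; ring.
have : sin (y / 2) ^+ 2 <= (y / 2) ^+ 2.
  rewrite -(real_normK (num_real (sin _))) -[leRHS](real_normK (num_real _)).
  by rewrite lerXn2r ?nnegrE// normr_sin_le.
by rewrite expr_div_n; lra.
Qed.

Lemma normr_cosB1_minsq_le u x : `|cos (u * x) - 1| <= (2 + u ^+ 2) * Num.min (x ^+ 2) 1.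
Proof.
rewrite distrC ger0_norm ?subr_ge0 ?cos_le1//.
have [x1|x1] := leP (x ^+ 2) 1.
  apply: le_trans (onem_cos_le _) _; rewrite exprMn.
  have := mulr_ge0 (sqr_ge0 u) (sqr_ge0 x); have := sqr_ge0 x; nra.
have := cos_geN1 (u * x); have := sqr_ge0 u; nra.
Qed.

(** For |x| <= 1 the compensator removes the linear term of the sine; for |x| > 1 its indicator
    vanishes and |sin| <= 1 suffices. *)
Lemma compensated_sin_minsq_le u x :
  `|sin (u * x) - u * x * \1_[set y : R | `|y| <= 1] x| <= (1 + u ^+ 2) * Num.min (x ^+ 2) 1.
Proof.
rewrite indicE; have [/set_mem/= x1|/negP x1] := boolP (x \in _).
  rewrite mulr1; have x2 : x ^+ 2 <= 1 by rewrite -(real_normK (num_real x)) expr_le1.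
  rewrite (min_idPl x2); apply: le_trans (normr_sinB_le _) _.
  by rewrite exprMn ler_wpM2r ?sqr_ge0// lerDr.
rewrite mulr0 subr0; have {}x1 : 1 < `|x| by rewrite ltNge; apply/negP => h; apply: x1; apply/mem_set.
have x2 : 1 <= x ^+ 2 by rewrite -(real_normK (num_real x)) expr_ge1// ltW.
rewrite (min_idPr x2) mulr1 (le_trans (sin_max _))// lerDl sqr_ge0//.
Qed.

End trigonometric_bounds.

(** * Gaussian averages of transforms and exponential moments *)

Section gaussian_functional.
Context (R : realType).
Local Notation mu := (@lebesgue_measure R).
Local Notation N01 := (@normal_prob R 0 1).
Implicit Types (rho : probability (measurableTypeR R) R).

Lemma normal_prob_cos_transform (s u th : R) : 0 < s ->
  cos_transform (normal_prob 0 s) u th = cos th * expR (- (s ^+ 2 * u ^+ 2 / 2)).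
Proof.
move=> s0; rewrite /cos_transform (@Rintegral_normal_prob _ _ _ _ 1).
- exact: normal_cos_transform.
- exact: measurable_cos_affine.
- by move=> x; exact: cos_max.
Qed.

(** The function exp (- (s x)^2 / 2) is the characteristic function of N(0, 1) at s x, so exchanging
    the two integrals leaves only transform values of [rho]. *)
Lemma onem_gauss_cos_transform rho (s : R) :
  \int[rho]_x (1 - expR (- ((s * x) ^+ 2 / 2))) =
  \int[N01]_u (1 - cos_transform rho (u * s) 0).
Proof.
have mcu : measurable_fun setT (fun z : measurableTypeR R * measurableTypeR R => cos (z.2 * s * z.1 + 0)).
  apply: (measurableT_comp (f := cos)).
    by apply: continuous_measurable_fun; exact: continuous_cos.
  by apply: measurable_funD => //; apply: measurable_funM => //; exact: measurable_funM.
have c1 (z : measurableTypeR R * measurableTypeR R) : `|cos (z.2 * s * z.1 + 0)| <= 1 by exact: cos_max.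
have E x : expR (- ((s * x) ^+ 2 / 2)) = \int[N01]_u cos (u * s * x + 0).
  have := @normal_prob_cos_transform 1 (s * x) 0 ltr01.
  rewrite cos0 mul1r expr1n mul1r => <-; apply: eq_Rintegral => u _.
  by congr (cos (_ + _)); ring.
have i1 (rho' : probability (measurableTypeR R) R) : rho'.-integrable setT (EFin \o cst (1 : R)).
  by apply: (bounded_integrable (M := 1)) => //; [exact: probability_lty|move=> x; rewrite normr1].
rewrite RintegralB//; last 2 first.
- exact: i1.
- apply: (bounded_integrable (M := 1)); first exact: probability_lty.
    under eq_fun do rewrite E.
    exact: (@measurable_Rintegral_l _ _ _ _ R rho N01 (fun z => cos (z.2 * s * z.1 + 0)) 1).
  move=> x; rewrite ger0_norm ?expR_ge0// expR_le1 oppr_le0.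
  by rewrite divr_ge0 ?sqr_ge0.
under [in X in _ - X = _]eq_Rintegral do rewrite E.
rewrite (@Rintegral_Fubini _ _ _ _ R rho N01 (fun z => cos (z.2 * s * z.1 + 0)) 1)//=.
rewrite RintegralB//; last 2 first.
- exact: i1.
- apply: (bounded_integrable (M := 1)); first exact: probability_lty.
    exact: (@measurable_Rintegral_r _ _ _ _ R rho N01 (fun z => cos (z.2 * s * z.1 + 0)) 1).
  by move=> u; exact: cos_transform_le1.
by rewrite !Rintegral_probability_cst.
Qed.

Lemma integrable_expR_normal_prob (s a : R) : 0 < s ->
  (normal_prob 0 s).-integrable setT (EFin \o (fun x : R => expR (a * `|x|))).
Proof.
move=> s0; have me : measurable_fun (setT : set (measurableTypeR R)) (fun x : R => expR (a * `|x|)).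
  by apply: measurableT_comp => //; apply: measurable_funM => //; exact: normr_measurable.
apply/integrableP; split; first exact/measurable_EFinP.
have := integrable_expR_normal_pdf a s0 => /integrableP[_].
under eq_integral do rewrite /= ger0_norm ?mulr_ge0 ?expR_ge0 ?normal_pdf_ge0//.
under [X in _ -> (X < _)%E]eq_integral do rewrite /= ger0_norm ?expR_ge0//.
rewrite (@ge0_integral_density _ _ R mu (normal_prob 0 s) (normal_pdf 0 s))//.
- exact: measurable_normal_pdf.
- by move=> x; exact: normal_pdf_ge0.
Qed.

Lemma exprn_le_expR (x : R) n : 0 <= x -> x ^+ n <= n`!%:R * expR x.
Proof.
case: n => [|n] x0; first by rewrite expr0 mul1r -[leLHS]expR0 ler_expR.
rewrite -ler_pdivrMl ?ltr0n ?fact_gt0// mulrC.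
by apply: le_trans (expR_ge1Dxn n x0); rewrite lerDr.
Qed.

Lemma powR_le_expR (r : R) : 0 <= r -> exists2 K : R, 0 < K &
  forall x, 0 <= x -> x `^ r <= K * expR x.
Proof.
move=> r0; pose n := (Num.truncn r).+1.
exists (1 + n`!%:R); first by rewrite addr_gt0// ltr0n fact_gt0.
move=> y y0; rewrite mulrDl mul1r.
have [y1|y1] := leP y 1.
  rewrite (@le_trans _ _ 1)//.
    have := @ge0_ler_powR R r r0 y 1; rewrite !nnegrE powR1.
    by move=> /(_ y0 ler01 y1).
  by rewrite -[leLHS]addr0 lerD ?mulr_ge0 ?expR_ge0// -[leLHS]expR0 ler_expR.
rewrite -[leLHS]add0r lerD ?expR_ge0// (le_trans _ (exprn_le_expR n y0))//.
by rewrite -powR_mulrn// ler_powR ?ltW// truncnS_gt.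
Qed.

End gaussian_functional.

(** * The exponent of a Levy process *)

Section levy_characteristics.
Context (R : realType).
Variables (b c : R) (F : {measure set R -> \bar R}).
Hypotheses (c0 : 0 <= c) (levyF : levy_measure F).
Implicit Types u s x h : R.

Local Notation minsq x := (Num.min (x ^+ 2) 1).

Lemma minsq_ge0 x : 0 <= minsq x.
Proof. by rewrite le_min sqr_ge0 ler01. Qed.

Lemma measurable_minsq : measurable_fun setT (fun x : R => minsq x).
Proof. by apply: measurable_minr => //; exact: measurable_funX. Qed.

Lemma integrable_minsq : F.-integrable setT (EFin \o (fun x : R => minsq x)).
Proof.
apply/integrableP; split; first by apply/measurable_EFinP; exact: measurable_minsq.
case: levyF => _; congr (_ < _)%E.
by apply: eq_integral => x _; rewrite /= ger0_norm// minsq_ge0.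
Qed.

Definition levy_re u : R := - (c * u ^+ 2 / 2) + \int[F]_x (cos (u * x) - 1).

Definition levy_im u : R :=
  u * b + \int[F]_x (sin (u * x) - u * x * \1_[set y : R | `|y| <= 1] x).

Lemma levy_exponentE u : levy_exponent b c F u = (levy_re u +i* levy_im u)%C.
Proof.
rewrite /levy_exponent /cintegral.
have E x : (cexp ('i * (u * x)%:C) - 1 - 'i * (u * x * \1_[set y : R | `|y| <= 1] x)%:C)%C =
    ((cos (u * x) - 1) +i* (sin (u * x) - u * x * \1_[set y : R | `|y| <= 1] x))%C.
  have Ei (y : R) : ('i * y%:C)%C = (0 +i* y)%C by simpc.
  have Ec (y : R) : (cexp (0 +i* y) = cos y +i* sin y)%C by rewrite /cexp /= expR0; simpc.
  by rewrite !Ei Ec; simpc.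
under eq_Rintegral do rewrite E.
under [X in (_ +i* X)%C]eq_Rintegral do rewrite E.
by simpc; congr (_ +i* _)%C; rewrite /levy_re /levy_im /=; ring.
Qed.

Definition levy_cos_part u x : R := cos (u * x) - 1.
Definition levy_sin_part u x : R := sin (u * x) - u * x * \1_[set y : R | `|y| <= 1] x.

Lemma measurable_levy_cos u : measurable_fun setT (levy_cos_part u).
Proof.
apply: measurable_funB => //; apply: (measurableT_comp (f := cos)).
  by apply: continuous_measurable_fun; exact: continuous_cos.
exact: measurable_funM.
Qed.

Lemma measurable_levy_sin u : measurable_fun setT (levy_sin_part u).
Proof.
apply: measurable_funB.
  apply: (measurableT_comp (f := sin)).
    by apply: continuous_measurable_fun; exact: continuous_sin.
  exact: measurable_funM.
apply: measurable_funM; first exact: measurable_funM.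
apply: measurable_indic.
rewrite (_ : [set _ | _] = `[-1, 1]%classic); first exact: measurable_itv.
by apply/seteqP; split => x /=; rewrite in_itv/= ler_norml.
Qed.

Lemma integrable_levy_cos u : F.-integrable setT (EFin \o levy_cos_part u).
Proof.
apply: (@integrable_dominated _ _ R F _ (fun x => (2 + u ^+ 2) * minsq x)).
- exact: measurable_levy_cos.
- exact: (integrableZl measurableT _ integrable_minsq).
- by move=> x; exact: normr_cosB1_minsq_le.
Qed.

Lemma integrable_levy_sin u : F.-integrable setT (EFin \o levy_sin_part u).
Proof.
apply: (@integrable_dominated _ _ R F _ (fun x => (1 + u ^+ 2) * minsq x)).
- exact: measurable_levy_sin.
- exact: (integrableZl measurableT _ integrable_minsq).
- by move=> x; exact: compensated_sin_minsq_le.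
Qed.

Let RintegralN_levy_cos u :
  - (\int[F]_x (cos (u * x) - 1)) = \int[F]_x (-1 * levy_cos_part u x).
Proof. by rewrite RintegralZl ?mulN1r//; exact: integrable_levy_cos. Qed.

Lemma levy_re_le u : levy_re u <= - (c * u ^+ 2 / 2).
Proof.
rewrite /levy_re gerDl -oppr_ge0 RintegralN_levy_cos.
by apply: Rintegral_ge0 => x _; rewrite mulN1r oppr_ge0 subr_le0 cos_le1.
Qed.

Let J : R := \int[F]_x minsq x.

Lemma levy_im_le u : `|levy_im u| <= `|u| * `|b| + (1 + u ^+ 2) * J.
Proof.
rewrite /levy_im (le_trans (ler_normD _ _))// normrM lerD2l.
apply: le_trans (le_normr_Rintegral _ (integrable_levy_sin u)) _ => //.
rewrite -RintegralZl//; last exact: integrable_minsq.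
apply: le_Rintegral => //.
- exact: (integrable_norm (integrable_levy_sin u)).
- exact: (integrableZl measurableT _ integrable_minsq).
- by move=> x _; exact: compensated_sin_minsq_le.
Qed.

(** Jumps are rescaled before being capped: those up to 1 / s count quadratically and only larger
    ones count fully, so the mass vanishes as s --> 0. *)
Definition small_jump_mass s : R := \int[F]_x minsq (s * x).

Lemma minsq_scale s x : 0 <= s <= 1 -> minsq (s * x) <= minsq x.
Proof.
move=> /andP[s0 s1]; rewrite le_min ge_min ge_min lexx orbT andbT exprMn.
by rewrite ler_piMl ?sqr_ge0// expr_le1.
Qed.

Lemma measurable_minsq_scale s : measurable_fun setT (fun x : R => minsq (s * x)).
Proof. by apply: measurable_minr => //; apply: measurable_funX; exact: measurable_funM. Qed.

Lemma integrable_minsq_scale s : 0 <= s <= 1 ->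
  F.-integrable setT (EFin \o (fun x : R => minsq (s * x))).
Proof.
move=> s01; apply: integrable_dominated (measurable_minsq_scale s) integrable_minsq _ => x.
by rewrite ger0_norm ?minsq_ge0// minsq_scale.
Qed.

(** The variables u and s are separated: the polynomial in u is later averaged under N(0, 1), and
    the factors in s tend to 0. *)
Lemma opp_levy_re_le s u : 0 <= s <= 1 ->
  - levy_re (u * s) <= c * s ^+ 2 * u ^+ 2 / 2 + (2 + u ^+ 2) * small_jump_mass s.
Proof.
move=> s01; rewrite /levy_re opprD opprK; apply: lerD.
  by rewrite exprMn; have -> : c * (u ^+ 2 * s ^+ 2) / 2 = c * s ^+ 2 * u ^+ 2 / 2 by ring.
rewrite RintegralN_levy_cos -RintegralZl//; last exact: integrable_minsq_scale.
apply: le_Rintegral => //.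
- exact: (integrableZl measurableT (-1) (integrable_levy_cos (u * s))).
- exact: (integrableZl measurableT _ (integrable_minsq_scale s01)).
- move=> x _; rewrite /levy_cos_part mulN1r (le_trans (ler_norm _))// normrN -mulrA.
  exact: normr_cosB1_minsq_le.
Qed.

Lemma small_jump_mass_ge0 s : 0 <= small_jump_mass s.
Proof. by apply: Rintegral_ge0 => x _; exact: minsq_ge0. Qed.

Lemma small_jump_mass_cvg0 : small_jump_mass n.+1%:R^-1 @[n --> \oo] --> 0.
Proof.
rewrite -(_ : \int[F]_x (cst 0 x : R) = 0); last by rewrite /Rintegral integral0.
apply: (@Rintegral_dominated_cvg _ _ R F _ _ (fun x => minsq x)).
- by move=> n; exact: measurable_minsq_scale.
- exact: measurable_cst.
- apply: aeW => x.
  apply: (@squeeze_cvgr _ _ _ _ (cst 0) (fun n => n.+1%:R^-1 ^+ 2 * x ^+ 2)).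
  + by apply: nearW => n; rewrite minsq_ge0/= ge_min exprMn lexx.
  + exact: cvg_cst.
  + rewrite -[X in _ --> X](mul0r (x ^+ 2)); apply: cvgMl.
    rewrite -[X in _ --> X](mulr0 0); under eq_fun do rewrite expr2.
    by apply: cvgM; exact: cvg_harmonic.
- exact: integrable_minsq.
- move=> n x; rewrite ger0_norm ?minsq_ge0// minsq_scale//.
  by rewrite invr_ge0 ler0n invf_le1// ler1n.
Qed.

(** * Small-time scaling of the exponent *)

Section scaling.
Variables (h : nat -> R).
Hypotheses (h0 : forall n, 0 < h n) (h_cvg0 : h n @[n --> \oo] --> 0).

Let sqrt_h0 n : 0 < Num.sqrt (h n). Proof. by rewrite sqrtr_gt0. Qed.

Let sqrt_hE n : h n = Num.sqrt (h n) ^+ 2.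
Proof. by rewrite sqr_sqrtr// ltW. Qed.

Lemma sqrt_cvg0 : Num.sqrt (h n) @[n --> \oo] --> 0.
Proof. by rewrite -[X in _ --> X](@sqrtr0 R); apply: continuous_cvg => //; exact: sqrt_continuous. Qed.

Let h_bounded : exists2 H, 0 <= H & forall n, h n <= H.
Proof.
have /cvg_seq_bounded[M [_ HM]] : cvgn h by apply/cvg_ex; exists 0.
exists (`|M| + 1) => [|n]; first by rewrite addr_ge0.
by rewrite (le_trans (ler_norm _))// HM// (le_lt_trans (ler_norm _)) ?ltrDl.
Qed.

(** The Gaussian term is invariant under this scaling. The jump integrand is at most 2 h, hence
    tends to 0 pointwise, and h (u / sqrt h)^2 = u^2 makes its bound by a multiple of min (x^2, 1)
    uniform in n. *)
Lemma levy_re_scaled u :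
  h n * levy_re (u / Num.sqrt (h n)) @[n --> \oo] --> - (c * u ^+ 2 / 2).
Proof.
have [H H0 hH] := h_bounded.
have E n : h n * levy_re (u / Num.sqrt (h n)) =
    - (c * u ^+ 2 / 2) + \int[F]_x (h n * levy_cos_part (u / Num.sqrt (h n)) x).
  rewrite /levy_re mulrDr RintegralZl//; last exact: integrable_levy_cos.
  congr (_ + _); rewrite {1}sqrt_hE; field.
  by rewrite gt_eqF.
rewrite (funext E).
rewrite -[X in _ --> X]addr0; apply: cvgD; first exact: cvg_cst.
rewrite -(_ : \int[F]_x (cst 0 x : R) = 0); last by rewrite /Rintegral integral0.
apply: (@Rintegral_dominated_cvg _ _ R F _ _ (fun x => (2 * H + u ^+ 2) * minsq x)).
- by move=> n; apply: measurable_funM => //; exact: measurable_levy_cos.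
- exact: measurable_cst.
- apply: aeW => x; apply: norm_cvg0.
  apply: (@squeeze_cvgr _ _ _ _ (cst 0) (fun n => h n * 2)).
  + apply: nearW => n; rewrite normr_ge0/= normrM gtr0_norm// ler_pM2l//.
    have := cos_le1 (u / Num.sqrt (h n) * x); have := cos_geN1 (u / Num.sqrt (h n) * x).
    by rewrite /levy_cos_part ler_norml; lra.
  + exact: cvg_cst.
  + by rewrite -[X in _ --> X](mul0r 2); apply: cvgMl.
- exact: (integrableZl measurableT _ integrable_minsq).
- move=> n x; rewrite normrM gtr0_norm//.
  apply: (@le_trans _ _ (h n * ((2 + (u / Num.sqrt (h n)) ^+ 2) * minsq x))).
    by rewrite ler_pM2l//; exact: normr_cosB1_minsq_le.
  rewrite mulrA ler_wpM2r ?minsq_ge0// mulrDr mulrC lerD ?ler_wpM2l ?hH//.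
  by rewrite [X in X * _]sqrt_hE -exprMn mulrC divfK ?gt_eqF.
Qed.

(** The drift contributes sqrt h u b. The compensated sine is at most 1 + |u x| / sqrt h, so h times
    it is at most h + sqrt h |u x|, which tends to 0 for each x. *)
Lemma levy_im_scaled u :
  h n * levy_im (u / Num.sqrt (h n)) @[n --> \oo] --> 0.
Proof.
have [H H0 hH] := h_bounded.
have E n : h n * levy_im (u / Num.sqrt (h n)) =
    Num.sqrt (h n) * (u * b) + \int[F]_x (h n * levy_sin_part (u / Num.sqrt (h n)) x).
  rewrite /levy_im mulrDr RintegralZl//; last exact: integrable_levy_sin.
  congr (_ + _); rewrite {1}sqrt_hE; field.
  by rewrite gt_eqF.
rewrite (funext E).
rewrite -[X in _ --> X]addr0; apply: cvgD.
  by rewrite -[X in _ --> X](mul0r (u * b)); apply: cvgMl; exact: sqrt_cvg0.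
rewrite -(_ : \int[F]_x (cst 0 x : R) = 0); last by rewrite /Rintegral integral0.
apply: (@Rintegral_dominated_cvg _ _ R F _ _ (fun x => (H + u ^+ 2) * minsq x)).
- by move=> n; apply: measurable_funM => //; exact: measurable_levy_sin.
- exact: measurable_cst.
- apply: aeW => x; apply: norm_cvg0.
  apply: (@squeeze_cvgr _ _ _ _ (cst 0) (fun n => h n + Num.sqrt (h n) * `|u * x|)).
  + apply: nearW => n; rewrite normr_ge0/= normrM gtr0_norm//.
    apply: (@le_trans _ _ (h n * (1 + `|u / Num.sqrt (h n) * x|))).
      rewrite ler_pM2l// (le_trans (ler_normB _ _))// lerD ?sin_max//.
      by rewrite normrM ler_piMr// indicE; case: (_ \in _); rewrite ?normr1 ?normr0.
    rewrite mulrDr mulr1 lerD2l [X in X * _]sqrt_hE.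
    rewrite !normrM normfV (gtr0_norm (sqrt_h0 n)) le_eqVlt; apply/orP; left; apply/eqP; field.
    by rewrite gt_eqF.
  + exact: cvg_cst.
  + rewrite -[X in _ --> X]addr0; apply: cvgD => //.
    by rewrite -[X in _ --> X](mul0r `|u * x|); apply: cvgMl; exact: sqrt_cvg0.
- exact: (integrableZl measurableT _ integrable_minsq).
- move=> n x; rewrite normrM gtr0_norm//.
  apply: (@le_trans _ _ (h n * ((1 + (u / Num.sqrt (h n)) ^+ 2) * minsq x))).
    by rewrite ler_pM2l//; exact: compensated_sin_minsq_le.
  rewrite mulrA ler_wpM2r ?minsq_ge0// mulrDr mulr1 lerD ?hH//.
  by rewrite [X in X * _]sqrt_hE -exprMn mulrC divfK ?gt_eqF.
Qed.

End scaling.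

Lemma levy_re_no_jump u : (forall A : set R, measurable A -> F A = 0%E) ->
  levy_re u = - (c * u ^+ 2 / 2).
Proof.
move=> F0; rewrite /levy_re /Rintegral null_set_integral ?addr0//; last exact: F0.
by apply/measurable_EFinP; exact: measurable_levy_cos.
Qed.

Lemma levy_im_no_jump u : (forall A : set R, measurable A -> F A = 0%E) ->
  levy_im u = u * b.
Proof.
move=> F0; rewrite /levy_im /Rintegral null_set_integral ?addr0//; last exact: F0.
by apply/measurable_EFinP; exact: measurable_levy_sin.
Qed.

End levy_characteristics.

(** * Increments of a Levy process *)

Section law.
Context d (T : measurableType d) (R : realType) (P : probability T R).

Section law_def.
Variables (f : T -> R) (mf : measurable_fun setT f).

Definition random_variable_of : {RV P >-> measurableTypeR R} :=
  HB.pack f (isMeasurableFun.Build _ _ T (measurableTypeR R) f mf).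

Definition law : probability (measurableTypeR R) R :=
  [the probability (measurableTypeR R) R of distribution P random_variable_of].

Lemma Rintegral_law (g : R -> R) (M : R) : measurable_fun setT g ->
  (forall x, `|g x| <= M) -> \int[law]_y g y = \int[P]_w g (f w).
Proof.
move=> mg gM; rewrite /Rintegral; congr fine.
rewrite /law (@integral_distribution _ _ _ _ _ P random_variable_of (EFin \o g))//.
- exact/measurable_EFinP.
- apply: (bounded_integrable (M := M)) => //; first exact: probability_lty.
  exact: measurableT_comp.
Qed.

Lemma cos_transform_law (u th : R) :
  cos_transform law u th = \int[P]_w cos (u * f w + th).
Proof.
rewrite /cos_transform (@Rintegral_law _ 1)//; first exact: measurable_cos_affine.
by move=> x; exact: cos_max.
Qed.

End law_def.

Lemma Rintegral_cos_phase (f : T -> R) (mf : measurable_fun setT f) (th : R) :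
  \int[P]_w cos (f w + th) =
  cos th * (\int[P]_w cos (f w)) - sin th * (\int[P]_w sin (f w)).
Proof.
have ic : P.-integrable setT (EFin \o (fun w => cos (f w))).
  apply: (bounded_integrable (M := 1)); first exact: probability_lty.
  - apply: (measurableT_comp (f := cos)) => //.
    by apply: continuous_measurable_fun; exact: continuous_cos.
  - by move=> w; exact: cos_max.
have is_ : P.-integrable setT (EFin \o (fun w => sin (f w))).
  apply: (bounded_integrable (M := 1)); first exact: probability_lty.
  - apply: (measurableT_comp (f := sin)) => //.
    by apply: continuous_measurable_fun; exact: continuous_sin.
  - by move=> w; exact: sin_max.
rewrite -!RintegralZl// -RintegralB//.
- by apply: eq_Rintegral => w _; rewrite cosD mulrC [sin _ * _]mulrC.
- exact: (integrableZl measurableT (cos th) ic).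
- exact: (integrableZl measurableT (sin th) is_).
Qed.

Lemma markov_Rintegral (Z : T -> R) (a M : R) : 0 < a -> measurable_fun setT Z ->
  (forall w, 0 <= Z w <= M) ->
  (P [set w | (a <= Z w)%R] <= ((\int[P]_w Z w)%R / a)%:E)%E.
Proof.
move=> a0 mZ ZM.
have mA : measurable [set w | a <= Z w].
  rewrite (_ : [set _ | _] = Z @^-1` `[a, +oo[); last first.
    by apply/seteqP; split => w /=; rewrite in_itv/= andbT.
  by rewrite -[X in measurable X]setTI; exact: mZ.
have fA : P [set w | a <= Z w] \is a fin_num by rewrite fin_num_measure.
rewrite -(fineK fA) lee_fin ler_pdivlMr// mulrC.
have -> : a * fine (P [set w | a <= Z w]) = \int[P]_w (a * \1_[set w | a <= Z w] w).
  rewrite RintegralZl//; last exact: integrable_indic.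
  by congr (_ * _); rewrite /Rintegral integral_indic// setIT.
apply: le_Rintegral => //.
- exact: (integrableZl measurableT a (integrable_indic _ mA)).
- apply: (bounded_integrable (M := M)) => //; first exact: probability_lty.
  by move=> w; have /andP[z0 zM] := ZM w; rewrite ger0_norm.
- move=> w _; rewrite indicE; have [/set_mem/=|_] := boolP (w \in _).
    by rewrite mulr1.
  by rewrite mulr0; have /andP[] := ZM w.
Qed.

End law.

(** * Stationarity, independence and small-time laws of increments *)

Section levy_process_increments.
Context (R : realType) d (T : measurableType d) (P : probability T R).
Variables (X : R -> {RV P >-> R}) (b c : R) (F : {measure set R -> \bar R}).
Hypotheses (levyX : levy_process X) (charX : has_characteristics X b c F).

Local Notation A := (levy_re c F).
Local Notation B := (levy_im b F).

Let c0 : 0 <= c. Proof. by case: charX. Qed.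
Let levyF : levy_measure F. Proof. by case: charX. Qed.

Lemma levy_process_cos (t u th : R) : 0 <= t ->
  \int[P]_w cos (u * X t w + th) = expR (t * A u) * cos (t * B u + th).
Proof.
move=> t0; have [_ _ /(_ t u t0)] := charX.
rewrite (levy_exponentE b c F u).
have Ei (y : R) : ('i * y%:C)%C = (0 +i* y)%C by simpc.
have Ec (y : R) : (cexp (0 +i* y) = cos y +i* sin y)%C by rewrite /cexp /= expR0; simpc.
rewrite /cintegral.
have E w : cexp ('i * (u * X t w)%:C)%C = (cos (u * X t w) +i* sin (u * X t w))%C by rewrite Ei Ec.
under eq_Rintegral do rewrite E.
under [X in (_ +i* X)%C = _ -> _]eq_Rintegral do rewrite E.
rewrite /cexp /=; simpc => -[Hc Hs].
rewrite (@Rintegral_cos_phase _ _ _ P (fun w => u * X t w)); last exact: measurable_funM.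
by rewrite Hc Hs cosD; ring.
Qed.

Lemma measurable_increment h i : measurable_fun setT (increment X h i).
Proof. exact: measurable_funB. Qed.

Lemma Rintegral_increment (h : R) (i : nat) (g : R -> R) (M : R) : 0 <= h ->
  measurable_fun setT g -> (forall x, `|g x| <= M) ->
  \int[P]_w g (increment X h i.+1 w) = \int[P]_w g (X h w).
Proof.
move=> h0 mg gM.
have m0 : measurable_fun setT (fun w => X h w - X 0 w) by exact: measurable_funB.
transitivity (\int[P]_w g (X h w - X 0 w)).
  rewrite -(Rintegral_law P (measurable_increment h i.+1) mg gM) -(Rintegral_law P m0 mg gM).
  rewrite /Rintegral; congr fine; apply: eq_measure_integral => A0 mA0 _.
  have := levy_stationary levyX (mulr_ge0 (ler0n R i) h0) h0 mA0.
  move=> H; rewrite -[RHS]/(P ((fun w => X h w - X 0 w) @^-1` A0)) -H.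
  have E : increment X h i.+1 = (fun w => X (i%:R * h + h) w - X (i%:R * h) w).
    by apply/funext => w; rewrite /increment /= -addn1 natrD mulrDl mul1r.
  by rewrite -[LHS]/(P (increment X h i.+1 @^-1` A0)) E.
rewrite /Rintegral; congr fine; apply: ae_eq_integral => //.
- by apply/measurable_EFinP; exact: measurableT_comp mg m0.
- by apply/measurable_EFinP; exact: measurableT_comp.
- by have := levy_start levyX; apply: filterS => w -> _; rewrite subr0.
Qed.

(** Mutual independence is used on the grid k h with the index subset {i, j}; the increment numbered
    [i.+1] is the one with ordinal [i], since increments are counted from 1. *)
Lemma increment_pair_independent (h : R) (i j : nat) (C D : set R) : 0 <= h ->
  i != j -> measurable C -> measurable D ->
  P (increment X h i.+1 @^-1` C `&` increment X h j.+1 @^-1` D) =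
  (P (increment X h i.+1 @^-1` C) * P (increment X h j.+1 @^-1` D))%E.
Proof.
move=> h0 ij mC mD.
pose n := (maxn i j).+1.
have iN : (i < n)%N by rewrite ltnS leq_maxl.
have jN : (j < n)%N by rewrite ltnS leq_maxr.
pose t (k : nat) : R := k%:R * h.
have t0 : 0 <= t 0%N by rewrite /t mul0r.
have tm : {homo t : x y / (x <= y)%N >-> x <= y}.
  by move=> x y xy; rewrite /t ler_wpM2r// ler_nat.
have := levy_independent levyX t0 tm.
pose oi := Ordinal iN; pose oj := Ordinal jN.
have oij : oi != oj by [].
move=> /(_ n [set oi; oj]%SET (fun k => if k == oi then C else D)).
rewrite big_setU1/= ?inE// big_set1 eqxx eq_sym (negbTE oij).
move=> H; rewrite -H; last by move=> k; case: ifP.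
congr (P _); apply/seteqP; split => w /=.
  move=> [wC wD] k /=; rewrite !inE => /orP[/eqP->|/eqP->].
    by rewrite eqxx.
  by rewrite eq_sym (negbTE oij).
move=> H'; split.
  by have := H' oi; rewrite /= !inE eqxx; apply.
by have := H' oj; rewrite /= !inE eqxx orbT [_ == oi]eq_sym (negbTE oij); apply.
Qed.

(** Independence on rectangles determines the joint law as the product of the two laws, after which
    the double integral factors. *)
Lemma Rintegral_increment_pair (h : R) (i j : nat) (g : R -> R) (M : R) : 0 <= h ->
  i != j -> measurable_fun setT g -> (forall x, `|g x| <= M) ->
  \int[P]_w (g (increment X h i.+1 w) * g (increment X h j.+1 w)) =
  (\int[P]_w g (increment X h i.+1 w)) * (\int[P]_w g (increment X h j.+1 w)).
Proof.
move=> h0 ij mg gM.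
pose f1 := increment X h i.+1; pose f2 := increment X h j.+1.
have m1 : measurable_fun setT f1 by exact: measurable_increment.
have m2 : measurable_fun setT f2 by exact: measurable_increment.
have mp : measurable_fun setT (fun w => (f1 w, f2 w) : measurableTypeR R * measurableTypeR R).
  exact: measurable_fun_pair.
pose G (z : measurableTypeR R * measurableTypeR R) : R := g z.1 * g z.2.
have mG : measurable_fun setT G.
  by apply: measurable_funM; exact: measurableT_comp.
have GM z : `|G z| <= M * M.
  by rewrite normrM ler_pM.
pose L1 := law P m1; pose L2 := law P m2.
have iG : P.-integrable ((fun w => (f1 w, f2 w) : measurableTypeR R * measurableTypeR R) @^-1` setT)
    ((EFin \o G) \o (fun w => (f1 w, f2 w) : measurableTypeR R * measurableTypeR R)).
  rewrite preimage_setT; apply: (bounded_integrable (M := M * M)) => //; first exact: probability_lty.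
  exact: measurableT_comp mG mp.
transitivity (\int[(L1 \x L2)%E]_z G z).
  rewrite /Rintegral; congr fine.
  have mEG : measurable_fun setT (EFin \o G) by exact/measurable_EFinP.
  have := @integral_pushforward _ _ _ _ R _ mp P setT _ mEG iG measurableT.
  rewrite preimage_setT => <-.
  apply: eq_measure_integral => S mS _; apply/esym.
  apply: product_measure_unique => // C D mC mD.
  exact: (increment_pair_independent h0 ij mC mD).
rewrite (Rintegral_product _ _ mG GM) /G /=.
have iL (L : probability (measurableTypeR R) R) : L.-integrable setT (EFin \o g).
  by apply: (bounded_integrable (M := M)) => //; exact: probability_lty.
have E x : \int[L2]_y (g x * g y) = g x * \int[L2]_y g y by rewrite RintegralZl//; exact: iL.
transitivity (\int[L1]_x (g x * \int[L2]_y g y)).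
  by apply: eq_Rintegral => x _; exact: E.
rewrite RintegralZr//; last exact: iL.
by rewrite (Rintegral_law P m1 mg gM) (Rintegral_law P m2 mg gM).
Qed.

Hypothesis c_gt0 : 0 < c.
Local Notation N01 := (@normal_prob R 0 1).

Lemma normal_scale_cos (u th : R) :
  \int[N01]_x cos (u * (Num.sqrt c * x) + th) = cos th * expR (- (c * u ^+ 2 / 2)).
Proof.
have := @normal_prob_cos_transform R 1 (u * Num.sqrt c) th ltr01.
rewrite /cos_transform expr1n mul1r exprMn sqr_sqrtr ?ltW// [u ^+ 2 * c]mulrC => <-.
by apply: eq_Rintegral => x _; rewrite mulrA.
Qed.

Lemma measurable_sqrtc : measurable_fun setT (fun x : measurableTypeR R => Num.sqrt c * x).
Proof. exact: measurable_funM. Qed.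

Theorem levy_local_limit (h : nat -> R) (g : R -> R) (M : R) :
  (forall n, 0 < h n) -> h n @[n --> \oo] --> 0 ->
  measurable_fun setT g -> (forall x, `|g x| <= M) ->
  \int[P]_w g (X (h n) w / Num.sqrt (h n)) @[n --> \oo] -->
  \int[N01]_x g (Num.sqrt c * x).
Proof.
move=> h0 hc mg gM.
have mX n : measurable_fun setT (fun w => X (h n) w / Num.sqrt (h n)) by exact: measurable_funM.
have cE n u th : cos_transform (law P (mX n)) u th =
    expR (h n * A (u / Num.sqrt (h n))) * cos (h n * B (u / Num.sqrt (h n)) + th).
  rewrite cos_transform_law -levy_process_cos ?ltW//; apply: eq_Rintegral => w _.
  by congr (cos (_ + _)); ring.
rewrite -(Rintegral_law N01 measurable_sqrtc mg gM).
under eq_fun do rewrite -(Rintegral_law P (mX _) mg gM).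
apply: (cos_transform_continuity c_gt0) gM => // [n u th|u th].
- rewrite cE normrM (ger0_norm (expR_ge0 _)).
  apply: (@le_trans _ _ (expR (h n * A (u / Num.sqrt (h n))))).
    by rewrite ler_piMr ?expR_ge0 ?cos_max.
  rewrite ler_expR.
  (* Jumps can only decrease the modulus, and the factor h cancels the scaling exactly, so the
     remaining Gaussian bound is the same for all n. *)
  apply: (@le_trans _ _ (h n * - (c * (u / Num.sqrt (h n)) ^+ 2 / 2))).
    by rewrite ler_pM2l//; exact: levy_re_le.
  rewrite expr_div_n sqr_sqrtr; last exact: ltW.
  rewrite le_eqVlt; apply/orP; left; apply/eqP; field.
  by rewrite gt_eqF.
- rewrite cos_transform_law normal_scale_cos (funext (fun n => cE n u th)).
  rewrite [X in _ --> X]mulrC -[X in cos X]add0r; apply: cvgM.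
    apply: continuous_cvg; first exact: continuous_expR.
    exact: levy_re_scaled.
  apply: continuous_cvg; first exact: continuous_cos.
  by apply: cvgD; [exact: levy_im_scaled|exact: cvg_cst].
Qed.

(** After removing the drift b h and dividing by sqrt h, the transform is exactly that of N(0,
    c). *)
Lemma levy_no_jump_law (h : R) (g : R -> R) (M : R) : 0 < h ->
  (forall S : set R, measurable S -> F S = 0%E) ->
  measurable_fun setT g -> (forall x, `|g x| <= M) ->
  \int[P]_w g (X h w) = \int[N01]_x g (b * h + Num.sqrt h * (Num.sqrt c * x)).
Proof.
move=> h0 F0 mg gM.
have s0 : 0 < Num.sqrt h by rewrite sqrtr_gt0.
pose g' y := g (b * h + Num.sqrt h * y).
have mg' : measurable_fun setT g'.
  apply: measurableT_comp mg _; apply: measurable_funD => //; exact: measurable_funM.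
have g'M x : `|g' x| <= M by exact: gM.
have mX : measurable_fun setT (fun w => (X h w - b * h) / Num.sqrt h).
  by apply: measurable_funM => //; exact: measurable_funB.
have cE u th : cos_transform (law P mX) u th = cos th * expR (- (c * u ^+ 2 / 2)).
  rewrite cos_transform_law.
  have E w : u * ((X h w - b * h) / Num.sqrt h) + th =
      u / Num.sqrt h * X h w + (th - u / Num.sqrt h * (b * h)) by ring.
  under eq_Rintegral do rewrite E.
  rewrite levy_process_cos ?ltW// levy_re_no_jump// levy_im_no_jump//.
  rewrite mulrC; congr (cos _ * expR _); first by ring.
  rewrite expr_div_n sqr_sqrtr ?ltW//; field.
  by rewrite gt_eqF.
(* Applied to a constant sequence of laws, the continuity theorem becomes a uniqueness theorem:
   equal transforms give equal integrals. *)
have := @cos_transform_continuity R (fun=> law P mX) (law N01 measurable_sqrtc) c g' M c_gt0 _ _ mg' g'M.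
rewrite (Rintegral_law P mX mg' g'M) (Rintegral_law N01 measurable_sqrtc mg' g'M) => H.
have {H}H : \int[P]_w g' ((X h w - b * h) / Num.sqrt h) = \int[N01]_x g' (Num.sqrt c * x).
  apply: (cvg_unique _ (cvg_cst _) (H _ _)) => //.
  - move=> _ u th; rewrite cE normrM (ger0_norm (expR_ge0 _)).
    by rewrite ler_piMl ?expR_ge0 ?cos_max.
  - move=> u th; rewrite cE cos_transform_law normal_scale_cos; exact: cvg_cst.
rewrite -H; apply: eq_Rintegral => w _; congr g.
by field; rewrite gt_eqF.
Qed.

(* Comparable to min ((s x)^2, 1), with an expectation that is a Gaussian average of characteristic function values. *)
Definition tail_weight (s x : R) : R := 1 - expR (- ((s * x) ^+ 2 / 2)).

Lemma tail_weight_ge0 s x : 0 <= tail_weight s x.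
Proof. by rewrite subr_ge0 expR_le1 oppr_le0 divr_ge0 ?sqr_ge0. Qed.

Lemma tail_weight_le1 s x : tail_weight s x <= 1.
Proof. by rewrite gerBl expR_ge0. Qed.

Lemma measurable_tail_weight s : measurable_fun setT (tail_weight s).
Proof.
apply: measurable_funB => //; apply: measurableT_comp => //; apply: measurable_funN.
by apply: measurable_funM => //; apply: measurable_funX; exact: measurable_funM.
Qed.

(** From exp z >= 1 + z with z = (s x)^2 / 2, since 1 - 1 / (1 + y / 2) = y / (2 + y). *)
Lemma tail_weight_ge s x : (s * x) ^+ 2 / (2 + (s * x) ^+ 2) <= tail_weight s x.
Proof.
set y := (s * x) ^+ 2; have y0 : 0 <= y by exact: sqr_ge0.
rewrite /tail_weight expRN -/y.
have h : (expR (y / 2))^-1 <= (1 + y / 2)^-1.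
  rewrite lef_pV2 ?posrE ?expR_gt0 ?expR_ge1Dx//.
  by rewrite ltr_pwDl// divr_ge0.
apply: le_trans (lerB (lexx 1) h).
rewrite le_eqVlt; apply/orP; left; apply/eqP; field.
by rewrite !gt_eqF//; lra.
Qed.

(** An exponential moment of |U|, used to absorb every polynomial in u that comes from the
    exponent. *)
Let G (k : R) : R := \int[N01]_u expR (k * `|u|).
Let J : R := \int[F]_x (Num.min (x ^+ 2) 1).

(** The real part of the exponent enters linearly and gives the term in h; the imaginary part enters
    only through 1 - cos, hence squared, and gives the term in h^2. *)
Lemma Rintegral_tail_weight (h s : R) : 0 < h -> 0 <= s <= 1 ->
  \int[P]_w tail_weight s (X h w) <=
  h * ((c * s ^+ 2 + 4 * small_jump_mass F s) * G 1 + h * ((`|b| + 3 * J) ^+ 2 / 2 * G 2)).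
Proof.
move=> h0 s01; have /andP[s0 s1] := s01.
have mX : measurable_fun setT (X h) by [].
have W1 x : `|tail_weight s x| <= 1.
  by rewrite ger0_norm ?tail_weight_ge0 ?tail_weight_le1.
rewrite -(Rintegral_law P mX (measurable_tail_weight s) W1).
rewrite onem_gauss_cos_transform.
have J0 : 0 <= J by apply: Rintegral_ge0 => x _; exact: minsq_ge0.
set k1 := c * s ^+ 2 + _; set k2 := (`|b| + 3 * J) ^+ 2 / 2.
have ie k : N01.-integrable setT (EFin \o (fun x : R => expR (k * `|x|))) by exact: integrable_expR_normal_prob.
have i1 : N01.-integrable setT (EFin \o (fun x : R => h * k1 * expR (1 * `|x|))).
  exact: (integrableZl measurableT _ (ie 1)).
have i2 : N01.-integrable setT (EFin \o (fun x : R => h ^+ 2 * k2 * expR (2 * `|x|))).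
  exact: (integrableZl measurableT _ (ie 2)).
have -> : h * (k1 * G 1 + h * (k2 * G 2)) =
    \int[N01]_x (h * k1 * expR (1 * `|x|) + h ^+ 2 * k2 * expR (2 * `|x|)).
  by rewrite RintegralD// !RintegralZl// /G; ring.
have mct : measurable_fun setT (fun u : measurableTypeR R => cos_transform (law P mX) (u * s) 0).
  apply: (@measurable_Rintegral_r _ _ _ _ R (law P mX) N01 (fun z => cos (z.2 * s * z.1 + 0)) 1).
  - apply: (measurableT_comp (f := cos)).
      by apply: continuous_measurable_fun; exact: continuous_cos.
    by apply: measurable_funD => //; apply: measurable_funM => //; exact: measurable_funM.
  - by move=> z; exact: cos_max.
apply: le_Rintegral => //.
- apply: (bounded_integrable (M := 2)); first exact: probability_lty.
    exact: measurable_funB.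
  move=> u; rewrite (le_trans (ler_normB _ _))// normr1 (_ : 2 = 1 + 1 :> R)// lerD2l.
  exact: cos_transform_le1.
- exact: (integrableD measurableT i1 i2).
move=> u _; rewrite cos_transform_law levy_process_cos; last exact: ltW.
rewrite addr0.
set a := h * _; set be := h * _.
have a0 : a <= 0.
  rewrite pmulr_rle0// (le_trans (levy_re_le c levyF _))// oppr_le0.
  by rewrite divr_ge0// mulr_ge0 ?sqr_ge0.
(* Split 1 - e^a cos be as (1 - e^a) + e^a (1 - cos be), with a <= 0. *)
apply: (@le_trans _ _ (- a + be ^+ 2 / 2)).
  have := onem_cos_le be; have := expR_ge1Dx a; have := expR_gt0 a.
  have : expR a <= 1 by rewrite expR_le1.
  have := cos_le1 be; move: (expR a) (cos be) (be ^+ 2) => x y z; nra.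
have e1 : 1 <= expR `|u| by rewrite -[leLHS]expR0 ler_expR.
have e2 : `|u| <= expR `|u| by exact: normr_le_expR.
have e3 : u ^+ 2 <= 2 * expR `|u|.
  by rewrite -(real_normK (num_real u)); have := exprn_le_expR 2 (normr_ge0 u).
rewrite mul1r; apply: lerD.
  rewrite /a -mulrN -mulrA ler_pM2l//.
  apply: le_trans (opp_levy_re_le c levyF u s01) _.
  (* The constant 4 comes from 2 + u^2 <= 4 e^|u|. *)
  have m0 := small_jump_mass_ge0 F s.
  rewrite /k1; have cs : 0 <= c * s ^+ 2 by rewrite mulr_ge0 ?sqr_ge0.
  move: (small_jump_mass F s) (c * s ^+ 2) m0 cs e1 e3 => m q m0 q0.
  move: (expR _) (u ^+ 2) => E U e1 e3.
  nra.
(* The constant 3 comes from 1 + (u s)^2 <= 1 + u^2 <= 3 e^|u|. *)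
have beE : `|be| <= h * ((`|b| + 3 * J) * expR `|u|).
  rewrite normrM gtr0_norm// ler_pM2l//.
  apply: le_trans (levy_im_le b levyF _) _.
  have us : `|u * s| <= `|u| by rewrite normrM ler_piMr// ger0_norm.
  have us2 : (u * s) ^+ 2 <= u ^+ 2 by rewrite exprMn ler_piMr ?sqr_ge0// expr_le1.
  have b0 := normr_ge0 b.
  rewrite -/J; move: J0 us us2 b0 e1 e2 e3.
  move: J `|b| `|u * s| ((u * s) ^+ 2) => J' b' x y.
  move: (expR `|u|) (u ^+ 2) => E U J0 xV yU b0 e1 e2 e3.
  have h1 : x * b' <= b' * E by rewrite mulrC ler_wpM2l// (le_trans xV).
  have h2 : (1 + y) * J' <= (3 * J') * E.
    by rewrite [_ * J']mulrC [3 * J']mulrC -mulrA ler_wpM2l//; lra.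
  apply: (le_trans (lerD h1 h2)).
  by rewrite le_eqVlt; apply/orP; left; apply/eqP; ring.
have : be ^+ 2 <= (h * ((`|b| + 3 * J) * expR `|u|)) ^+ 2.
  rewrite -(real_normK (num_real be)) lerXn2r// nnegrE// ?(le_trans _ beE)//.
rewrite !exprMn /k2 (_ : expR (2 * `|u|) = expR `|u| ^+ 2); last by rewrite expRM_natl.
by move: (be ^+ 2) => z; lra.
Qed.

End levy_process_increments.

(** * Sums of increments *)

Section orthogonal_sums.
Context d (T : measurableType d) (R : realType) (P : probability T R).
Variables (z : nat -> T -> R) (K : R).
Hypotheses (mz : forall i, measurable_fun setT (z i)) (zK : forall i w, `|z i w| <= K).
Hypothesis z_orth : forall i j, i != j -> \int[P]_w (z i w * z j w) = 0.

Let S N w := \sum_(0 <= i < N) z i w.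

Lemma measurable_partial_sum N : measurable_fun setT (S N).
Proof. by apply: measurable_sum. Qed.

Lemma partial_sum_le N w : `|S N w| <= N%:R * K.
Proof.
rewrite /S (le_trans (ler_norm_sum _ _ _))// (le_trans (ler_sum _ (fun i _ => zK i w)))//.
by rewrite sumr_const_nat subn0 mulr_natl.
Qed.

Let iP (f : T -> R) M : measurable_fun setT f -> (forall w, `|f w| <= M) ->
  P.-integrable setT (EFin \o f).
Proof. by apply: bounded_integrable; exact: probability_lty. Qed.

Let S_orth N M : (M <= N)%N -> \int[P]_w (S M w * z N w) = 0.
Proof.
elim: M => [_|M IH MN].
  rewrite /S; under eq_Rintegral do rewrite big_geq// mul0r.
  by rewrite /Rintegral integral0.
have i1 : P.-integrable setT (EFin \o (fun w => S M w * z N w)).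
  apply: (@iP _ (M%:R * K * K)).
    by apply: measurable_funM => //; exact: measurable_partial_sum.
  by move=> w; rewrite normrM ler_pM// partial_sum_le.
have i2 : P.-integrable setT (EFin \o (fun w => z M w * z N w)).
  apply: (@iP _ (K * K)); first exact: measurable_funM.
  by move=> w; rewrite normrM ler_pM.
transitivity (\int[P]_w (S M w * z N w + z M w * z N w)).
  by apply: eq_Rintegral => w _; rewrite /S big_nat_recr//= mulrDl.
rewrite RintegralD// IH ?(ltnW MN)// z_orth ?addr0//.
by rewrite neq_ltn MN.
Qed.

Lemma orthogonal_sum_sqr_le N : \int[P]_w S N w ^+ 2 <= N%:R * K ^+ 2.
Proof.
elim: N => [|N IH].
  rewrite /S; under eq_Rintegral do rewrite big_geq// expr0n/=.
  by rewrite /Rintegral integral0 mul0r.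
have i1 : P.-integrable setT (EFin \o (fun w => S N w ^+ 2)).
  apply: (@iP _ ((N%:R * K) ^+ 2)).
    by apply: measurable_funX; exact: measurable_partial_sum.
  by move=> w; rewrite normrX lerXn2r// ?nnegrE// ?partial_sum_le// (le_trans (normr_ge0 _) (partial_sum_le N w)).
have i2 : P.-integrable setT (EFin \o (fun w => S N w * z N w)).
  apply: (@iP _ (N%:R * K * K)).
    by apply: measurable_funM => //; exact: measurable_partial_sum.
  by move=> w; rewrite normrM ler_pM// partial_sum_le.
have z2 w : `|z N w ^+ 2| <= K ^+ 2.
  by rewrite normrX lerXn2r// nnegrE (le_trans (normr_ge0 _) (zK N w)).
have mz2 : measurable_fun setT (fun w => z N w ^+ 2) by exact: measurable_funX.
have i3 := iP mz2 z2.
have i4 : P.-integrable setT (EFin \o (fun w => 2 * (S N w * z N w))).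
  exact: (integrableZl measurableT 2 i2).
have -> : \int[P]_w S N.+1 w ^+ 2 = \int[P]_w (S N w ^+ 2 + 2 * (S N w * z N w) + z N w ^+ 2).
  by apply: eq_Rintegral => w _; rewrite /S big_nat_recr//=; ring.
have i5 : P.-integrable setT (EFin \o (fun w => S N w ^+ 2 + 2 * (S N w * z N w))).
  exact: (integrableD measurableT i1 i4).
rewrite RintegralD// RintegralD// RintegralZl// S_orth// mulr0 addr0.
rewrite -natr1 mulrDl mul1r lerD//.
by have := Rintegral_bounded_le P mz2 z2; exact: le_trans (ler_norm _).
Qed.

End orthogonal_sums.

(** * Suprema over a time interval *)

Section sup_distance_lemmas.
Context d (T : measurableType d) (R : realType) (P : probability T R).

Lemma lt_sup_distance (y z : R -> R) (t e : R) : (e%:E < sup_distance y z t)%E <->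
  exists2 s, 0 <= s <= t & e < `|y s - z s|.
Proof.
split=> [/ereal_sup_gt[_ [s /= st <-]]|[s st es]].
  by rewrite lte_fin => es; exists s.
apply: (@lt_le_trans _ _ `|y s - z s|%:E); first by rewrite lte_fin.
by apply: ereal_sup_ubound; exists s.
Qed.

(** The supremum runs over uncountably many times, but the process depends on s only through k =
    [s / h]. For fixed k the times s yield a union of open conditions on [V k], which is open, and
    only the union over k has to be countable. *)
Lemma measurable_sup_distance (V : nat -> T -> R) (h m t e : R) :
  (forall k, measurable_fun setT (V k)) ->
  measurable [set w | (e%:E < sup_distance (fun s => V (Num.truncn (s / h)%R) w) (fun s => (m * s)%R) t)%E].
Proof.
move=> mV.
pose O k : set R := \bigcup_(s in [set s | 0 <= s <= t /\ Num.truncn (s / h) = k])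
  [set y | e < `|y - m * s|].
rewrite (_ : [set _ | _] = \bigcup_k (V k @^-1` O k)).
  apply: bigcupT_measurable => k; rewrite -[X in measurable X]setTI; apply: mV => //.
  apply: open_measurable; apply: bigcup_open => s _.
  apply: (@open_comp _ _ (fun y : R => `|y - m * s|) [set x | e < x]); last exact: open_gt.
  by move=> y _; apply: cvg_norm; apply: cvgB; [exact: cvg_id|exact: cvg_cst].
apply/seteqP; split => w /=.
  move=> /lt_sup_distance[s st es]; exists (Num.truncn (s / h)) => //=.
  by exists s.
by move=> [k _ [s [st sk] /= es]]; apply/lt_sup_distance; exists s => //; rewrite sk.
Qed.

Lemma probability_cvg0 (A : nat -> set T) : (forall n, measurable (A n)) ->
  (forall e : R, 0 < e -> \forall n \near \oo, (P (A n) <= e%:E)%E) ->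
  P (A n) @[n --> \oo] --> 0%E.
Proof.
move=> mA H; apply/fine_cvgP; split.
  by apply: nearW => n; rewrite fin_num_measure.
apply/cvgrPdist_le => e e0; have := H e e0; apply: filterS => n.
rewrite sub0r normrN ger0_norm ?fine_ge0//= => Pe.
by rewrite -lee_fin fineK ?fin_num_measure.
Qed.

End sup_distance_lemmas.

(** * Uniform law of large numbers for bounded functions of increments *)

Section increment_sums.
Context (R : realType) d (T : measurableType d) (P : probability T R).
Variables (X : R -> {RV P >-> R}).
Hypothesis levyX : levy_process X.

Definition increment_sum (h : R) (g : R -> R) (N : nat) (w : T) : R :=
  \sum_(1 <= i < N.+1) g (increment X h i w).

Lemma increment_sumE h g N w :
  increment_sum h g N w = \sum_(0 <= i < N) g (increment X h i.+1 w).
Proof. by rewrite /increment_sum big_add1. Qed.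

Lemma measurable_increment_sum h g N : measurable_fun setT g ->
  measurable_fun setT (increment_sum h g N).
Proof.
move=> mg; apply: measurable_sum => i.
exact: measurableT_comp mg (measurable_increment X h i).
Qed.

Lemma increment_sum_variance (h : R) (g : R -> R) (M : R) N : 0 <= h ->
  measurable_fun setT g -> (forall x, `|g x| <= M) ->
  \int[P]_w (increment_sum h g N w - N%:R * \int[P]_w g (X h w)) ^+ 2 <= N%:R * (2 * M) ^+ 2.
Proof.
move=> h0 mg gM; set m := \int[P]_w g (X h w).
have mgX : measurable_fun setT (fun w => g (X h w)) by exact: measurableT_comp.
have mM : `|m| <= M by apply: Rintegral_bounded_le.
pose g' x := g x - m.
have mg' : measurable_fun setT g' by exact: measurable_funB.
have g'M x : `|g' x| <= 2 * M.
  by rewrite (le_trans (ler_normB _ _))// mulr_natl mulr2n lerD.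
have g'0 : \int[P]_w g' (X h w) = 0.
  rewrite /g' RintegralB//; first by rewrite Rintegral_probability_cst subrr.
  - by apply: (bounded_integrable (M := M)) => //; exact: probability_lty.
  - by apply: (bounded_integrable (M := `|m|)) => //; exact: probability_lty.
have E w : increment_sum h g N w - N%:R * m = \sum_(0 <= i < N) g' (increment X h i.+1 w).
  by rewrite increment_sumE /g' big_split/= sumrN sumr_const_nat subn0 mulr_natl.
under eq_Rintegral do rewrite E.
apply: (@orthogonal_sum_sqr_le _ _ _ P (fun i w => g' (increment X h i.+1 w))).
- by move=> i; exact: measurableT_comp mg' (measurable_increment X h i.+1).
- by move=> i w; exact: g'M.
- move=> i j ij; rewrite (Rintegral_increment_pair levyX h0 ij mg' g'M).
  by rewrite (Rintegral_increment levyX i h0 mg' g'M) g'0 mul0r.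
Qed.

(* If the sum of [q] exceeds [a], then either some [phi] is at least 1 or [q <= a * phi] at every increment; the sum of [phi] is at least 1 in both cases. *)
Lemma increment_sum_exceed_le (h a : R) (q phi : R -> R) (M : R) N : 0 <= h -> 0 < a ->
  measurable_fun setT q -> measurable_fun setT phi ->
  (forall x, 0 <= phi x <= M) ->
  (forall x, q x <= a * phi x \/ 1 <= phi x) ->
  (P [set w | (a < increment_sum h q N w)%R] <= (N%:R * (\int[P]_w phi (X h w))%R)%:E)%E.
Proof.
move=> h0 a0 mq mphi phiM qphi.
have phi0 x : 0 <= phi x by have /andP[] := phiM x.
have phiM' x : `|phi x| <= M by rewrite ger0_norm//; have /andP[] := phiM x.
have mS := measurable_increment_sum h N mq.
have mS' := measurable_increment_sum h N mphi.
have ip i : P.-integrable setT (EFin \o (fun w => phi (increment X h i w))).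
  apply: (bounded_integrable (M := M)) => //; first exact: probability_lty.
  exact: measurableT_comp mphi (measurable_increment X h i).
have E : \int[P]_w increment_sum h phi N w = N%:R * \int[P]_w phi (X h w).
  have iS k : P.-integrable setT (EFin \o increment_sum h phi k).
    apply: (bounded_integrable (M := k%:R * M)); first exact: probability_lty.
      exact: measurable_increment_sum.
    move=> w; rewrite increment_sumE (le_trans (ler_norm_sum _ _ _))//.
    rewrite (le_trans (ler_sum _ (fun i _ => phiM' _)))//.
    by rewrite sumr_const_nat subn0 mulr_natl.
  elim: N {mS mS'} => [|k IH].
    under eq_Rintegral do rewrite increment_sumE big_geq//.
    by rewrite /Rintegral integral0 mul0r.
  transitivity (\int[P]_w (increment_sum h phi k w + phi (increment X h k.+1 w))).
    by apply: eq_Rintegral => w _; rewrite !increment_sumE big_nat_recr.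
  by rewrite RintegralD// IH (Rintegral_increment levyX k h0 mphi phiM') -natr1 mulrDl mul1r.
have SM w : 0 <= increment_sum h phi N w <= N%:R * M.
  rewrite increment_sumE sumr_ge0//=.
  rewrite (le_trans (ler_sum _ (fun i _ => le_trans (ler_norm _) (phiM' _))))//.
  by rewrite sumr_const_nat subn0 mulr_natl.
have := markov_Rintegral P ltr01 mS' SM; rewrite divr1 E; apply: le_trans.
apply: le_measure; rewrite ?inE.
- rewrite (_ : [set _ | _] = increment_sum h q N @^-1` `]a, +oo[); last first.
    by apply/seteqP; split => w /=; rewrite in_itv/= andbT.
  by rewrite -[X in measurable X]setTI; exact: mS.
- rewrite (_ : [set _ | _] = increment_sum h phi N @^-1` `[1, +oo[); last first.
    by apply/seteqP; split => w /=; rewrite in_itv/= andbT.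
  by rewrite -[X in measurable X]setTI; exact: mS'.
move=> w /=; rewrite !increment_sumE => aq.
have [H|/existsNP[i /not_implyP[iN Hi]]] := pselect (forall i, (i < N)%N ->
    q (increment X h i.+1 w) <= a * phi (increment X h i.+1 w)).
  rewrite -(ler_pM2l a0) mulr1 (le_trans (ltW aq))// mulr_sumr.
  rewrite big_nat [leRHS]big_nat; apply: ler_sum => i /andP[_ iN]; exact: H.
have phi1 : 1 <= phi (increment X h i.+1 w).
  by have [//|] := qphi (increment X h i.+1 w).
rewrite (le_trans phi1)// (bigD1_seq i)/= ?mem_index_iota ?iota_uniq//.
by rewrite lerDl sumr_ge0.
Qed.

(* The supremum over times is compared with multiples of [del]: a bounded number of grid points, so Markov's inequality applies to the sum of the squared deviations there. *)
Lemma ucp_bounded_bound (h e t m del M : R) (g : R -> R) :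
  let mn := \int[P]_w g (X h w) in let Q := Num.truncn (2 * t / del) in
  0 < h -> 0 < e -> 0 < t -> 0 < del -> h <= del / 2 ->
  measurable_fun setT g -> (forall x, `|g x| <= M) ->
  h * M <= e / 4 -> t * `|mn - m| <= e / 4 -> 2 * M * del <= e / 4 ->
  (P [set w | (e%:E < sup_distance (fun s => (h * increment_sum h g (Num.truncn (s / h)) w)%R)
       (fun s => (m * s)%R) t)%E] <=
   ((Q.+1%:R * (Q%:R * del * (2 * M) ^+ 2) / (e / 4) ^+ 2 * h)%R)%:E)%E.
Proof.
move=> mn Q h0 e0 t0 del0 hdel mg gM hM tm Md.
have M0 : 0 <= M by exact: le_trans (normr_ge0 _) (gM 0).
have mnM : `|mn| <= M by apply: Rintegral_bounded_le => //; exact: measurableT_comp.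
(* Grid points are spaced by [L] increments, a duration between del / 2 and del because h <= del /
   2; hence at most 2 t / del blocks fit before t, which explains [Q]. *)
pose L := Num.truncn (del / h).
have dh0 : 0 <= del / h by rewrite divr_ge0 ?ltW.
have Lle : L%:R * h <= del by rewrite -ler_pdivlMr// truncn_le.
have Lge : del / 2 <= L%:R * h.
  have : del / h < L.+1%:R by exact: truncnS_gt.
  by rewrite ltr_pdivrMr// -natr1 mulrDl mul1r; lra.
have L0 : (0 < L)%N.
  rewrite lt0n; apply/eqP => L0; move: Lge; rewrite L0 mul0r; lra.
pose D N w := h * (increment_sum h g N w - N%:R * mn).
pose V w := \sum_(0 <= j < Q.+1) D (j * L)%N w ^+ 2.
have Dle N w : `|D N w| <= h * (N%:R * (2 * M)).
  rewrite normrM gtr0_norm// ler_pM2l// (le_trans (ler_normB _ _))//.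
  rewrite (_ : N%:R * (2 * M) = N%:R * M + N%:R * M); last by ring.
  rewrite lerD//.
    rewrite increment_sumE (le_trans (ler_norm_sum _ _ _))//.
    rewrite (le_trans (ler_sum _ (fun i _ => gM _)))//.
    by rewrite sumr_const_nat subn0 mulr_natl.
  by rewrite normrM normr_nat ler_wpM2l.
have mD N : measurable_fun setT (D N).
  by apply: measurable_funM => //; apply: measurable_funB => //; exact: measurable_increment_sum.
have mV : measurable_fun setT V.
  by apply: measurable_sum => j; exact: measurable_funX.
have D2le N w : `|D N w ^+ 2| <= (h * (N%:R * (2 * M))) ^+ 2.
  by rewrite normrX lerXn2r// nnegrE (le_trans (normr_ge0 _) (Dle N w)).
have iD N : P.-integrable setT (EFin \o (fun w => D N w ^+ 2)).
  apply: (bounded_integrable (M := (h * (N%:R * (2 * M))) ^+ 2)) => //; first exact: probability_lty.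
  exact: measurable_funX.
have intD N : \int[P]_w D N w ^+ 2 <= h ^+ 2 * (N%:R * (2 * M) ^+ 2).
  under eq_Rintegral do rewrite exprMn.
  rewrite RintegralZl//.
    by rewrite ler_wpM2l ?sqr_ge0//; apply: increment_sum_variance => //; exact: ltW.
  have := integrableZl measurableT (h ^- 2) (iD N); apply: eq_integrable => // w _ /=.
  by rewrite -EFinM /D exprMn mulKf// expf_neq0// gt_eqF.
have intV : \int[P]_w V w <= Q.+1%:R * (Q%:R * del * (2 * M) ^+ 2) * h.
  have intV' k : \int[P]_w (\sum_(0 <= j < k) D (j * L)%N w ^+ 2) <=
      \sum_(0 <= j < k) h ^+ 2 * ((j * L)%:R * (2 * M) ^+ 2).
    have iS k' : P.-integrable setT (EFin \o (fun w => \sum_(0 <= j < k') D (j * L)%N w ^+ 2)).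
      elim: k' => [|k' IH].
        apply: (bounded_integrable (M := 0)) => //; first exact: probability_lty.
          by apply: measurable_sum => j; exact: measurable_funX.
        by move=> w; rewrite big_geq// normr0.
      have := integrableD measurableT IH (iD (k' * L)%N).
      by apply: eq_integrable => // w _ /=; rewrite big_nat_recr//= EFinD.
    elim: k => [|k IH].
      under eq_Rintegral do rewrite big_geq//.
      by rewrite big_geq// /Rintegral integral0.
    have -> : \int[P]_w (\sum_(0 <= j < k.+1) D (j * L)%N w ^+ 2) =
        \int[P]_w (\sum_(0 <= j < k) D (j * L)%N w ^+ 2 + D (k * L)%N w ^+ 2).
      by apply: eq_Rintegral => w _; rewrite big_nat_recr.
    by rewrite RintegralD// [leRHS]big_nat_recr//= lerD.
  apply: (le_trans (intV' _)).
  have H j : (0 <= j < Q.+1)%N -> h ^+ 2 * ((j * L)%:R * (2 * M) ^+ 2) <= Q%:R * del * (2 * M) ^+ 2 * h.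
    move=> /andP[_ jQ].
    have jQ' : j%:R <= Q%:R :> R by rewrite ler_nat -ltnS.
    have -> : h ^+ 2 * ((j * L)%:R * (2 * M) ^+ 2) = (j%:R * (L%:R * h)) * (2 * M) ^+ 2 * h.
      by rewrite natrM; ring.
    rewrite ler_pM2r// ler_wpM2r ?sqr_ge0// ler_pM// mulr_ge0// ltW//.
  rewrite big_nat (le_trans (ler_sum _ H))// -big_nat sumr_const_nat subn0.
  by rewrite -[leLHS]mulr_natl le_eqVlt; apply/orP; left; apply/eqP; ring.
have QM : 0 <= (Q.+1%:R * (h * ((Q * L)%:R * (2 * M))) ^+ 2).
  by rewrite mulr_ge0 ?sqr_ge0.
have VM w : 0 <= V w <= Q.+1%:R * (h * ((Q * L)%:R * (2 * M))) ^+ 2.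
  apply/andP; split; first by apply: sumr_ge0 => j _; exact: sqr_ge0.
  have H j : (0 <= j < Q.+1)%N -> D (j * L)%N w ^+ 2 <= (h * ((Q * L)%:R * (2 * M))) ^+ 2.
    move=> /andP[_ jQ]; rewrite (le_trans (ler_norm _))// (le_trans (D2le _ _))//.
    have A0 (k : nat) : 0 <= h * (k%:R * (2 * M)) by rewrite (mulr_ge0 (ltW h0))// mulr_ge0// mulr_ge0.
    rewrite lerXn2r ?nnegrE ?A0//.
    rewrite ler_wpM2l ?(ltW h0)// ler_wpM2r ?mulr_ge0// ler_nat leq_mul2r -ltnS jQ orbT//.
  rewrite /V big_nat (le_trans (ler_sum _ H))// -big_nat sumr_const_nat subn0.
  by rewrite -[leLHS]mulr_natl.
have e4 : 0 < (e / 4) ^+ 2 by rewrite exprn_gt0// divr_gt0.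
apply: (@le_trans _ _ (P [set w | ((e / 4) ^+ 2 <= V w)%R])); last first.
  apply: le_trans (markov_Rintegral P e4 mV VM) _.
  by rewrite lee_fin ler_pdivrMr// mulrAC divfK ?gt_eqF.
apply: le_measure; rewrite ?inE.
- apply: (@measurable_sup_distance _ T R (fun k w => h * increment_sum h g k w)) => k.
  by apply: measurable_funM => //; exact: measurable_increment_sum.
- rewrite (_ : [set _ | _] = V @^-1` `[(e / 4) ^+ 2, +oo[); last first.
    by apply/seteqP; split => w /=; rewrite in_itv/= andbT.
  by rewrite -[X in measurable X]setTI; exact: mV.
move=> w /= /lt_sup_distance[s /andP[s0 st] es].
(* [j] is the number of the last grid point not after s. *)
pose N := Num.truncn (s / h); pose j := (N %/ L)%N.
have sh0 : 0 <= s / h by rewrite divr_ge0// ltW.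
have Nle : N%:R * h <= s by rewrite -ler_pdivlMr// truncn_le.
have Nge : s - h <= N%:R * h.
  have : s / h < N.+1%:R by exact: truncnS_gt.
  by rewrite ltr_pdivrMr// -natr1 mulrDl mul1r; lra.
have jQ : (j < Q.+1)%N.
  rewrite ltnS /Q truncn_ge_nat; last by rewrite divr_ge0 ?mulr_ge0 ?ltW.
  rewrite ler_pdivlMr//.
  have : j%:R * (L%:R * h) <= s.
    rewrite mulrA -natrM (le_trans _ Nle)// ler_wpM2r ?(ltW h0)// ler_nat.
    exact: leq_trunc_div.
  have : j%:R * (del / 2) <= j%:R * (L%:R * h) by rewrite ler_wpM2l.
  by lra.
(* Fewer than [L] centred terms of size at most 2 M separate N from the grid point, with total
   weight at most 2 M del. *)
have DN : `|D N w - D (j * L)%N w| <= e / 4.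
  apply: le_trans Md; rewrite /D -mulrBr normrM gtr0_norm//.
  have jLN : (j * L <= N)%N by exact: leq_trunc_div.
  have -> : increment_sum h g N w - N%:R * mn - (increment_sum h g (j * L) w - (j * L)%:R * mn) =
      \sum_(j * L <= i < N) (g (increment X h i.+1 w) - mn).
    rewrite !increment_sumE [X in X - _ - _](big_cat_nat (leq0n (j * L)) jLN)/= big_split/= sumrN sumr_const_nat.
    by rewrite -[mn *+ _]mulr_natl natrB//; ring.
  apply: (@le_trans _ _ (h * (L%:R * (2 * M)))); last first.
    rewrite (_ : h * (L%:R * (2 * M)) = 2 * M * (L%:R * h)); last by ring.
    by rewrite ler_wpM2l// mulr_ge0.
  rewrite ler_pM2l// (le_trans (ler_norm_sum _ _ _))//.
  have H i : `|g (increment X h i.+1 w) - mn| <= 2 * M.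
    by rewrite (le_trans (ler_normB _ _))// mulr_natl mulr2n lerD.
  rewrite (le_trans (ler_sum _ (fun i _ => H i)))// sumr_const_nat -[leLHS]mulr_natl.
  rewrite ler_wpM2r ?mulr_ge0// ler_nat leq_subLR.
  by rewrite {1}(divn_eq N L) leq_add2l ltnW// ltn_mod.
(* Two deterministic errors: the time lost by rounding s down, at most h, and the bias [mn - m] over
   a time at most t. *)
have rest : `|h * N%:R * mn - m * s| <= e / 4 + e / 4.
  have -> : h * N%:R * mn - m * s = (N%:R * h - s) * mn + s * (mn - m) by ring.
  rewrite (le_trans (ler_normD _ _))// lerD//.
    rewrite normrM (le_trans _ hM)// ler_pM//.
    by rewrite ler0_norm; lra.
  by rewrite normrM ger0_norm// (le_trans _ tm)// ler_wpM2r.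
(* Of the excess e, one quarter goes to the grid step and two to the deterministic errors; one is
   left at the grid point. *)
have DjL : e / 4 <= `|D (j * L)%N w|.
  move: es; rewrite -/N.
  have -> : h * increment_sum h g N w - m * s =
      D (j * L)%N w + (D N w - D (j * L)%N w) + (h * N%:R * mn - m * s).
    by rewrite /D; ring.
  move=> {}es; have := lt_le_trans es (ler_normD _ _).
  have := ler_normD (D (j * L)%N w) (D N w - D (j * L)%N w).
  move: DN rest.
  move: `|D N w - _| `|_ - m * s| `|D (j * L)%N w + _| `|D (j * L)%N w| => x1 x2 x3 x4.
  by lra.
rewrite /V (bigD1_seq j)/=; last 2 first.
- by rewrite mem_index_iota.
- exact: (iota_uniq 0 Q.+1).
rewrite -[leLHS]addr0 lerD//; last by apply: sumr_ge0 => i _; exact: sqr_ge0.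
rewrite -(real_normK (num_real (D _ _))) lerXn2r// nnegrE divr_ge0// ltW//.
Qed.

(** The function varies with n so as to include the normalisation by sqrt h; only its uniform bound
    and the limit of its means are required. *)
Lemma ucp_bounded (h : nat -> R) (g : nat -> R -> R) (m M : R) :
  (forall n, 0 < h n) -> h n @[n --> \oo] --> 0 ->
  (forall n, measurable_fun setT (g n)) -> (forall n x, `|g n x| <= M) ->
  \int[P]_w g n (X (h n) w) @[n --> \oo] --> m ->
  ucp_cvg P (fun n t w => h n * increment_sum (h n) (g n) (Num.truncn (t / h n)) w)
    (fun t _ => m * t).
Proof.
move=> h0 hc mg gM gm t t0 e e0.
have M0 : 0 <= M by exact: le_trans (normr_ge0 _) (gM 0%N 0).
apply: probability_cvg0 => [n|eps eps0].
  apply: (@measurable_sup_distance _ T R (fun k w => h n * increment_sum (h n) (g n) k w)) => k.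
  by apply: measurable_funM => //; exact: measurable_increment_sum.
(* The mesh makes 2 M del <= e / 4 and is fixed before n, so that [C] below is constant and C h_n
   --> 0. *)
pose del := e / (8 * (M + 1)).
have M1 : 0 < M + 1 by rewrite ltr_wpDl.
have del0 : 0 < del by rewrite divr_gt0// mulr_gt0.
pose Q := Num.truncn (2 * t / del).
pose C := Q.+1%:R * (Q%:R * del * (2 * M) ^+ 2) / (e / 4) ^+ 2.
have C0 : 0 <= C.
  apply: divr_ge0; last exact: sqr_ge0.
  apply: mulr_ge0 => //; apply: mulr_ge0; last exact: sqr_ge0.
  by apply: mulr_ge0 => //; exact: ltW.
have C1 : 0 < C + 1 by rewrite ltr_wpDl.
have hle (k : R) : 0 < k -> \forall n \near \oo, h n <= k.
  move=> k0; have /cvgrPdist_le/(_ k k0) := hc; apply: filterS => n.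
  by rewrite sub0r normrN ger0_norm// ltW.
have e4 : 0 < e / 4 by rewrite divr_gt0.
near=> n.
apply: (@le_trans _ _ (C * h n)%:E).
  apply: (@ucp_bounded_bound (h n) e t m del M (g n)) => //.
  - by near: n; apply: hle; rewrite divr_gt0.
  - have hn : h n <= e / 4 / (M + 1) by near: n; apply: hle; rewrite divr_gt0.
    move: hn; rewrite ler_pdivlMr//; apply: le_trans.
    by rewrite ler_pM2l// lerDl.
  - have mn : `|m - \int[P]_w g n (X (h n) w)| <= e / 4 / t.
      by near: n; move/cvgrPdist_le: gm; apply; rewrite divr_gt0.
    by rewrite distrC; move: mn; rewrite ler_pdivlMr// mulrC.
  - have -> : 2 * M * del = e / 4 * (M / (M + 1)) by rewrite /del; field; rewrite gt_eqF.
    by rewrite ler_piMr ?(ltW e4)// ler_pdivrMr// mul1r lerDl.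
rewrite lee_fin.
have hn : h n <= eps / (C + 1) by near: n; apply: hle; rewrite divr_gt0.
move: hn; rewrite ler_pdivlMr//; apply: le_trans.
by rewrite mulrC ler_pM2l// lerDl.
Unshelve. all: by end_near. Qed.

End increment_sums.

(** * Power functionals *)

Section class_E_bounds.
Context (R : realType) (r : R) (f : R -> R).
Hypotheses (r0 : 0 < r) (fE : class_E r f).

(** Equivalence is stated on punctured neighbourhoods; at 0 the bound is trivial because f(0) = 0
    and r > 0. Halving the radius passes from an open ball to a closed inequality. *)
Lemma class_E_near0 (eps : R) : 0 < eps -> exists2 eta : R, 0 < eta &
  forall x, `|x| <= eta -> `|f x - `|x| `^ r| <= eps * `|x| `^ r.
Proof.
move=> eps0; have [_ _ f0 /eqaddoP/(_ eps eps0)] := fE.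
move=> /nbhs_ballP[/= d d0 H]; exists (d / 2); first by rewrite divr_gt0.
move=> x xd; have [->|xn0] := eqVneq x 0.
  by rewrite f0 normr0 powR0 ?gt_eqF// subr0 normr0 mulr0.
have := H x; rewrite /ball/= sub0r normrN.
have xd' : `|x| < d by rewrite (le_lt_trans xd)// ltr_pdivrMr// ltr_pMr// ltr1n.
by move=> /(_ xd' xn0); rewrite [X in _ <= _ * X -> _]ger0_norm ?powR_ge0.
Qed.

Lemma class_E_growth : exists2 K : R, 0 <= K & exists p : nat,
  forall x, `|f x| <= K * (1 + `|x| ^+ p).
Proof.
have [_ [K [p H]] _ _] := fE; exists `|K| => //; exists p => x.
by rewrite (le_trans (H x))// ler_wpM2r ?ler_norm// addr_ge0// exprn_ge0.
Qed.

End class_E_bounds.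

Section power_scaling.
Context (R : realType).
Implicit Types h x r : R.

(** This exchange of h^(1 - r/2) for a single factor h treats all r alike, including r > 2, where
    h^(1 - r/2) blows up. *)
Lemma powR_scale h x r : 0 < h ->
  h * `|x / Num.sqrt h| `^ r = h `^ (1 - r / 2) * `|x| `^ r.
Proof.
move=> h0; have s0 : 0 < Num.sqrt h by rewrite sqrtr_gt0.
rewrite normrM normfV (gtr0_norm s0) powRM ?normr_ge0 ?invr_ge0 ?(ltW s0)//.
rewrite -[in LHS]powR12_sqrt ?(ltW h0)// -powRN -powRrM mulNr.
rewrite mulrCA -{1}(powRr1 (ltW h0)) -powRD; last by rewrite (gt_eqF h0) implybT.
by rewrite mulrC [2^-1 * r]mulrC.
Qed.

Lemma powR_cvg_seq0 (h : nat -> R) r : 0 < r -> (forall n, 0 < h n) ->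
  h n @[n --> \oo] --> 0 -> h n `^ r @[n --> \oo] --> 0.
Proof.
move=> r0 h0 hc; have /cvg_at_rightP := powR_cvg0 r0.
by apply; split.
Qed.

Lemma cvg0_near_le (h : nat -> R) k : 0 < k -> h n @[n --> \oo] --> 0 ->
  \forall n \near \oo, h n <= k.
Proof.
move=> k0 /cvgrPdist_le/(_ k k0); apply: filterS => n.
by rewrite sub0r normrN; exact: le_trans (ler_norm _).
Qed.

End power_scaling.

Section truncated_power.
Context (R : realType).
Local Notation N01 := (@normal_prob R 0 1).
Implicit Types (r c : R).

Definition truncated_power r (k : nat) (y : R) : R :=
  `|y| `^ r * \1_[set y : R | `|y| <= k%:R] y.

Lemma measurable_normr_powR r :
  measurable_fun (setT : set (measurableTypeR R)) (fun x : R => `|x| `^ r).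
Proof.
apply: (measurableT_comp (f := fun y : R => y `^ r)); first exact: measurable_powR.
exact: normr_measurable.
Qed.

Lemma measurable_truncated_power r k : measurable_fun setT (truncated_power r k).
Proof.
apply: measurable_funM; last first.
  apply: measurable_indic.
  rewrite (_ : [set _ | _] = `[- k%:R, k%:R]%classic); first exact: measurable_itv.
  by apply/seteqP; split => x /=; rewrite in_itv/= ler_norml.
exact: measurable_normr_powR.
Qed.

Lemma truncated_power_le r k y : 0 <= r -> `|truncated_power r k y| <= k%:R `^ r.
Proof.
move=> r0; rewrite /truncated_power indicE.
have [/set_mem/= yk|_] := boolP (y \in _); last by rewrite mulr0 normr0 powR_ge0.
by rewrite mulr1 ger0_norm ?powR_ge0// ge0_ler_powR// nnegrE.
Qed.

Lemma integrable_normal_power r : 0 <= r ->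
  N01.-integrable setT (EFin \o (fun x : R => `|x| `^ r)).
Proof.
move=> r0; have [K K0 H] := powR_le_expR r0.
apply: (@integrable_dominated _ _ R N01 _ (fun x => K * expR (1 * `|x|))).
- exact: measurable_normr_powR.
- exact: (integrableZl measurableT K (integrable_expR_normal_prob 1 ltr01)).
- by move=> x; rewrite ger0_norm ?powR_ge0// mul1r H.
Qed.

Lemma gaussian_momentE r c : 0 <= r -> 0 < c ->
  c `^ (r / 2) * gaussian_moment r = \int[N01]_x (`|Num.sqrt c * x| `^ r).
Proof.
move=> r0 c0; rewrite /gaussian_moment /gaussian_expectation unlock.
rewrite -[fine _]/(\int[N01]_x (`|x| `^ r)) -RintegralZl//; last exact: integrable_normal_power.
apply: eq_Rintegral => x _; rewrite normrM powRM// ger0_norm ?sqrtr_ge0//.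
by rewrite -powR12_sqrt ?ltW// -powRrM [2^-1 * r]mulrC.
Qed.

Lemma truncated_power_cvg r c : 0 <= r -> 0 < c ->
  \int[N01]_x truncated_power r k (Num.sqrt c * x) @[k --> \oo] -->
  c `^ (r / 2) * gaussian_moment r.
Proof.
move=> r0 c0; rewrite gaussian_momentE//.
have E x : `|Num.sqrt c * x| `^ r = c `^ (r / 2) * `|x| `^ r.
  rewrite normrM powRM// ger0_norm ?sqrtr_ge0//.
  by rewrite -powR12_sqrt ?ltW// -powRrM [2^-1 * r]mulrC.
have mc : measurable_fun (setT : set (measurableTypeR R)) (fun x : R => Num.sqrt c * x).
  exact: measurable_funM.
apply: (@Rintegral_dominated_cvg _ _ R N01 _ _ (fun x => c `^ (r / 2) * `|x| `^ r)).
- by move=> k; exact: measurableT_comp (measurable_truncated_power r k) mc.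
- exact: measurableT_comp (measurable_normr_powR r) mc.
- apply: aeW => x; apply: (@cvg_near_cst _ _ _ _ \oo).
  near=> k; rewrite /truncated_power indicE mem_set ?mulr1//=.
  by near: k; exact: nbhs_infty_ger.
- exact: (integrableZl measurableT _ (integrable_normal_power r0)).
- move=> k x; rewrite /truncated_power normrM (ger0_norm (powR_ge0 _ _)) E.
  rewrite ler_piMr ?mulr_ge0 ?powR_ge0// indicE.
  by case: (_ \in _); rewrite ?normr1 ?normr0.
Unshelve. all: by end_near. Qed.

End truncated_power.

Section tail_weight_bounds.
Context (R : realType).
Implicit Types s u x : R.

Lemma tail_weight_lower s u x : 0 <= u -> u <= (s * x) ^+ 2 ->
  u / (2 + u) <= tail_weight s x.
Proof.
move=> u0 uv; apply: le_trans (tail_weight_ge s x).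
move: ((s * x) ^+ 2) uv => v uv.
rewrite ler_pdivrMr ?ltr_pwDl// mulrAC ler_pdivlMr ?ltr_pwDl//; last exact: le_trans uv.
by rewrite !mulrDr; lra.
Qed.

Lemma tail_weight_large s x : 1 <= (s * x) ^+ 2 -> 1 <= 3 * tail_weight s x.
Proof.
move=> /(tail_weight_lower ler01); rewrite (_ : 2 + 1 = 3 :> R); last by ring.
by rewrite ler_pdivrMr// mulrC.
Qed.

Lemma sqr_le_tail_weight x : x ^+ 2 <= 1 -> x ^+ 2 <= 3 * tail_weight 1 x.
Proof.
move=> x1; have := tail_weight_ge 1 x; rewrite mul1r.
have := sqr_ge0 x; move: (x ^+ 2) (tail_weight 1 x) x1 => z W z1 z0.
by rewrite ler_pdivrMr ?ltr_pwDl//; nra.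
Qed.

End tail_weight_bounds.

(** * From truncated functionals to power variations *)

Section power_variation_limit.
Context (R : realType) d (T : measurableType d) (P : probability T R).
Variables (X : R -> {RV P >-> R}) (b c : R) (F : {measure set R -> \bar R}).
Hypotheses (levyX : levy_process X) (charX : has_characteristics X b c F).
Hypothesis c_gt0 : 0 < c.
Variables (h : nat -> R).
Hypotheses (h0 : forall n, 0 < h n) (h_cvg0 : h n @[n --> \oo] --> 0).
Local Notation N01 := (@normal_prob R 0 1).

Let sh0 n : 0 < Num.sqrt (h n). Proof. by rewrite sqrtr_gt0. Qed.

Theorem normalized_ucp (g : R -> R) (M : R) : measurable_fun setT g ->
  (forall x, `|g x| <= M) ->
  ucp_cvg P (fun n t w => h n * increment_sum X (h n) (fun x => g (x / Num.sqrt (h n)))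
      (Num.truncn (t / h n)) w)
    (fun t _ => \int[N01]_x g (Num.sqrt c * x) * t).
Proof.
move=> mg gM.
apply: (@ucp_bounded _ _ _ _ _ levyX h (fun n x => g (x / Num.sqrt (h n))) _ M) => //.
- by move=> n; apply: measurableT_comp mg _; exact: measurable_funM.
- exact: (levy_local_limit charX c_gt0 h0 h_cvg0 mg gM).
Qed.

Section power.
Variables (r : R) (f : R -> R).
Hypotheses (r0 : 0 < r) (fE : class_E r f).

Let mf : measurable_fun setT f. Proof. by case: fE. Qed.

(** The absolute value makes its sums nondecreasing in time, so one bound at the final time t
    controls all s <= t. *)
Definition power_tail n (k : nat) (x : R) : R :=
  h n `^ (1 - r / 2) * `|f x| * \1_[set x : R | k%:R * Num.sqrt (h n) < `|x|] x.

Lemma measurable_power_tail n k : measurable_fun setT (power_tail n k).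
Proof.
apply: measurable_funM.
  by apply: measurable_funM => //; exact: measurableT_comp.
apply: measurable_indic; rewrite (_ : [set _ | _] = Num.norm @^-1` `]k%:R * Num.sqrt (h n), +oo[).
  by rewrite -[X in measurable X]setTI; exact: normr_measurable.
by apply/seteqP; split => x /=; rewrite in_itv/= andbT.
Qed.

Lemma power_tail_ge0 n k x : 0 <= power_tail n k x.
Proof. by rewrite mulr_ge0// mulr_ge0 ?powR_ge0. Qed.

Lemma power_tail_compare n k eps x : 0 <= eps ->
  (`|x| <= k%:R * Num.sqrt (h n) -> `|f x - `|x| `^ r| <= eps * `|x| `^ r) ->
  `|h n `^ (1 - r / 2) * f x - h n * truncated_power r k (x / Num.sqrt (h n))| <=
  h n * (eps * k%:R `^ r) + power_tail n k x.
Proof.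
move=> eps0 near0; have hh0 := ltW (h0 n).
have kE : (`|x / Num.sqrt (h n)| <= k%:R) = (`|x| <= k%:R * Num.sqrt (h n)).
  by rewrite normrM normfV (gtr0_norm (sh0 n)) ler_pdivrMr.
rewrite /truncated_power /power_tail !indicE.
have [xk|xk] := leP `|x| (k%:R * Num.sqrt (h n)).
  rewrite mem_set/= ?kE// mulr1 memNset/=; last by rewrite ltNge xk.
  rewrite mulr0 addr0 powR_scale// -mulrBr normrM ger0_norm ?powR_ge0//.
  apply: (le_trans (ler_wpM2l (powR_ge0 _ _) (near0 xk))).
  rewrite mulrCA -powR_scale// mulrCA ler_wpM2l// ler_wpM2l//.
  by rewrite ge0_ler_powR ?(ltW r0) ?nnegrE ?normr_ge0 ?kE.
rewrite memNset/= ?kE; last by rewrite leNgt xk.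
rewrite mem_set//= mulr0 mulr0 subr0 mulr1 normrM ger0_norm ?powR_ge0//.
by rewrite lerDr mulr_ge0// mulr_ge0 ?powR_ge0.
Qed.

(** The error e is shared equally by the truncated functional, the tail, the replacement of f by
    |x|^r, and the gap between the truncated and full moments. The last one forces k to be large, so
    the tail bound must be available beyond any [k0]. *)
Lemma power_ucp_of_tail :
  (forall t a eps : R, 0 < t -> 0 < a -> 0 < eps -> forall k0 : nat, exists2 k : nat, (k0 <= k)%N &
    \forall n \near \oo,
     (P [set w | (a < increment_sum X (h n) (power_tail n k) (Num.truncn (t / h n)) w)%R] <= eps%:E)%E) ->
  ucp_cvg P (fun n t w => h n `^ (1 - r / 2) * increment_sum X (h n) f (Num.truncn (t / h n)) w)
    (fun t _ => c `^ (r / 2) * gaussian_moment r * t).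
Proof.
move=> tail t t0 e e0; set m := c `^ (r / 2) * gaussian_moment r.
have mbad n : measurable [set w | (e%:E < sup_distance (fun s =>
    (h n `^ (1 - r / 2) * increment_sum X (h n) f (Num.truncn (s / h n)) w)%R) (fun s => (m * s)%R) t)%E].
  apply: (@measurable_sup_distance _ T R (fun k w => h n `^ (1 - r / 2) * increment_sum X (h n) f k w)) => k.
  by apply: measurable_funM => //; exact: measurable_increment_sum.
apply: probability_cvg0 => // eps eps0.
have e4 : 0 < e / 4 by rewrite divr_gt0.
have eps2 : 0 < eps / 2 by rewrite divr_gt0.
pose mk k := \int[N01]_x truncated_power r k (Num.sqrt c * x).
have [k0 _ Hk0] : \forall k \near \oo, `|m - mk k| <= e / 4 / t.
  have /cvgrPdist_le := truncated_power_cvg (ltW r0) c_gt0.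
  by apply; rewrite divr_gt0.
have [k /Hk0 /= mkm tailk] := tail t (e / 4) (eps / 2) t0 e4 eps2 k0.
have kr1 : 0 < k%:R `^ r + 1 by rewrite ltr_wpDl ?powR_ge0.
(* At most t / h increments each cost h eps1 k^r, in total at most e / 4. *)
pose eps1 := e / 4 / t / (k%:R `^ r + 1).
have eps10 : 0 < eps1 by rewrite !divr_gt0.
have [eta eta0 Heta] := class_E_near0 r0 fE eps10.
have := @normalized_ucp (truncated_power r k) (k%:R `^ r) (measurable_truncated_power r k)
  (fun x => truncated_power_le k x (ltW r0)) t t0 (e / 4) e4.
rewrite -/(mk k) => /fine_cvgP[_ /cvgrPdist_le/(_ _ eps2) bnd].
near=> n.
have tailn : (P [set w | (e / 4 < increment_sum X (h n) (power_tail n k) (Num.truncn (t / h n)) w)%R] <= (eps / 2)%:E)%E.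
  by near: n; exact: tailk.
have mtail : measurable [set w | (e / 4 < increment_sum X (h n) (power_tail n k) (Num.truncn (t / h n)) w)%R].
  rewrite (_ : [set _ | _] = increment_sum X (h n) (power_tail n k) (Num.truncn (t / h n)) @^-1` `]e / 4, +oo[); last first.
    by apply/seteqP; split => w /=; rewrite in_itv/= andbT.
  rewrite -[X in measurable X]setTI; apply: measurable_increment_sum => //.
  exact: measurable_power_tail.
have mbadk : measurable [set w | ((e / 4)%:E < sup_distance (fun s =>
    (h n * increment_sum X (h n) (fun x => truncated_power r k (x / Num.sqrt (h n))) (Num.truncn (s / h n)) w)%R)
    (fun s => (mk k * s)%R) t)%E].
  apply: (@measurable_sup_distance _ T R (fun j w => h n * increment_sum X (h n) (fun x => truncated_power r k (x / Num.sqrt (h n))) j w)) => j.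
  apply: measurable_funM => //; apply: measurable_increment_sum.
  by apply: measurableT_comp (measurable_truncated_power r k) _; exact: measurable_funM.
have bndn : (P [set w | ((e / 4)%:E < sup_distance (fun s =>
    (h n * increment_sum X (h n) (fun x => truncated_power r k (x / Num.sqrt (h n))) (Num.truncn (s / h n)) w)%R)
    (fun s => (mk k * s)%R) t)%E] <= (eps / 2)%:E)%E.
  rewrite -(fineK (fin_num_measure P _ mbadk)) lee_fin.
  rewrite -[leLHS]ger0_norm ?fine_ge0// -normrN -[X in `|X|]sub0r.
  by near: n.
(* For fixed k the truncation range shrinks with n into the neighbourhood where f is close to
   |x|^r. *)
have ksh : k%:R * Num.sqrt (h n) <= eta.
  have k10 : 0 < k%:R + 1 :> R by rewrite ltr_wpDl.
  have : Num.sqrt (h n) <= eta / (k%:R + 1).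
    by near: n; apply: cvg0_near_le; [rewrite divr_gt0|exact: sqrt_cvg0].
  rewrite ler_pdivlMr//; apply: le_trans.
  by rewrite mulrC ler_pM2l// lerDl.
have -> : eps%:E = ((eps / 2)%:E + (eps / 2)%:E)%E by rewrite -EFinD -splitr.
apply: le_trans (leeD bndn tailn).
apply: le_trans (measureU2 P mbadk mtail).
apply: le_measure; rewrite ?inE//; first exact: measurableU.
move=> w /= /lt_sup_distance[s /andP[s0 st] es].
have [tl|tl] := ltP (e / 4) (increment_sum X (h n) (power_tail n k) (Num.truncn (t / h n)) w); first by right.
left; apply/lt_sup_distance; exists s; first by rewrite s0.
set N := Num.truncn (s / h n) in es *.
have Nle : N%:R * h n <= s by rewrite -ler_pdivlMr// truncn_le divr_ge0// ltW.
have NN : (N <= Num.truncn (t / h n))%N.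
  by rewrite /N; apply: le_truncn; rewrite ler_pM2r ?invr_gt0.
have cmp : `|h n `^ (1 - r / 2) * increment_sum X (h n) f N w -
    h n * increment_sum X (h n) (fun x => truncated_power r k (x / Num.sqrt (h n))) N w| <= e / 4 + e / 4.
  rewrite !increment_sumE !mulr_sumr -sumrB.
  apply: (le_trans (ler_norm_sum _ _ _)).
  have H i : `|h n `^ (1 - r / 2) * f (increment X (h n) i.+1 w) -
      h n * truncated_power r k (increment X (h n) i.+1 w / Num.sqrt (h n))| <=
      h n * (eps1 * k%:R `^ r) + power_tail n k (increment X (h n) i.+1 w).
    by apply: power_tail_compare (ltW eps10) _ => xk; apply: Heta; exact: le_trans ksh.
  apply: (le_trans (ler_sum _ (fun i _ => H i))).
  rewrite big_split/= sumr_const_nat subn0; apply: lerD.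
    rewrite -[leLHS]mulr_natl mulrA.
    apply: (@le_trans _ _ (t * (eps1 * (k%:R `^ r + 1)))).
      apply: ler_pM.
      - by rewrite mulr_ge0// ltW.
      - by rewrite mulr_ge0 ?powR_ge0// ltW.
      - exact: le_trans Nle st.
      - by rewrite ler_pM2l// lerDl.
    rewrite /eps1 divfK ?gt_eqF// mulrC divfK ?gt_eqF//.
  apply: le_trans tl; rewrite increment_sumE (big_cat_nat (leq0n N) NN)/= lerDl.
  by apply: sumr_ge0 => i _; exact: power_tail_ge0.
have mks : `|mk k * s - m * s| <= e / 4.
  rewrite -mulrBl normrM distrC (ger0_norm s0).
  by move: mkm; rewrite ler_pdivlMr//; apply: le_trans; rewrite ler_wpM2l.
move: es cmp mks.
set a := _ * increment_sum _ _ f _ _; set a' := _ * increment_sum _ _ _ _ _.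
move=> es cmp mks.
have := lt_le_trans es (ler_distD a' a (m * s)).
have := ler_distD (mk k * s) a' (m * s).
by lra.
Unshelve. all: by end_near. Qed.

Let G (k : R) : R := \int[N01]_u expR (k * `|u|).
Let J : R := \int[F]_x (Num.min (x ^+ 2) 1).

Let G_ge0 k : 0 <= G k.
Proof. by apply: Rintegral_ge0 => x _; exact: expR_ge0. Qed.

Lemma truncn_mul_le (t u v : R) n : 0 < t -> 0 <= v -> u <= h n * v ->
  (Num.truncn (t / h n))%:R * u <= t * v.
Proof.
move=> t0 v0 uv; apply: (le_trans (ler_wpM2l (ler0n _ _) uv)).
rewrite mulrA ler_wpM2r// -ler_pdivlMr// truncn_le// divr_ge0// ltW//.
Qed.

(** Each of the three size ranges, up to [eta], up to 1 / s and beyond, has its own small quantity: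
    k^(r - 2), h^(1 - r/2) and kappa(s). *)
Lemma power_tail_jump : r < 2 -> forall t a eps : R, 0 < t -> 0 < a -> 0 < eps ->
  forall k0 : nat, exists2 k : nat, (k0 <= k)%N &
  \forall n \near \oo,
   (P [set w | (a < increment_sum X (h n) (power_tail n k) (Num.truncn (t / h n)) w)%R] <= eps%:E)%E.
Proof.
move=> r2 t a eps t0 a0 eps0 k0.
have [eta0 eta00 Heta0] := class_E_near0 r0 fE ltr01.
pose eta := Num.min eta0 1.
have eta_gt0 : 0 < eta by rewrite lt_min eta00 ltr01.
have Heta x : `|x| <= eta -> `|f x| <= 2 * `|x| `^ r.
  rewrite le_min => /andP[/Heta0 H _].
  have := ler_normD (f x - `|x| `^ r) (`|x| `^ r).
  by rewrite subrK (ger0_norm (powR_ge0 _ r)); move: H; rewrite mul1r; lra.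
have [Kf Kf0 [p Hf]] := class_E_growth fE.
pose kap s := (c * s ^+ 2 + 4 * small_jump_mass F s) * G 1.
pose K2 := (`|b| + 3 * J) ^+ 2 / 2 * G 2.
have J0 : 0 <= J by apply: Rintegral_ge0 => x _; exact: minsq_ge0.
have K20 : 0 <= K2 by rewrite mulr_ge0// divr_ge0// sqr_ge0.
have tw n s : 0 <= s <= 1 -> \int[P]_w tail_weight s (X (h n) w) <= h n * (kap s + h n * K2).
  by move=> s01; exact: (Rintegral_tail_weight charX).
have kap_cvg : kap j.+1%:R^-1 @[j --> \oo] --> 0.
  rewrite -[X in _ --> X](mul0r (G 1)); apply: cvgMl.
  rewrite -[X in _ --> X](addr0 0); apply: cvgD.
    rewrite -[X in _ --> X](mulr0 c); apply: cvgMr.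
    rewrite -[X in _ --> X](mulr0 0); under eq_fun do rewrite expr2.
    by apply: cvgM; exact: cvg_harmonic.
  rewrite -[X in _ --> X](mulr0 4); apply: cvgMr; apply: small_jump_mass_cvg0.
  by case: charX.
have eps4 : 0 < eps / 4 by rewrite divr_gt0.
(* The 3 is the coefficient of [tail_weight s] in [phi] below, and t comes from the t / h increments
   of weight h. *)
have [j _ /(_ j (leqnn j)) /= Hj] : \forall j \near \oo, kap j.+1%:R^-1 <= eps / 4 / (3 * t).
  by apply: cvg0_near_le kap_cvg; rewrite divr_gt0// mulr_gt0.
pose s : R := j.+1%:R^-1.
have s0 : 0 < s by rewrite invr_gt0.
have s01 : 0 <= s <= 1 by rewrite ltW//= invf_le1// ler1n.
have one01 : 0 <= (1 : R) <= 1 := introT andP (conj ler01 (lexx 1)).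
pose ML := Kf * (1 + s^-1 ^+ p).
have ML0 : 0 <= ML by rewrite mulr_ge0// addr_ge0// exprn_ge0// invr_ge0 ltW.
(* The reciprocal of the lower bound of [tail_weight 1] on |x| >= eta, so that [ML] is at most
   [ML * Ceta * tail_weight 1 x] there. *)
pose Ceta := (2 + eta ^+ 2) / eta ^+ 2.
have eta2 : 0 < eta ^+ 2 by rewrite exprn_gt0.
have Ceta0 : 0 <= Ceta by rewrite divr_ge0 ?addr_ge0 ?ltW.
have kap1 : 0 <= kap 1.
  rewrite mulr_ge0// addr_ge0 ?mulr_ge0 ?sqr_ge0 ?(ltW c_gt0)//.
  exact: small_jump_mass_ge0.
pose C1 := kap 1 + K2.
have C10 : 0 <= C1 by rewrite addr_ge0.
have C11 : 0 < t * C1 + 1 by rewrite ltr_wpDl// mulr_ge0// ltW.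
have r20 : 0 < 2 - r by rewrite subr_gt0.
(* k^(r - 2) is written as a positive power of 1 / k, to which the convergence of positive powers at
   0 applies. *)
have [k1 _ Hk1] : \forall k \near \oo, (k.+1%:R^-1 : R) `^ (2 - r) <= a * (eps / 4) / 6 / (t * C1 + 1).
  apply: cvg0_near_le; first by rewrite !divr_gt0// mulr_gt0.
  by apply: powR_cvg_seq0 => //; exact: cvg_harmonic.
pose k := (maxn k0 k1).+1.
exists k; first by rewrite leqW// leq_maxl.
have kpos : 0 < k%:R :> R by [].
have Hk : k%:R `^ (r - 2) <= a * (eps / 4) / 6 / (t * C1 + 1).
  have := Hk1 (maxn k0 k1) (leq_maxr _ _).
  rewrite -/k -powR_inv1// -powRrM mulN1r opprB.
  by [].
have hpow : h n `^ (1 - r / 2) @[n --> \oo] --> 0.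
  by apply: powR_cvg_seq0 => //; lra.
near=> n.
have hn1 : h n <= 1 by near: n; exact: cvg0_near_le.
have hK2 : h n <= eps / 4 / (3 * t) / (K2 + 1).
  by near: n; apply: cvg0_near_le => //; rewrite !divr_gt0 ?mulr_gt0// ltr_wpDl.
have hML : h n `^ (1 - r / 2) <= a * (eps / 4) / (ML * Ceta + 1) / (t * C1 + 1).
  near: n; apply: cvg0_near_le => //; rewrite divr_gt0// divr_gt0 ?mulr_gt0//.
  by rewrite ltr_wpDl// mulr_ge0.
(* The 6 is the product of 2 from |f x| <= 2 |x|^r and 3 from x^2 <= 3 W_1(x); the second term
   covers sizes between [eta] and 1 / s. *)
pose Cn := 6 * k%:R `^ (r - 2) + h n `^ (1 - r / 2) * (ML * Ceta).
have Cn0 : 0 <= Cn.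
  by apply: addr_ge0; apply: mulr_ge0 => //; rewrite ?powR_ge0// mulr_ge0.
pose phi x := 3 * tail_weight s x + a^-1 * Cn * tail_weight 1 x.
have aCn : 0 <= a^-1 * Cn by rewrite mulr_ge0// invr_ge0 ltW.
have phiM x : 0 <= phi x <= 3 + a^-1 * Cn.
  apply/andP; split; first by rewrite addr_ge0 ?mulr_ge0 ?tail_weight_ge0// invr_ge0 ltW.
  rewrite lerD//; first by rewrite ler_piMr ?tail_weight_le1.
  by rewrite ler_piMr ?tail_weight_le1.
have mphi : measurable_fun setT phi.
  by apply: measurable_funD; apply: measurable_funM => //; exact: measurable_tail_weight.
(* Increments larger than [s^-1] make [phi] at least 1; up to there [r < 2] bounds the tail by a multiple of [tail_weight 1 x] that is small for large [k]. *)
have qphi x : power_tail n k x <= a * phi x \/ 1 <= phi x.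
  have [xs|xs] := ltP s^-1 `|x|.
    right; apply: (@le_trans _ _ (3 * tail_weight s x)).
      have sx1 : 1 <= (s * x) ^+ 2.
        rewrite -(real_normK (num_real _)) expr_ge1// normrM (gtr0_norm s0).
        by rewrite -ler_pdivrMl// mulr1 ltW.
      exact: tail_weight_large.
    by rewrite lerDl mulr_ge0 ?tail_weight_ge0.
  left; apply: (@le_trans _ _ (Cn * tail_weight 1 x)); last first.
    have -> : a * phi x = a * (3 * tail_weight s x) + Cn * tail_weight 1 x.
      by rewrite /phi; field; rewrite gt_eqF.
    by rewrite lerDr; apply: mulr_ge0; rewrite ?(ltW a0)// mulr_ge0 ?tail_weight_ge0.
  rewrite /power_tail indicE; have [/set_mem/= xk|_] := boolP (x \in _); last first.
    by rewrite mulr0 mulr_ge0 ?tail_weight_ge0.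
  rewrite mulr1; have [xe|xe] := leP `|x| eta.
    apply: (@le_trans _ _ (6 * k%:R `^ (r - 2) * tail_weight 1 x)); last first.
      by rewrite ler_wpM2r ?tail_weight_ge0// lerDl mulr_ge0 ?powR_ge0// mulr_ge0.
    apply: (le_trans (ler_wpM2l (powR_ge0 _ _) (Heta x xe))).
    rewrite mulrCA -powR_scale//.
    set y := `|x / Num.sqrt (h n)|.
    have yk : k%:R < y by rewrite /y normrM normfV (gtr0_norm (sh0 n)) ltr_pdivlMr.
    have y0 : 0 < y by exact: lt_trans yk.
    (* Here r < 2 is decisive: y^(r - 2) decreases, so it is at most k^(r - 2), and h y^2 = x^2 no
       longer involves h. *)
    have -> : y `^ r = y `^ (r - 2) * y ^+ 2.
      by rewrite -powR_mulrn ?ltW// -powRD ?subrK// gt_eqF ?implybT.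
    have yk2 : y `^ (r - 2) <= k%:R `^ (r - 2).
      rewrite -(opprB 2 r) !powRN lef_pV2 ?posrE ?powR_gt0//.
      by rewrite ge0_ler_powR ?nnegrE ?ltW.
    have hy : h n * y ^+ 2 = x ^+ 2.
      rewrite /y real_normK ?num_real// expr_div_n sqr_sqrtr ?ltW//.
      by rewrite mulrC divfK ?gt_eqF.
    have x1 : x ^+ 2 <= 1.
      rewrite -(real_normK (num_real x)) expr_le1// (le_trans xe)//.
      by rewrite ge_min lexx orbT.
    have xW := sqr_le_tail_weight x1.
    rewrite (_ : 2 * _ = y `^ (r - 2) * (2 * (h n * y ^+ 2))); last by ring.
    rewrite hy (_ : 6 * _ * _ = k%:R `^ (r - 2) * (2 * (3 * tail_weight 1 x))); last by ring.
    have xW2 : 2 * x ^+ 2 <= 2 * (3 * tail_weight 1 x) by rewrite ler_pM2l.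
    by apply: ler_pM => //; [exact: powR_ge0|rewrite mulr_ge0 ?sqr_ge0].
  apply: (@le_trans _ _ (h n `^ (1 - r / 2) * (ML * Ceta) * tail_weight 1 x)); last first.
    by rewrite ler_wpM2r ?tail_weight_ge0// lerDr mulr_ge0 ?powR_ge0.
  rewrite -mulrA ler_wpM2l ?powR_ge0//.
  have CW : 1 <= Ceta * tail_weight 1 x.
    have ex : eta ^+ 2 <= x ^+ 2.
      by rewrite -(real_normK (num_real x)) lerXn2r// ?nnegrE ltW.
    rewrite -{1}[x]mul1r in ex.
    have := tail_weight_lower (ltW eta2) ex.
    move=> /(ler_wpM2l Ceta0); apply: le_trans.
    rewrite /Ceta le_eqVlt; apply/orP; left; apply/eqP; field.
    by rewrite (gt_eqF eta_gt0) gt_eqF// ltr_pwDl// ltW.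
  apply: (@le_trans _ _ ML); last by rewrite -mulrA ler_peMr.
  apply: (le_trans (Hf x)); rewrite ler_wpM2l// lerD2l lerXn2r// nnegrE// invr_ge0 ltW//.
apply: (le_trans (increment_sum_exceed_le levyX (Num.truncn (t / h n)) (ltW (h0 n)) a0
  (measurable_power_tail n k) mphi phiM qphi)).
rewrite lee_fin.
have iW q : P.-integrable setT (EFin \o (fun w => tail_weight q (X (h n) w))).
  apply: (bounded_integrable (M := 1)); first exact: probability_lty.
    exact: measurableT_comp (measurable_tail_weight q) _.
  by move=> w; rewrite ger0_norm ?tail_weight_ge0 ?tail_weight_le1.
have -> : \int[P]_w phi (X (h n) w) = 3 * (\int[P]_w tail_weight s (X (h n) w)) +
    a^-1 * Cn * (\int[P]_w tail_weight 1 (X (h n) w)).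
  rewrite -!RintegralZl// -RintegralD//.
  - exact: (integrableZl measurableT 3 (iW s)).
  - exact: (integrableZl measurableT (a^-1 * Cn) (iW 1)).
rewrite mulrDr mulrCA [X in _ + X]mulrCA.
have kaps0 : 0 <= kap s.
  by rewrite mulr_ge0// addr_ge0 ?mulr_ge0 ?(ltW c_gt0) ?(ltW s0) ?small_jump_mass_ge0.
have b1 : (Num.truncn (t / h n))%:R * (\int[P]_w tail_weight s (X (h n) w)) <= t * (kap s + h n * K2).
  by apply: truncn_mul_le (tw n s s01) => //; rewrite addr_ge0// mulr_ge0// ltW.
have b2 : (Num.truncn (t / h n))%:R * (\int[P]_w tail_weight 1 (X (h n) w)) <= t * C1.
  apply: truncn_mul_le => //; apply: (le_trans (tw n 1 one01)).
  by rewrite ler_pM2l// lerD2l ler_piMl.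
have hK2' : h n * K2 <= eps / 4 / (3 * t).
  have K21 : 0 < K2 + 1 by rewrite ltr_wpDl.
  move: hK2; rewrite ler_pdivlMr//; apply: le_trans.
  by rewrite ler_pM2l// lerDl.
have p1 : 3 * (t * (kap s + h n * K2)) <= eps / 4 + eps / 4.
  have : kap s + h n * K2 <= eps / 4 / (3 * t) + eps / 4 / (3 * t) by exact: lerD.
  rewrite -mulrDl ler_pdivlMr ?mulr_gt0//.
  by rewrite mulrA mulrC.
have p2 : a^-1 * Cn * (t * C1) <= eps / 4 + eps / 4.
  have tC1 : t * C1 <= t * C1 + 1 by rewrite lerDl.
  apply: (@le_trans _ _ (a^-1 * Cn * (t * C1 + 1))); first by rewrite ler_wpM2l.
  have q1 : 6 * k%:R `^ (r - 2) * (t * C1 + 1) <= a * (eps / 4).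
    move: Hk; rewrite ler_pdivlMr// ler_pdivlMr//.
    by rewrite mulrAC [_ * 6]mulrC.
  have q2 : h n `^ (1 - r / 2) * (ML * Ceta) * (t * C1 + 1) <= a * (eps / 4).
    have MC : 0 < ML * Ceta + 1 by rewrite ltr_wpDl// mulr_ge0.
    move: hML; rewrite ler_pdivlMr// ler_pdivlMr// mulrAC; apply: le_trans.
    by rewrite ler_wpM2r ?(ltW C11)// ler_wpM2l ?powR_ge0// lerDl.
  rewrite -mulrA mulrC ler_pdivrMr// [leRHS]mulrC [leRHS]mulrDr [leLHS]mulrDl; exact: lerD.
have b1' := ler_wpM2l (ler0n R 3) b1.
have b2' := ler_wpM2l aCn b2.
have -> : eps = eps / 4 + eps / 4 + (eps / 4 + eps / 4) by field.
by apply: lerD; [exact: le_trans b1' p1|exact: le_trans b2' p2].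
Unshelve. all: by end_near. Qed.

(** In the absence of jumps X_h / sqrt h is Gaussian with bounded mean, so beyond k any power and
    polynomial factor is beaten by an exponential moment, at the price e^(-k). *)
Lemma power_tail_no_jump : (forall A : set R, measurable A -> F A = 0%E) ->
  forall t a eps : R, 0 < t -> 0 < a -> 0 < eps ->
  forall k0 : nat, exists2 k : nat, (k0 <= k)%N &
  \forall n \near \oo,
   (P [set w | (a < increment_sum X (h n) (power_tail n k) (Num.truncn (t / h n)) w)%R] <= eps%:E)%E.
Proof.
move=> F0 t a eps t0 a0 eps0 k0.
have [eta eta0 Heta0] := class_E_near0 r0 fE ltr01.
have [Kf Kf0 [p Hf]] := class_E_growth fE.
(* Away from 0, 1 <= |x|^r / eta^r lets the factor |x|^r be kept for all x; it is what turns h^(1 -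
   r/2) into h. *)
pose Cf := 2 + Kf * (eta `^ r)^-1.
have er0 : 0 < eta `^ r by exact: powR_gt0.
have Cf0 : 0 <= Cf by rewrite addr_ge0// mulr_ge0// invr_ge0 ltW.
have fle x : `|f x| <= Cf * (`|x| `^ r * (1 + `|x| ^+ p)).
  have px : 0 <= `|x| ^+ p by exact: exprn_ge0.
  have rx : 0 <= `|x| `^ r by exact: powR_ge0.
  have rpx : 0 <= `|x| `^ r * (1 + `|x| ^+ p) by rewrite mulr_ge0// addr_ge0.
  have [xe|xe] := leP `|x| eta.
    have H := Heta0 x xe; have := ler_normD (f x - `|x| `^ r) (`|x| `^ r).
    rewrite subrK (ger0_norm rx) => H'.
    apply: (@le_trans _ _ (2 * (`|x| `^ r * (1 + `|x| ^+ p)))); last first.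
      by rewrite ler_wpM2r// lerDl mulr_ge0// invr_ge0 ltW.
    have : `|x| `^ r <= `|x| `^ r * (1 + `|x| ^+ p) by rewrite ler_peMr// lerDl.
    by move: H; rewrite mul1r; lra.
  apply: (le_trans (Hf x)).
  apply: (@le_trans _ _ (Kf * (eta `^ r)^-1 * (`|x| `^ r * (1 + `|x| ^+ p)))); last first.
    by rewrite ler_wpM2r// lerDr.
  rewrite -mulrA ler_wpM2l// mulrA ler_peMl ?addr_ge0//.
  rewrite mulrC ler_pdivlMr// mul1r.
  by apply: ge0_ler_powR; rewrite ?nnegrE ?normr_ge0// ltW.
have [Kr Kr0 Hr] := powR_le_expR (ltW r0).
pose C3 := Cf * (Kr * (1 + p`!%:R)).
have C30 : 0 <= C3 by rewrite mulr_ge0// mulr_ge0 ?ltW// addr_ge0.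
pose Ge := expR (3 * `|b|) * G (3 * Num.sqrt c).
have Ge0 : 0 <= Ge by rewrite mulr_ge0 ?expR_ge0.
have aC0 : 0 <= a^-1 * C3 * Ge.
  by apply: mulr_ge0 => //; apply: mulr_ge0 => //; rewrite invr_ge0 ltW.
have tC : 0 < t * (a^-1 * C3 * Ge) + 1.
  by rewrite ltr_wpDl// mulr_ge0// ltW.
have [k1 _ Hk1] : \forall k \near \oo, expR (- k%:R) <= eps / (t * (a^-1 * C3 * Ge) + 1).
  by apply: cvg0_near_le; [rewrite divr_gt0|exact: cvgn_expR].
exists (maxn k0 k1); first exact: leq_maxl.
set k := maxn k0 k1; have {Hk1}Hk := Hk1 k (leq_maxr _ _).
near=> n.
have hn1 : h n <= 1 by near: n; exact: cvg0_near_le.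
have shn1 : Num.sqrt (h n) <= 1 by rewrite -[leRHS](@sqrtr1 R) ler_sqrt.
have hn := h0 n.
(* Of the three exponentials e^y, one bounds |y|^r and one the polynomial; the third, as e^(y - k)
   >= 1 on y >= k, pays for the truncation. *)
pose psi x := a^-1 * (h n * C3) * expR (3 * `|x / Num.sqrt (h n)| - k%:R).
have hC : 0 <= a^-1 * (h n * C3).
  by apply: mulr_ge0; [rewrite invr_ge0 ltW|rewrite mulr_ge0// ltW].
have psi0 x : 0 <= psi x by rewrite mulr_ge0 ?expR_ge0.
(* Capping at 1 makes the function bounded, and where the cap acts the alternative 1 <= phi
   holds. *)
pose phi x := Num.min (psi x) 1.
have mpsi : measurable_fun setT psi.
  apply: measurable_funM => //; apply: measurableT_comp => //; apply: measurable_funB => //.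
  by apply: measurable_funM => //; apply: measurableT_comp => //; exact: measurable_funM.
have mphi : measurable_fun setT phi by exact: measurable_minr.
have phi01 x : 0 <= phi x <= 1 by rewrite le_min psi0 ler01/= ge_min lexx orbT.
have qpsi x : power_tail n k x <= a * psi x.
  rewrite /psi mulrA mulVKf ?gt_eqF// /power_tail indicE.
  set y := `|x / Num.sqrt (h n)|.
  have [/set_mem/= xk|_] := boolP (x \in _); last by rewrite mulr0 mulr_ge0 ?expR_ge0// mulr_ge0// ltW.
  have yk : k%:R <= y by rewrite /y normrM normfV (gtr0_norm (sh0 n)) ler_pdivlMr// ltW.
  have y0 : 0 <= y by exact: normr_ge0.
  (* Since h <= 1, the unscaled factor 1 + |x|^p is bounded by its scaled version. *)
  have xy : `|x| <= y.
    by rewrite /y normrM normfV (gtr0_norm (sh0 n)) ler_peMr// -[leLHS]invr1 lef_pV2 ?posrE.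
  rewrite mulr1; apply: (le_trans (ler_wpM2l (powR_ge0 _ _) (fle x))).
  rewrite mulrCA [_ `^ _ * (_ * _)]mulrA -powR_scale// -/y.
  rewrite (_ : h n * C3 * _ = Cf * (h n * (Kr * (1 + p`!%:R)) * expR (3 * y - k%:R))); last first.
    by rewrite /C3; ring.
  rewrite ler_wpM2l// -!mulrA ler_pM2l//.
  have e1 : 1 <= expR y by rewrite -[leLHS]expR0 ler_expR.
  have xp : 1 + `|x| ^+ p <= (1 + p`!%:R) * expR y.
    rewrite mulrDl mul1r lerD// (le_trans _ (exprn_le_expR p y0))//.
    by rewrite lerXn2r.
  apply: (@le_trans _ _ (Kr * expR y * ((1 + p`!%:R) * expR y))).
    by rewrite ler_pM ?powR_ge0 ?Hr// addr_ge0// exprn_ge0.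
  rewrite (_ : Kr * _ * _ = Kr * ((1 + p`!%:R) * (expR y * expR y))); last by ring.
  rewrite ler_pM2l// ler_wpM2l ?addr_ge0// -expRD ler_expR.
  by lra.
have qphi x : power_tail n k x <= a * phi x \/ 1 <= phi x.
  rewrite /phi; have [p1|p1] := leP (psi x) 1; [left; exact: qpsi|by right].
apply: (le_trans (increment_sum_exceed_le levyX (Num.truncn (t / h n)) (ltW (h0 n)) a0
  (measurable_power_tail n k) mphi phi01 qphi)).
rewrite lee_fin.
have phi1 x : `|phi x| <= 1 by have /andP[q0 q1] := phi01 x; rewrite ger0_norm.
rewrite (levy_no_jump_law charX c_gt0 hn F0 mphi phi1).
have mlin : measurable_fun (setT : set (measurableTypeR R))
    (fun x : R => b * h n + Num.sqrt (h n) * (Num.sqrt c * x)).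
  by apply: measurable_funD => //; apply: measurable_funM => //; exact: measurable_funM.
have iexp := integrable_expR_normal_prob (3 * Num.sqrt c) (@ltr01 R).
have bnd : \int[N01]_x phi (b * h n + Num.sqrt (h n) * (Num.sqrt c * x)) <=
    h n * (a^-1 * C3 * Ge * expR (- k%:R)).
  have -> : h n * (a^-1 * C3 * Ge * expR (- k%:R)) =
      \int[N01]_x (a^-1 * (h n * C3) * (expR (3 * `|b|) * expR (- k%:R)) * expR (3 * Num.sqrt c * `|x|)).
    by rewrite RintegralZl// /Ge /G; ring.
  apply: le_Rintegral => //.
  - apply: (bounded_integrable (M := 1)); first exact: probability_lty.
      exact: measurableT_comp mphi mlin.
    by move=> x; exact: phi1.
  - exact: (integrableZl measurableT _ iexp).
  move=> x _; apply: (@le_trans _ _ (psi (b * h n + Num.sqrt (h n) * (Num.sqrt c * x)))).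
    by rewrite ge_min lexx.
  rewrite /psi -[leRHS]mulrA; apply: ler_wpM2l; first exact: hC.
  rewrite -!expRD ler_expR.
  (* After scaling, the drift is b sqrt h, at most |b| in absolute value, whence the constant e^(3
     |b|) in [Ge]. *)
  have -> : (b * h n + Num.sqrt (h n) * (Num.sqrt c * x)) / Num.sqrt (h n) =
      b * Num.sqrt (h n) + Num.sqrt c * x.
    rewrite -{1}(sqr_sqrtr (ltW hn)); field.
    by rewrite gt_eqF.
  have := ler_normD (b * Num.sqrt (h n)) (Num.sqrt c * x).
  rewrite !normrM !(ger0_norm (sqrtr_ge0 _)).
  have : `|b| * Num.sqrt (h n) <= `|b| by rewrite ler_piMr.
  by rewrite -mulrA; lra.
apply: le_trans (truncn_mul_le t0 _ bnd) _.
  by rewrite mulr_ge0 ?expR_ge0.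
move: Hk; rewrite ler_pdivlMr//; apply: le_trans.
rewrite mulrA mulrC ler_pM2l ?expR_gt0// lerDl//.
Unshelve. all: by end_near. Qed.

End power.
End power_variation_limit.

Theorem theorem2p2 (R : realType) (d : measure_display)
    (T : measurableType d) (P : probability T R) (X : R -> {RV P >-> R})
    (b c : R) (F : {measure set R -> \bar R})
    (levyX : levy_process X) (charX : has_characteristics X b c F)
    (c_gt0 : 0 < c)
    (D : nat -> R) (D_gt0 : forall n, 0 < D n) (D_cvg0 : D n @[n --> \oo] --> 0) :
  (forall (r : R) (f : R -> R), class_E r f ->
     0 < r < 2 \/ (2 <= r /\ forall A : set R, measurable A -> F A = 0%E) ->
     ucp_cvg P
       (fun n t w => D n `^ (1 - r / 2) * power_variation X (D n) f t w)
       (fun t _ => c `^ (r / 2) * gaussian_moment r * t)) /\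
  (forall f : R -> R, measurable_fun setT f -> [bounded f x | x in setT] ->
     ucp_cvg P
       (fun n t w => D n * normalized_power_variation X (D n) f t w)
       (fun t _ => t * gaussian_expectation (fun u => f (Num.sqrt c * u)))).
Proof.
split=> [r f fE rP|f mf [M [_ fM]]].
  have r0 : 0 < r by case: rP => [/andP[]//|[r2 _]]; exact: lt_le_trans r2.
  apply: (power_ucp_of_tail levyX charX c_gt0 D_gt0 D_cvg0 r0 fE).
  case: rP => [/andP[_ r2]|[_ F0]].
    exact: (power_tail_jump levyX charX c_gt0 D_gt0 D_cvg0 r0 fE r2).
  exact: (power_tail_no_jump levyX charX c_gt0 D_gt0 D_cvg0 r0 fE F0).
(* Boundedness provides a bound only for reals strictly above [M], hence [M + 1]. *)
have fM' x : `|f x| <= M + 1 by apply: fM; rewrite ?ltrDl.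
have := normalized_ucp levyX charX c_gt0 D_gt0 D_cvg0 mf fM'.
rewrite (_ : (fun t _ => _) = (fun t (_ : T) => t * gaussian_expectation (fun u => f (Num.sqrt c * u)))) //.
apply/funext => t; apply/funext => w.
by rewrite mulrC /gaussian_expectation unlock.
Qed.
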